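(* Let $X$ be a real separable Hilbert space and let $\{U(t,s)\}_{s\le t}$, $\{B(t)\}_{t\in\mathbb R}$ satisfy assumptions (A1)--(A4) of the context. Then for every $p\in(1,\infty)$ there exists a positive constant $c_p$ such that $$\|P_{s,t}f-m_t(f)\|_{L^p(X,\gamma_s)}\le c_p\,\|U(t,s)_{|\mathcal H_s}\|_{\mathscr L(\mathcal H_s,\mathcal H_t)}\,\|f\|_{L^p(X,\gamma_t)},\qquad f\in L^p(X,\gamma_t),\ s<t,$$ where $m_t(f)=\int_Xf\,d\gamma_t$ for $t\in\mathbb R$ and $f\in L^p(X,\gamma_t)$.
   Context: Assumptions. (A1) $\{U(t,s)\}_{s\le t}\subseteq\mathscr L(X)$ is a strongly continuous evolution operator: $(s,t)\mapsto U(t,s)x$ is continuous for every $x\in X$, $U(t,t)=I$ and $U(t,r)U(r,s)=U(t,s)$ for $s\le r\le t$. (A2) $\{B(t)\}_{t\in\mathbb R}\subseteq\mathscr L(X)$, $\sup_{t}\|B(t)\|_{\mathscr L(X)}<\infty$, and $t\mapsto B(t)x$ is measurable for every $x\in X$. (A3) With $Q(r):=B(r)B(r)^\star$, for every $s<t$ the operator $Q(t,s)=\int_s^tU(t,r)Q(r)U(t,r)^\star\,dr$ has finite trace. (A4) For every $t\in\mathbb R$, $\sup_{s<t}\mathrm{Tr}[Q(t,s)]<\infty$, and $\lim_{s\to-\infty}U(t,s)x=0$ for every $x\in X$. $P_{t,t}=I$ and, for $s<t$ and $\varphi$ bounded Borel, $P_{s,t}\varphi(x)=\int_X\varphi(y)\,\mathcal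 N_{U(t,s)x,Q(t,s)}(dy)$, where $\mathcal N_{a,Q}$ is the Gaussian measure with mean $a$ and covariance $Q$. Put $Q(t,-\infty)=\int_{-\infty}^tU(t,r)Q(r)U(t,r)^\star\,dr$ and $\gamma_t=\mathcal N_{0,Q(t,-\infty)}$. For every $p\in[1,\infty)$, $P_{s,t}$ extends to a bounded operator $L^p(X,\gamma_t)\to L^p(X,\gamma_s)$ with norm $1$, still denoted $P_{s,t}$. $\mathcal H_t$ is the Cameron–Martin space of $\gamma_t$: $\mathcal H_t=Q(t,-\infty)^{1/2}(X)$ with norm $\|h\|_{\mathcal H_t}=\|Q(t,-\infty)^{-1/2}h\|_X$, where $Q(t,-\infty)^{-1/2}h$ is the unique $z\in(\ker Q(t,-\infty)^{1/2})^\perp$ with $Q(t,-\infty)^{1/2}z=h$. Under the assumptions $U(t,s)$ maps $\mathcal H_s$ into $\mathcal H_t$ with norm at most $1$. *)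

(* Defs.v *)
From HB Require Import structures.
From mathcomp Require Import all_boot all_order all_algebra.
From mathcomp Require Import all_classical all_reals all_analysis.

Set Implicit Arguments.
Unset Strict Implicit.
Unset Printing Implicit Defensive.
Import Order.TTheory GRing.Theory Num.Theory.
Import numFieldNormedType.Exports.

Local Open Scope classical_set_scope.
Local Open Scope ring_scope.

(* A real Hilbert space is a complete normed space X together with a dot
   product that induces its norm. Objects that the theory characterizes
   uniquely (adjoint, square root, Gaussian measure and so on) are picked with
   [get], which returns a default value when the describing set is empty; each
   comment below says why it is not empty where the object is used. *)
Definition induces_norm (R : realType) (X : completeNormedModType R)
    (dot : {dot X for idfun}) : Prop :=
  forall x : X, dot x x = `|x| ^+ 2.

Definition separable (T : topologicalType) : Prop :=
  exists D : set T, countable D /\ dense D.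

Definition borel (T : ptopologicalType) := g_sigma_algebraType (@open T).

(* sup { nW (L v) : v in D, nV v <= 1 }, for norms nV on D and nW on the
   target. *)
Definition operator_norm (R : realType) (V W : Type) (D : set V)
    (nV : V -> R) (nW : W -> R) (L : V -> W) : \bar R :=
  ereal_sup [set (nW (L v))%:E | v in [set v | D v /\ nV v <= 1]].

(* The normal law on R with mean m and variance v, a Dirac mass when v = 0. *)
Definition normal_law (R : realType) (m v : R) (A : set (measurableTypeR R)) :
    \bar R :=
  if v == 0 then \d_(m : measurableTypeR R) A
  else normal_prob m (Num.sqrt v) A.

Section Operators.
Context (R : realType) (X : completeNormedModType R) (dot : {dot X for idfun}).

Definition bounded_operator (A : X -> X) : Prop := linear A /\ continuous A.

Definition norm_LX (A : X -> X) : \bar R :=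
  operator_norm [set: X] (@Num.norm R X) (@Num.norm R X) A.

(* Nonempty for a bounded operator A by the Riesz representation theorem. *)
Definition adjoint (A : X -> X) : X -> X :=
  get [set A' | bounded_operator A' /\
    forall x y, dot (A x) y = dot x (A' y)].

Definition nonneg_operator (A : X -> X) : Prop :=
  [/\ bounded_operator A,
      forall x y, dot (A x) y = dot x (A y)
    & forall x, 0 <= dot (A x) x].

(* The nonnegative square root; every nonnegative A has exactly one. *)
Definition sqrt_operator (A : X -> X) : X -> X :=
  get [set S | nonneg_operator S /\ forall x, S (S x) = A x].

Definition orthonormal_basis (E : set X) : Prop :=
  [/\ forall e, E e -> dot e e = 1,
      forall e e', E e -> E e' -> e <> e' -> dot e e' = 0
    & forall x, (forall e, E e -> dot x e = 0) -> x = 0].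

(* The trace of a nonnegative operator, computed in one orthonormal basis (its
   value, possibly +oo, does not depend on the basis). *)
Definition trace (A : X -> X) : \bar R :=
  let E := get orthonormal_basis in
  \esum_(e in E) (dot (A e) e)%:E.

(* The integral of F over D, taken weakly. For the integrands below r |-> F r x
   is weakly measurable and absolutely integrable for every x, and X is
   separable, so that this is also the Bochner integral of r |-> F r x. *)
Definition operator_integral (D : set R) (F : R -> X -> X) : X -> X :=
  get [set A | bounded_operator A /\ forall x y,
    (@lebesgue_measure R).-integrable D (fun r => (dot (F r x) y)%:E) /\
    dot (A x) y = \int[@lebesgue_measure R]_(r in D) dot (F r x) y].

(* mu = N_{a,Q}: the law of x |-> <x,h> is normal with mean <a,h> and variance
   <Qh,h>, for every h. *)
Definition is_gaussian (a : X) (Q : X -> X)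
    (mu : probability (borel X) R) : Prop :=
  forall (h : X) (A : set (measurableTypeR R)), measurable A ->
    pushforward mu (fun x : borel X => dot (x : X) h : measurableTypeR R) A
    = normal_law (dot a h) (dot (Q h) h) A.

(* Such a measure exists and is unique when Q is nonnegative of finite trace
   and X is separable. *)
Definition gaussian (a : X) (Q : X -> X) : probability (borel X) R :=
  get (is_gaussian a Q).

(* A^{-1/2} h: the solution of A^{1/2} z = h in the orthogonal complement of
   ker A^{1/2}. *)
Definition inv_sqrt_operator (A : X -> X) (h : X) : X :=
  get [set z | sqrt_operator A z = h /\
    forall y, sqrt_operator A y = 0 -> dot z y = 0].

Definition cm_space (A : X -> X) : set X := range (sqrt_operator A).

Definition cm_norm (A : X -> X) (h : X) : R := `|inv_sqrt_operator A h|.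

End Operators.

Section Evolution.
Context (R : realType) (X : completeNormedModType R) (dot : {dot X for idfun}).
Context (U : R -> R -> X -> X) (B : R -> X -> X).

(* U t s is only constrained for s <= t. *)
Definition evolution_operator : Prop :=
  [/\ forall s t, s <= t -> bounded_operator (U t s),
      forall x, {within [set st : R * R | st.1 <= st.2],
        continuous (fun st : R * R => U st.2 st.1 x)},
      forall t x, U t t x = x
    & forall s r t x, s <= r -> r <= t -> U t r (U r s x) = U t s x].

Definition bounded_strongly_measurable : Prop :=
  [/\ forall t, bounded_operator (B t),
      (ereal_sup [set norm_LX (B t) | t in [set: R]] < +oo)%E
    & forall x, measurable_fun [set: measurableTypeR R]
        (fun t : measurableTypeR R => B t x : borel X)].

(* U(t,r) B(r) B(r)^* U(t,r)^*. *)
Definition Q_integrand (t r : R) : X -> X :=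
  U t r \o B r \o adjoint dot (B r) \o adjoint dot (U t r).

Definition Q_ (t s : R) : X -> X :=
  operator_integral dot `[s, t] (Q_integrand t).

Definition Q_infty (t : R) : X -> X :=
  operator_integral dot `]-oo, t] (Q_integrand t).

Definition finite_traces : Prop :=
  forall s t, s < t -> (trace dot (Q_ t s) < +oo)%E.

Definition stable : Prop :=
  (forall t,
    ereal_sup [set trace dot (Q_ t s) | s in [set s | (s < t)%R]] < +oo)%E /\
  (forall t x, U t s x @[s --> -oo] --> (0 : X)).

Definition gamma (t : R) : probability (borel X) R :=
  gaussian dot 0 (Q_infty t).

(* P_{s,t} on bounded Borel functions, for s <= t. *)
Definition transition (s t : R) (phi : borel X -> R) (x : borel X) : R :=
  if s == t then phi x
  else \int[gaussian dot (U t s x) (Q_ t s)]_y phi y.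

Definition bounded_borel (phi : borel X -> R) : Prop :=
  measurable_fun [set: borel X] phi /\ exists M, forall x, `|phi x| <= M.

(* A representative of P_{s,t} f for the extension by density of P_{s,t} to an
   operator L^p(gamma_t) -> L^p(gamma_s): the L^p(gamma_s) limit of
   P_{s,t} phi_n for bounded Borel phi_n converging to f in L^p(gamma_t). *)
Definition transition_Lp (p s t : R) (f : borel X -> R) : borel X -> R :=
  get [set g | g \in Lfun (gamma s) p%:E /\
    exists phi : nat -> borel X -> R,
      [/\ forall n, bounded_borel (phi n),
          ('N[gamma t]_p%:E [EFin \o (phi n \- f)%R])%E @[n --> \oo]
            --> 0%E
        & ('N[gamma s]_p%:E [EFin \o (transition s t (phi n) \- g)%R])%E
            @[n --> \oo] --> 0%E]].

Definition mean (t : R) (f : borel X -> R) : R := \int[gamma t]_x f x.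

(* The norm of the restriction of U(t,s) in L(H_s, H_t), where H_t is the
   Cameron-Martin space of gamma_t. *)
Definition norm_U_cm (t s : R) : \bar R :=
  operator_norm (cm_space dot (Q_infty s)) (cm_norm dot (Q_infty s))
    (cm_norm dot (Q_infty t)) (U t s).

End Evolution.

(* Main.v *)
(* Let r be the norm of U(t,s) from H_s to H_t; in terms of the covariances this
   says that U Q_s U^* <= r^2 Q_t as quadratic forms, with Q_s = Q(s,-oo) and
   Q_t = Q(t,-oo). Let T f(x) be the mean of f((x + w) / sqrt 2) over w of law
   gamma_t. When a^2 r^2 <= 1, put P_a f(x) = E f(a U x + y) with y centered
   Gaussian of covariance Q_t - a^2 U Q_s U^*. Then P_1 = P_{s,t}, every P_a is a
   contraction from L^p(gamma_t) to L^p(gamma_s), and P_a = P_{a sqrt 2} T, so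
   that P_{s,t} = P_{2^(k/2)} T^k whenever 2^k r^2 <= 1. It remains to see that
   T^k f - m_t(f) is O(2^(-k/2)) in L^p. By rotation invariance, 2 T f(x) is the
   mean of f(y1) + f(y2), where y1 and y2 are independent of law gamma_t. For f
   of mean zero the L^2 norm therefore drops by sqrt 2; expanding
   |f(y1) + f(y2)|^p gives the same rate for p > 2 by induction on k, and p < 2
   follows by duality because T is symmetric. *)

(* The induction on k for p > 2 closes because 2^p multiplies the integral of |T f|^p, while the
   leading terms |f(y1)|^p + |f(y2)|^p give only twice the integral of |f|^p. This part shrinks by
   2^(1-p) per step, which is below the wanted 2^(-p/2) exactly when p > 2. The slack absorbs a
   small multiple of the same integral coming from Young's inequality, and the other terms are
   controlled by the L^2 norm, which already decays at the wanted rate. For p < 2 the slack is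
   negative, hence the detour by duality. The number r need not be a power of sqrt 2: rounding it to
   one costs only a constant, and for r = 0 the number of steps tends to infinity. All constants
   depend on p alone because the decay of T^k is proved for all rotation invariant laws at once. Two
   things have to be supplied besides. Gaussian laws must exist for [gaussian] to mean anything;
   they are built from independent normal variables on the unit interval. And [transition_Lp] may
   pick any limit, so the bound is shown for every admissible one. *)
Require Import Defs.
From HB Require Import structures.
From mathcomp Require Import all_boot all_order all_algebra.
From mathcomp Require Import all_classical all_reals all_analysis.
From mathcomp Require Import measurable_realfun.
From mathcomp Require Import ring lra.
Import Order.TTheory GRing.Theory Num.Theory.
Import numFieldNormedType.Exports.
Local Open Scope classical_set_scope.
Local Open Scope ring_scope.

Set Implicit Arguments.
Unset Strict Implicit.
Unset Printing Implicit Defensive.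

(** * Linear maps and inner products *)

Section LinearProp.
Context (R : pzRingType) (V W : lmodType R) (A : V -> W).
Hypothesis linA : linear A.

Lemma linear0P : A 0 = 0.
Proof. by have := linA (-1) 0 0; rewrite !scaleN1r addr0 oppr0 addNr. Qed.

Lemma linearDP x y : A (x + y) = A x + A y.
Proof. by have := linA 1 x y; rewrite !scale1r. Qed.

Lemma linearZP a x : A (a *: x) = a *: A x.
Proof. by have := linA a x 0; rewrite linear0P !addr0. Qed.

Lemma linearNP x : A (- x) = - A x.
Proof. by rewrite -!scaleN1r linearZP. Qed.

Lemma linearBP x y : A (x - y) = A x - A y.
Proof. by rewrite linearDP linearNP. Qed.

Lemma linear_sumP I (r : seq I) (P : pred I) F :
  A (\sum_(i <- r | P i) F i) = \sum_(i <- r | P i) A (F i).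
Proof. by elim/big_rec2 : _ => [|i y1 y2 _ <-]; [exact: linear0P|exact: linearDP]. Qed.

End LinearProp.

Lemma quadratic_linear_coef_eq0 (R : realFieldType) (a b : R) :
  (forall t, 0 <= t * a + t ^+ 2 * b) -> a = 0.
Proof.
move=> H; apply/eqP/negPn/negP => a0.
have b0 : 0 <= b by have := H 1; have := H (-1); rewrite sqrrN; lra.
have d0 : 0 < 1 + b by lra.
(* The minimiser would divide by 2 * b, which may vanish; 1 + b is positive and still gives the
   negative value - a^2 / (1 + b)^2. *)
have := H (- a / (1 + b)); have -> : - a / (1 + b) * a + (- a / (1 + b)) ^+ 2 * b =
  - (a ^+ 2 / (1 + b) ^+ 2) by field; rewrite gt_eqF.
rewrite oppr_ge0 leNgt => /negP; apply.
by apply: divr_gt0; [rewrite exprn_even_gt0|rewrite exprn_gt0].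
Qed.

Lemma cauchy_sequence_cvg (R : realType) (V : completeNormedModType R) (u : nat -> V) :
  (forall e : R, 0 < e -> exists N, forall i j, (N <= i)%N -> (N <= j)%N ->
     `|u i - u j| < e) -> exists l : V, u @ \oo --> l.
Proof.
move=> H; suff : cvg (u @ \oo) by move=> ?; exists (lim (u @ \oo)).
apply: cauchy_cvg; apply/cauchy_ballP => e e0.
have [N HN] := H e e0.
exists (u @` [set i | (N <= i)%N], u @` [set i | (N <= i)%N]) => /=.
  by split; exists N => // i Ni /=; exists i.
by move=> [x y] [/= [i Ni <-] [j Nj <-]]; rewrite -ball_normE /=; exact: HN.
Qed.

Section Hilbert.
Context (R : realType) (X : completeNormedModType R) (dot : {dot X for idfun}).
Hypothesis normE : induces_norm dot.
Implicit Types x y z : X.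

Lemma dotC x y : dot x y = dot y x.
Proof. by rewrite hermC /= expr0 mul1r. Qed.

Lemma dotDl x y z : dot (x + y) z = dot x z + dot y z.
Proof. exact: linearDl. Qed.

Lemma dotDr x y z : dot x (y + z) = dot x y + dot x z.
Proof. exact: raddfD. Qed.

Lemma dotZl a x y : dot (a *: x) y = a * dot x y.
Proof. by rewrite linearZl_LR. Qed.

Lemma dotZr a x y : dot x (a *: y) = a * dot x y.
Proof. by rewrite linearZ. Qed.

Lemma dotNl x y : dot (- x) y = - dot x y.
Proof. by rewrite -scaleN1r dotZl mulN1r. Qed.

Lemma dotNr x y : dot x (- y) = - dot x y.
Proof. by rewrite -scaleN1r dotZr mulN1r. Qed.

Lemma dotBl x y z : dot (x - y) z = dot x z - dot y z.
Proof. by rewrite dotDl dotNl. Qed.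

Lemma dotBr x y z : dot x (y - z) = dot x y - dot x z.
Proof. by rewrite dotDr dotNr. Qed.

Lemma dot0l x : dot 0 x = 0.
Proof. by rewrite -(scale0r (0 : X)) dotZl mul0r. Qed.

Lemma dot0r x : dot x 0 = 0.
Proof. by rewrite dotC dot0l. Qed.

Lemma dot_suml I (r : seq I) (P : pred I) (F : I -> X) y :
  dot (\sum_(i <- r | P i) F i) y = \sum_(i <- r | P i) dot (F i) y.
Proof. by elim/big_rec2 : _ => [|i y1 y2 _ <-]; rewrite ?dot0l ?dotDl. Qed.

Lemma dot_sumr I (r : seq I) (P : pred I) (F : I -> X) y :
  dot y (\sum_(i <- r | P i) F i) = \sum_(i <- r | P i) dot y (F i).
Proof. by rewrite dotC dot_suml; apply: eq_bigr => i _; rewrite dotC. Qed.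

Lemma dotxx_ge0 x : 0 <= dot x x.
Proof. by rewrite normE sqr_ge0. Qed.

Lemma dotxx_eq0 x : dot x x = 0 -> x = 0.
Proof. by rewrite normE => /eqP; rewrite sqrf_eq0 normr_eq0 => /eqP. Qed.

Lemma dot_sep x : (forall y, dot x y = 0) -> x = 0.
Proof. by move=> /(_ x)/dotxx_eq0. Qed.

Lemma dot_inj x y : (forall z, dot x z = dot y z) -> x = y.
Proof.
by move=> H; apply/eqP; rewrite -subr_eq0; apply/eqP/dot_sep => z; rewrite dotBl H subrr.
Qed.

Lemma cauchy_schwarz x y : `|dot x y| <= `|x| * `|y|.
Proof.
have [->|y0] := eqVneq y 0; first by rewrite dot0r !normr0 mulr0.
have ny0 : 0 < `|y| by rewrite normr_gt0.
have := dotxx_ge0 (`|y| ^+ 2 *: x - dot x y *: y).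
rewrite dotBl !dotBr !dotZl !dotZr [dot y x]dotC !normE => H.
rewrite -(@ler_pXn2r _ 2)// ?nnegrE ?mulr_ge0// exprMn real_normK ?num_real//.
rewrite -(ler_pM2r (exprn_gt0 2 ny0)); move: H; set n := `|y| ^+ 2.
set m := `|x| ^+ 2; set d := dot x y; nra.
Qed.

Lemma dot_le x y : dot x y <= `|x| * `|y|.
Proof. exact: le_trans (ler_norm _) (cauchy_schwarz x y). Qed.

Lemma parallelogram x y :
  `|x - y| ^+ 2 = 2 * `|x| ^+ 2 + 2 * `|y| ^+ 2 - `|x + y| ^+ 2.
Proof. by rewrite -!normE dotBl !dotBr dotDl !dotDr [dot y x]dotC; ring. Qed.

Lemma dot_continuousl y : continuous (fun x => dot x y).
Proof.
move=> x; apply/cvgrPdist_lt => e e0; near=> z.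
rewrite -dotBl (le_lt_trans (cauchy_schwarz _ _))//.
rewrite (@le_lt_trans _ _ (`|x - z| * (`|y| + 1)))//; first by rewrite ler_wpM2l// lerDl.
rewrite -ltr_pdivlMr ?ltr_wpDl//; near: z.
by apply: cvgr_dist_lt => //; rewrite divr_gt0 ?ltr_wpDl.
Unshelve. all: by end_near. Qed.

Lemma dot_cvgl (u : nat -> X) x y : u @ \oo --> x -> (fun n => dot (u n) y) @ \oo --> dot x y.
Proof. by move=> H; exact: (cvg_comp u (fun z => dot z y) H (@dot_continuousl y x)). Qed.

Lemma dot_cvgr (u : nat -> X) x y : u @ \oo --> x -> (fun n => dot y (u n)) @ \oo --> dot y x.
Proof. by move=> /(@dot_cvgl _ _ y); under eq_fun do rewrite dotC; rewrite dotC. Qed.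

(* Riesz' minimisation argument for the functional k |-> |S k|^2 - 2 l k; S = id
   is the Riesz representation theorem. *)
Lemma variational_representation (S : X -> X) (l : X -> R) (c : R) :
  linear S -> (forall a x y, l (a *: x + y) = a * l x + l y) ->
  (forall k, `|l k| <= c * `|S k|) -> 0 <= c ->
  exists w, [/\ forall k, l k = dot w (S k), `|w| <= c
    & forall y, (forall k, dot (S k) y = 0) -> dot w y = 0].
Proof.
move=> lS ll lc c0.
pose J k := `|S k| ^+ 2 - 2 * l k.
have Jlb k : - c ^+ 2 <= J k.
  have := lc k; rewrite ler_norml => /andP[_ H].
  by rewrite /J; have := sqr_ge0 (`|S k| - c); set s := `|S k| in H *; nra.
pose m := inf (range J).
have hlb : has_lbound (range J) by exists (- c ^+ 2) => _ [k _ <-].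
have hinf : has_inf (range J) by split=> //; exists (J 0), 0.
have mJ k : m <= J k by apply: (ge_inf hlb); exists k.
have [k_ Hk] : {k_ : nat -> X & forall n, J (k_ n) < m + n.+1%:R^-1}.
  apply: (@choice _ _ (fun n k => J k < m + n.+1%:R^-1)) => n.
  have [_ [k _ <-] Hk] := @inf_adherent _ (range J) n.+1%:R^-1 (ltac:(by rewrite invr_gt0)) hinf.
  by exists k.
have l0 : l 0 = 0 by have := ll (-1) 0 0; rewrite scaleN1r addr0 oppr0 mulN1r addNr.
have Jexp k t h : J (k + t *: h) =
    J k + t * (2 * (dot (S k) (S h) - l h)) + t ^+ 2 * `|S h| ^+ 2.
  rewrite /J [k + _]addrC lS -normE dotDl !dotDr !dotZl !dotZr ll [dot (S h) (S k)]dotC -!normE.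
  by ring.
(* By the parallelogram identity and [mJ] at the midpoint, two almost minimisers have close images.
   Only the images converge: [k_] itself need not, which is why the representing vector is a limit
   of [S (k_ n)]. *)
have Sdiff i j : `|S (k_ i) - S (k_ j)| ^+ 2 <= 2 * i.+1%:R^-1 + 2 * j.+1%:R^-1.
  have Hi := Hk i; have Hj := Hk j.
  have := mJ (2^-1 *: (k_ i) + 2^-1 *: k_ j).
  have lmid : l (2^-1 *: (k_ i) + 2^-1 *: k_ j) = (l (k_ i) + l (k_ j)) / 2.
    by rewrite ll -[_ *: k_ j]addr0 ll l0; ring.
  have Smid : `|S (2^-1 *: (k_ i) + 2^-1 *: k_ j)| ^+ 2 = `|S (k_ i) + S (k_ j)| ^+ 2 / 4.
    rewrite (linearDP lS) !(linearZP lS) -scalerDr -normE dotZl dotZr normE; by field.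
  move: Hi Hj; rewrite parallelogram /J lmid Smid.
  set a := `|_ + _| ^+ 2; set b := i.+1%:R^-1; set d := j.+1%:R^-1; lra.
have [w Hw] : exists w : X, (fun n => S (k_ n)) @ \oo --> w.
  apply: cauchy_sequence_cvg => e e0.
  have e4 : 0 < e ^+ 2 / 4 by rewrite divr_gt0// exprn_gt0.
  have [N _ HN] := near_infty_natSinv_lt (PosNum e4).
  exists N => i j Ni Nj.
  rewrite -(@ltr_pXn2r _ 2)// ?nnegrE ?(ltW e0)//.
  apply: le_lt_trans (Sdiff i j) _.
  have Hi : i.+1%:R^-1 < e ^+ 2 / 4 := HN i Ni.
  have Hj : j.+1%:R^-1 < e ^+ 2 / 4 := HN j Nj.
  by move: Hi Hj; set a := i.+1%:R^-1; set b := j.+1%:R^-1; lra.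
(* First variation: [Jexp] along t *: k shows, in the limit, that a quadratic polynomial in t
   without constant term is nonnegative, so its linear coefficient vanishes. *)
have Ew k : l k = dot w (S k).
  apply/eqP; rewrite -subr_eq0 -oppr_eq0 opprB -(mulrI_eq0 _ (@lregP _ 2 _)) ?pnatr_eq0//.
  apply/eqP; apply: (@quadratic_linear_coef_eq0 _ _ (`|S k| ^+ 2)) => t.
  have H1 : (fun n => n.+1%:R^-1 + (t * (2 * (dot (S (k_ n)) (S k) - l k)) +
     t ^+ 2 * `|S k| ^+ 2)) @ \oo --> 0 + (t * (2 * (dot w (S k) - l k)) +
     t ^+ 2 * `|S k| ^+ 2).
    apply: cvgD; first exact: cvg_harmonic.
    apply: cvgD; last exact: cvg_cst.
    apply: cvgM; first exact: cvg_cst.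
    apply: cvgM; first exact: cvg_cst.
    by apply: cvgB; [exact: dot_cvgl|exact: cvg_cst].
  rewrite add0r in H1; apply: (ler_cvg_to (cvg_cst 0) H1); near=> n.
  have := mJ (k_ n + t *: k); rewrite Jexp; have := Hk n.
  by set a := n.+1%:R^-1; set b := t * _; set d := t ^+ 2 * _; lra.
exists w; split => //.
- have H1 : (fun n => dot (S (k_ n)) w) @ \oo --> `|w| ^+ 2 by rewrite -normE; exact: dot_cvgl.
  have H2 : (fun n => c * `|S (k_ n)|) @ \oo --> c * `|w|.
    by apply: cvgM; [exact: cvg_cst|exact: cvg_norm].
  have H3 : `|w| ^+ 2 <= c * `|w|.
    apply: (ler_cvg_to H1 H2); near=> n.
    by rewrite dotC -Ew (le_trans (ler_norm _)).
  have [->|w0] := eqVneq w 0; first by rewrite normr0.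
  by rewrite -(@ler_pM2r _ `|w|) ?normr_gt0// -expr2.
- move=> y Hy.
  have H := @dot_cvgl _ _ y Hw.
  rewrite (_ : (fun n => _) = fun=> 0) in H; last by apply/funext => n.
  exact: (cvg_unique (@norm_hausdorff _ _) H (cvg_cst 0)).
Unshelve. all: by end_near. Qed.

End Hilbert.

(** * Adjoints, square roots and ranges of operators *)

Section Operators.
Context (R : realType) (X : completeNormedModType R) (dot : {dot X for idfun}).
Hypothesis normE : induces_norm dot.
Implicit Types (x y z : X) (A : X -> X).

Lemma linear_bound_continuous (W : normedModType R) (A : X -> W) M :
  linear A -> (forall x, `|A x| <= M * `|x|) -> continuous A.
Proof.
move=> lA H; pose M' := `|M| + 1.
have M'0 : 0 < M' by rewrite ltr_wpDl.
move=> x; apply/cvgrPdist_lt => e e0; near=> z.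
rewrite -(linearBP lA) (le_lt_trans (H _))//.
rewrite (@le_lt_trans _ _ (M' * `|x - z|))//.
  by rewrite ler_wpM2r// (le_trans (ler_norm M))// lerDl.
rewrite mulrC -ltr_pdivlMr//; near: z.
by apply: cvgr_dist_lt => //; rewrite divr_gt0.
Unshelve. all: by end_near. Qed.

Lemma bounded_operator_bound A : bounded_operator A ->
  exists2 M, 0 < M & forall x, `|A x| <= M * `|x|.
Proof.
move=> [lA cA].
pose A' : {linear X -> X} := HB.pack A (GRing.isLinear.Build _ _ _ _ A lA).
have /linear_boundedP : bounded_near A' (nbhs (0 : X)) by apply: continuous_linear_bounded; exact: cA.
move=> H; near (pinfty_nbhs R) => M.
exists M; first by near: M; exact: nbhs_pinfty_gt.
by near: M; apply: H.
Unshelve. all: by end_near. Qed.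

Lemma bounded_operatorI A M : linear A -> (forall x, `|A x| <= M * `|x|) ->
  bounded_operator A.
Proof. by move=> lA H; split => //; exact: linear_bound_continuous H. Qed.

Lemma norm_le_dot x c : 0 <= c -> (forall y, dot x y <= c * `|y|) -> `|x| <= c.
Proof.
move=> c0 /(_ x); rewrite normE.
have [->|x0] := eqVneq x 0; first by rewrite normr0.
by rewrite expr2 ler_pM2r ?normr_gt0.
Qed.

(** Riesz' theorem for each first argument separately; uniqueness of the representing vector makes
    the result linear. Adjoints and weak operator integrals are both known first as such forms. *)
Lemma riesz_form (b : X -> X -> R) C : 0 <= C ->
  (forall a x y z, b (a *: x + y) z = a * b x z + b y z) ->
  (forall a x y z, b z (a *: x + y) = a * b z x + b z y) ->
  (forall x y, `|b x y| <= C * `|x| * `|y|) ->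
  exists2 A, bounded_operator A & forall x y, dot (A x) y = b x y.
Proof.
move=> C0 bl br bC.
have H x : exists w, forall k, dot w k = b x k.
  have [||||w [Hw _ _]] := @variational_representation _ _ _ normE id (b x) (C * `|x|).
  - by [].
  - by move=> a u v; exact: br.
  - by move=> k; exact: bC.
  - by rewrite mulr_ge0.
  - by exists w => k; rewrite Hw.
have [A HA] := choice H.
exists A => //; apply: (@bounded_operatorI _ C).
  by move=> a u v; apply: (dot_inj normE) => z; rewrite dotDl dotZl !HA bl.
move=> x; apply: norm_le_dot => [|y]; first by rewrite mulr_ge0.
by rewrite HA (le_trans (ler_norm _)).
Qed.

Lemma adjointP A : bounded_operator A ->
  bounded_operator (adjoint dot A) /\ forall x y, dot (A x) y = dot x (adjoint dot A y).
Proof.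
move=> bA; have [M M0 HM] := bounded_operator_bound bA.
have [lA cA] := bA.
suff H : [set A' | bounded_operator A' /\ forall x y, dot (A x) y = dot x (A' y)] !=set0.
  exact: (getPex H).
have [||||A' bA' HA'] := @riesz_form (fun y x => dot (A x) y) M.
- exact: ltW.
- by move=> a x y z; rewrite dotDr dotZr.
- by move=> a x y z; rewrite lA dotDl dotZl.
- move=> x y; rewrite (le_trans (cauchy_schwarz normE _ _))// mulrAC ler_wpM2r//.
- by exists A'; split => // x y; rewrite [RHS]dotC HA'.
Qed.

Lemma adjoint_bound A M : 0 <= M -> bounded_operator A ->
  (forall x, `|A x| <= M * `|x|) -> forall x, `|adjoint dot A x| <= M * `|x|.
Proof.
move=> M0 bA HM x; have [_ H] := adjointP bA.
apply: norm_le_dot => [|y]; first by rewrite mulr_ge0.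
rewrite dotC -H (le_trans (dot_le normE _ _))// mulrAC [leRHS]mulrAC.
by rewrite -[leRHS]mulrAC ler_wpM2r.
Qed.

Lemma nonneg_cauchy_schwarz A x y : nonneg_operator dot A ->
  dot (A x) y ^+ 2 <= dot (A x) x * dot (A y) y.
Proof.
move=> [[lA _] sA pA].
have Hq t : 0 <= dot (A x) x + t * (2 * dot (A x) y) + t ^+ 2 * dot (A y) y.
  have := pA (t *: y + x); rewrite lA dotDl !dotDr !dotZl !dotZr.
  rewrite [dot (A y) x]sA [dot y _]dotC => H; apply: le_trans H _.
  by rewrite le_eqVlt; apply/orP; left; apply/eqP; ring.
set a := dot (A x) x in Hq *; set b := dot (A x) y in Hq *; set c := dot (A y) y in Hq *.
have c0 : 0 <= c by exact: pA.
have [c00|cn0] := eqVneq c 0.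
  suff -> : b = 0 by rewrite c00 expr0n /= mulr0.
  apply/eqP/negPn/negP => b0.
  (* With c = 0 the form is affine in t, and this t gives it the value -1. *)
  have := Hq (- (a + 1) / (2 * b)); rewrite c00 mulr0 addr0.
  have -> : - (a + 1) / (2 * b) * (2 * b) = - (a + 1) by field.
  lra.
have cp : 0 < c by rewrite lt_neqAle eq_sym cn0.
have := Hq (- b / c).
have -> : a + - b / c * (2 * b) + (- b / c) ^+ 2 * c = (a * c - b ^+ 2) / c by field.
by rewrite pmulr_lge0 ?invr_gt0// subr_ge0.
Qed.

(** Cauchy-Schwarz for the form of A, applied to x and A x: |A x|^4 <= <A x, x> <A (A x), A x>. It
    makes I - A / C a contraction, from which the square root iteration starts. *)
Lemma nonneg_operator_contraction A C : nonneg_operator dot A -> 0 <= C ->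
  (forall x, `|A x| <= C * `|x|) -> forall x, `|A x| ^+ 2 <= C * dot (A x) x.
Proof.
move=> nA C0 HC x; have [_ _ pA] := nA.
have [->|Ax0] := eqVneq (`|A x|) 0; first by rewrite expr0n /= mulr_ge0.
have Axp : 0 < `|A x| ^+ 2 by rewrite exprn_gt0// lt_neqAle eq_sym Ax0/=.
have := nonneg_cauchy_schwarz x (A x) nA; rewrite normE.
have H : dot (A (A x)) (A x) <= C * `|A x| ^+ 2.
  by rewrite (le_trans (dot_le normE _ _))// expr2 mulrA ler_wpM2r.
move=> H2; rewrite -(ler_pM2r Axp) -expr2 (le_trans H2)//.
by rewrite [C * _]mulrC -mulrA ler_wpM2l.
Qed.

End Operators.

(* F is a polynomial in B with nonnegative coefficients of sum c. *)
Inductive positive_polynomial (R : realType) (X : lmodType R) (B : X -> X) :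
    (X -> X) -> R -> Prop :=
| PosPoly0 : positive_polynomial B (fun=> 0) 0
| PosPolyX : positive_polynomial B B 1
| PosPolyD F c G d : positive_polynomial B F c -> positive_polynomial B G d ->
    positive_polynomial B (fun x => F x + G x) (c + d)
| PosPolyM F c G d : positive_polynomial B F c -> positive_polynomial B G d ->
    positive_polynomial B (fun x => F (G x)) (c * d)
| PosPolyZ a F c : 0 <= a -> positive_polynomial B F c ->
    positive_polynomial B (fun x => a *: F x) (a * c).

Section SquareRoot.
Context (R : realType) (X : completeNormedModType R) (dot : {dot X for idfun}).
Hypothesis normE : induces_norm dot.
Context (B : X -> X).
Hypothesis linB : linear B.
Hypothesis symB : forall x y, dot (B x) y = dot x (B y).
Hypothesis contrB : forall x, `|B x| <= `|x|.

Local Notation pp := (positive_polynomial B).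

Lemma pp_ge0 F c : pp F c -> 0 <= c.
Proof. by elim=> // *; rewrite ?addr_ge0 ?mulr_ge0. Qed.

Lemma pp_linear F c : pp F c -> linear F.
Proof.
elim => {F c} [a x y|//|F c G d _ lF _ lG a x y|F c G d _ lF _ lG a x y|b F c _ _ lF a x y].
- by rewrite scaler0 addr0.
- by rewrite lF lG scalerDr addrACA.
- by rewrite lG lF.
- by rewrite lF scalerDr !scalerA [a * b]mulrC.
Qed.

Lemma pp_commB F c : pp F c -> forall x, F (B x) = B (F x).
Proof.
elim => {F c} [x|x|F c G d _ lF _ lG x|F c G d _ lF _ lG x|b F c _ _ lF x] //.
- by rewrite (linear0P linB).
- by rewrite (linearDP linB) lF lG.
- by rewrite lG lF.
- by rewrite (linearZP linB) lF.
Qed.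

Lemma pp_comm F c G d : pp F c -> pp G d -> forall x, F (G x) = G (F x).
Proof.
move=> pF pG; elim: pF => {F c} [x|x|F c F' c' _ lF _ lG x|F c F' c' _ lF _ lG x|b F c _ _ lF x] //.
- by rewrite (linear0P (pp_linear pG)).
- by rewrite (pp_commB pG).
- by rewrite (linearDP (pp_linear pG)) lF lG.
- by rewrite lG lF.
- by rewrite (linearZP (pp_linear pG)) lF.
Qed.

Lemma pp_sym F c : pp F c -> forall x y, dot (F x) y = dot x (F y).
Proof.
elim => {F c} [x y|x y|F c G d _ lF _ lG x y|F c G d pF lF pG lG x y|b F c _ _ lF x y] //.
- by rewrite dot0l dot0r.
- by rewrite dotDl dotDr lF lG.
- by rewrite lF lG (pp_comm pF pG).
- by rewrite dotZl dotZr lF.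
Qed.

Lemma pp_bound F c : pp F c -> forall x, `|F x| <= c * `|x|.
Proof.
elim => {F c} [x|x|F c G d _ lF _ lG x|F c G d pF lF pG lG x|b F c b0 _ lF x].
- by rewrite normr0 mul0r.
- by rewrite mul1r.
- by rewrite (le_trans (ler_normD _ _))// mulrDl lerD.
- by rewrite (le_trans (lF _))// -mulrA ler_wpM2l ?(pp_ge0 pF).
- by rewrite normrZ ger0_norm// -mulrA ler_wpM2l.
Qed.

(** A fixed point Y of this iteration satisfies (I - Y)^2 = I - 2 Y + Y^2 = I - B, so it yields a
    square root of I - B. Started at 0, it only produces positive polynomials in B. *)
Fixpoint sqrt_iter n : X -> X :=
  if n is m.+1 then fun x => 2^-1 *: (B x + sqrt_iter m (sqrt_iter m x))
  else fun=> 0.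

(** The same iteration for the scalar B = 1, hence the coefficient sum of [sqrt_iter n]. It bounds
    operator norms, so that monotone convergence of reals gives convergence of operators. *)
Fixpoint sqrt_seq n : R := if n is m.+1 then 2^-1 * (1 + sqrt_seq m * sqrt_seq m) else 0.

Lemma pp_sqrt_iter n : pp (sqrt_iter n) (sqrt_seq n).
Proof.
elim: n => [|n IH]; first exact: PosPoly0.
apply: (@PosPolyZ _ _ B 2^-1 (fun x => B x + _)); first by rewrite invr_ge0.
by apply: (@PosPolyD _ _ B B 1 (fun x => sqrt_iter n (sqrt_iter n x)));
  [exact: PosPolyX|exact: PosPolyM].
Qed.

(** Since the iterates commute, Y_(n+2) - Y_(n+1) = (Y_(n+1) - Y_n) (Y_(n+1) + Y_n) / 2, and
    positivity of the coefficients passes to the next increment. *)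
Lemma pp_sqrt_iterB n : exists2 D, pp D (sqrt_seq n.+1 - sqrt_seq n) &
  forall x, sqrt_iter n.+1 x - sqrt_iter n x = D x.
Proof.
elim: n => [|n [D pD HD]].
  exists (sqrt_iter 1); last by move=> x; rewrite subr0.
  by rewrite [X in _ - X]/= subr0; exact: pp_sqrt_iter.
exists (fun x => 2^-1 *: (D (sqrt_iter n.+1 x + sqrt_iter n x))).
  have -> : sqrt_seq n.+2 - sqrt_seq n.+1 =
    2^-1 * ((sqrt_seq n.+1 - sqrt_seq n) * (sqrt_seq n.+1 + sqrt_seq n)).
    by rewrite /=; set a := sqrt_seq n; field.
  apply: (@PosPolyZ _ _ B 2^-1 (fun x => D _)); first by rewrite invr_ge0.
  apply: (@PosPolyM _ _ B D _ (fun x => sqrt_iter n.+1 x + sqrt_iter n x)) => //.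
  by apply: PosPolyD; exact: pp_sqrt_iter.
have E m y : sqrt_iter m.+1 y = 2^-1 *: (B y + sqrt_iter m (sqrt_iter m y)) by [].
have := pp_comm (pp_sqrt_iter n) (pp_sqrt_iter n.+1).
have l1 := pp_linear (pp_sqrt_iter n.+1); have l0 := pp_linear (pp_sqrt_iter n).
move=> comm x; rewrite -HD [sqrt_iter n.+2 x]E [X in _ - X = _]E -scalerBr.
move: l1 l0 comm; set F1 := sqrt_iter n.+1; set F0 := sqrt_iter n => l1 l0 comm.
congr (_ *: _); rewrite opprD addrACA subrr add0r.
rewrite !(linearDP l1) !(linearDP l0) opprD comm [- _ - _ in RHS]addrC.
by rewrite addrA [RHS]addrAC addrK.
Qed.

Lemma sqrt_seq_itv n : 0 <= sqrt_seq n <= 1.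
Proof.
elim: n => [|n /andP[]]; first by rewrite lexx ler01.
by rewrite [sqrt_seq n.+1]/=; set a := sqrt_seq n; nra.
Qed.

Lemma sqrt_iterB m n : (n <= m)%N -> sqrt_seq n <= sqrt_seq m /\
  forall x, `|sqrt_iter m x - sqrt_iter n x| <= (sqrt_seq m - sqrt_seq n) * `|x|.
Proof.
move=> /subnK <-; elim: (m - n)%N => {m} [|k [IH1 IH2]].
  by rewrite add0n; split => // x; rewrite !subrr normr0 mul0r.
rewrite addSn; have [D pD HD] := pp_sqrt_iterB (k + n).
split; first by rewrite (le_trans IH1)// -subr_ge0 (pp_ge0 pD).
move=> x; rewrite -[_ x](subrK (sqrt_iter (k + n) x)) -addrA HD.
rewrite (le_trans (ler_normD _ _))// (le_trans (lerD (pp_bound pD x) (IH2 x)))//.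
by rewrite -mulrDl addrA subrK.
Qed.

Lemma sqrt_iter_cvg : exists Y : X -> X, forall x, sqrt_iter n x @[n --> \oo] --> Y x.
Proof.
suff H x : exists y : X, sqrt_iter n x @[n --> \oo] --> y by have [Y] := choice H; exists Y.
apply: cauchy_sequence_cvg => e e0.
have cvs : cvgn sqrt_seq.
  apply: nondecreasing_is_cvgn; first by move=> i j /sqrt_iterB[].
  by exists 1 => _ [n _ <-]; have /andP[] := sqrt_seq_itv n.
have d0 : 0 < e / (2 * (`|x| + 1)) by rewrite divr_gt0// mulr_gt0// ltr_wpDl.
have /cvgrPdist_lt/(_ _ d0)[N _ HN] := cvs.
suff H i j : (N <= i)%N -> (i <= j)%N -> `|sqrt_iter j x - sqrt_iter i x| < e.
  exists N => i j Ni Nj; have /orP[ij|ij] := leq_total i j; first by rewrite distrC H.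
  exact: H.
move=> Ni ij; have [H1 H2] := sqrt_iterB ij.
apply: le_lt_trans (H2 x) _.
have Hi := HN i Ni; have Hj := HN j (leq_trans Ni ij).
rewrite (@le_lt_trans _ _ ((e / (2 * (`|x| + 1)) * 2) * `|x|))//.
  rewrite ler_wpM2r//; move: Hi Hj; rewrite /= !ltr_norml.
  by set l := lim _; set d := e / _; lra.
have -> : e / (2 * (`|x| + 1)) * 2 = e / (`|x| + 1).
  by field; rewrite gt_eqF// ltr_wpDl.
by rewrite mulrAC ltr_pdivrMr ?ltr_wpDl// ltr_pM2l// ltrDl.
Qed.

Lemma contraction_sqrt : exists Y : X -> X, [/\ linear Y,
  forall x y, dot (Y x) y = dot x (Y y), forall x, `|Y x| <= `|x| &
  forall x, Y x *+ 2 = B x + Y (Y x)].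
Proof.
have [Y HY] := sqrt_iter_cvg.
have lY : linear Y.
  move=> a x y; have H := HY (a *: x + y).
  have H2 : sqrt_iter n (a *: x + y) @[n --> \oo] --> a *: Y x + Y y.
    under eq_fun do rewrite (pp_linear (pp_sqrt_iter _)).
    by apply: cvgD => //; apply: cvgZr.
  exact: (cvg_unique (@norm_hausdorff _ _) H H2).
have bY x : `|Y x| <= `|x|.
  apply: (ler_cvg_to (cvg_norm (HY x)) (cvg_cst _)); near=> n.
  rewrite (le_trans (pp_bound (pp_sqrt_iter n) x))//.
  by rewrite ler_piMl//; have /andP[] := sqrt_seq_itv n.
exists Y; split => //.
  move=> x y; have H1 := @dot_cvgl _ _ _ normE _ _ y (HY x).
  have H2 := @dot_cvgr _ _ _ normE _ _ x (HY y).
  rewrite (_ : (fun n => _) = fun n => dot x (sqrt_iter n y)) in H1; last first.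
    by apply/funext => n; exact: pp_sym (pp_sqrt_iter n) _ _.
  exact: (cvg_unique (@norm_hausdorff _ _) H1 H2).
move=> x.
(* Operator and argument vary together; the iterates are contractions uniformly in n, so the
   argument may first be replaced by its limit [Y x]. *)
have H1 : (fun n => sqrt_iter n (sqrt_iter n x)) @ \oo --> Y (Y x).
  have H2 : (fun n => sqrt_iter n (sqrt_iter n x - Y x)) @ \oo --> (0 : X).
    apply/cvgr0Pnorm_lt => e e0; near=> n.
    rewrite (le_lt_trans (pp_bound (pp_sqrt_iter n) _))//.
    rewrite (@le_lt_trans _ _ (1 * `|sqrt_iter n x - Y x|))//.
      by rewrite ler_wpM2r//; have /andP[] := sqrt_seq_itv n.
    rewrite mul1r distrC; near: n.
    by have /cvgrPdist_lt/(_ _ e0) := HY x.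
  have -> : (fun n => sqrt_iter n (sqrt_iter n x)) =
    (fun n => sqrt_iter n (sqrt_iter n x - Y x) + sqrt_iter n (Y x)).
    by apply/funext => n; rewrite -(linearDP (pp_linear (pp_sqrt_iter n))) subrK.
  by rewrite -[Y (Y x)]add0r; apply: cvgD.
have H3 : (fun n => sqrt_iter n.+1 x *+ 2) @ \oo --> B x + Y (Y x).
  have -> : (fun n => sqrt_iter n.+1 x *+ 2) = (fun n => B x + sqrt_iter n (sqrt_iter n x)).
    by apply/funext => n /=; rewrite -scaler_nat scalerA divff ?scale1r// pnatr_eq0.
  by apply: cvgD => //; exact: cvg_cst.
have H4 : (fun n => sqrt_iter n.+1 x *+ 2) @ \oo --> Y x *+ 2.
  by apply: cvgMn; rewrite (cvg_shiftS (fun n => sqrt_iter n x)); exact: HY.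
exact: (cvg_unique (@norm_hausdorff _ _) H4 H3).
Unshelve. all: by end_near. Qed.

End SquareRoot.

Section SqrtOperator.
Context (R : realType) (X : completeNormedModType R) (dot : {dot X for idfun}).
Hypothesis normE : induces_norm dot.
Implicit Types (x y z h : X) (A : X -> X).

Lemma sqrt_operatorP A : nonneg_operator dot A ->
  nonneg_operator dot (sqrt_operator dot A) /\
  forall x, sqrt_operator dot A (sqrt_operator dot A x) = A x.
Proof.
move=> nA; have [bA sA pA] := nA; have [lA cA] := bA.
suff H : [set S | nonneg_operator dot S /\ forall x, S (S x) = A x] !=set0.
  exact: (getPex H).
have [C C0 HC] := bounded_operator_bound bA.
(* Dividing by the bound C of A makes [B] a symmetric contraction; its fixed point Y then satisfies
   C (I - Y)^2 = A. *)
pose B x := x - C^-1 *: A x.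
have lB : linear B.
  move=> a x y; apply: (dot_inj normE) => z.
  by rewrite /B lA !(dotDl, dotZl, dotNl); ring.
have sB x y : dot (B x) y = dot x (B y).
  by rewrite /B dotBl dotBr dotZl dotZr sA.
have cB x : `|B x| <= `|x|.
  rewrite -(@ler_pXn2r _ 2)// ?nnegrE// -!normE /B dotBl !dotBr !dotZl !dotZr !normE.
  rewrite [dot x (A x)]dotC.
  have := nonneg_operator_contraction normE nA (ltW C0) HC x.
  have := pA x; set a := `|A x| ^+ 2; set d := dot _ _; set m := `|x| ^+ 2 => d0 H.
  have : C^-1 * (C^-1 * a) <= C^-1 * d.
    by rewrite ler_pM2l ?invr_gt0// mulrC ler_pdivrMr// mulrC.
  have : 0 <= C^-1 * d by rewrite mulr_ge0// invr_ge0 ltW.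
  by lra.
have [Y [lY sY bY EY]] := contraction_sqrt normE lB sB cB.
pose s := Num.sqrt C.
have ss : s * s = C by rewrite -expr2 sqr_sqrtr// ltW.
exists (fun x => s *: (x - Y x)); split; first split.
- apply: (@bounded_operatorI _ _ _ (s * 2)).
    move=> a x y; apply: (dot_inj normE) => z.
    by rewrite lY !(dotDl, dotZl, dotNl); ring.
  move=> x; rewrite normrZ ger0_norm ?sqrtr_ge0// -mulrA ler_wpM2l ?sqrtr_ge0//.
  by rewrite (le_trans (ler_normB _ _))// mulr_natl mulr2n lerD2l.
- by move=> x y; rewrite dotZl dotZr dotBl dotBr sY.
- move=> x; rewrite dotZl mulr_ge0 ?sqrtr_ge0// dotBl normE subr_ge0.
  by rewrite (le_trans (dot_le normE _ _))// expr2 ler_wpM2r.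
move=> x; rewrite (linearZP lY) (linearBP lY) -scalerBr scalerA ss.
have -> : x - Y x - (Y x - Y (Y x)) = C^-1 *: A x.
  have -> : Y (Y x) = Y x *+ 2 - B x by rewrite EY addrC addKr.
  apply: (dot_inj normE) => z.
  by rewrite /B mulr2n !(dotDl, dotZl, dotNl); ring.
by rewrite scalerA divff ?scale1r// gt_eqF.
Qed.

(** Douglas' range criterion: the bound makes k |-> <y, k> a bounded functional of S k, with S the
    square root. Riesz' argument represents it by some w, and by symmetry of S this w solves S w =
    y. *)
Lemma range_sqrt A y c : nonneg_operator dot A -> 0 <= c ->
  (forall k, `|dot y k| <= c * `|sqrt_operator dot A k|) ->
  exists w, [/\ sqrt_operator dot A w = y, `|w| <= c &
    forall z, sqrt_operator dot A z = 0 -> dot w z = 0].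
Proof.
move=> nA c0 H; have [[[lS _] sS _] _] := sqrt_operatorP nA.
have [||||w [H1 H2 H3]] := @variational_representation _ _ _ normE
  (sqrt_operator dot A) (dot y) c => //.
  by move=> a u v; rewrite dotDr dotZr.
exists w; split => //.
  by apply: (dot_inj normE) => z; rewrite sS -H1.
by move=> z Hz; apply: H3 => k; rewrite sS Hz dot0r.
Qed.

(** [range_sqrt] yields a preimage orthogonal to the kernel and of norm at most |z|. Two preimages
    orthogonal to the kernel differ by a kernel vector orthogonal to itself, so [get] returns this
    one. *)
Lemma inv_sqrt_operatorP A z : nonneg_operator dot A ->
  let h := sqrt_operator dot A z in
  sqrt_operator dot A (inv_sqrt_operator dot A h) = h /\
  `|inv_sqrt_operator dot A h| <= `|z|.
Proof.
move=> nA h; have [[[lS _] sS _] _] := sqrt_operatorP nA.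
have [k|w [Hw1 Hw2 Hw3]] := @range_sqrt A h `|z| nA (normr_ge0 _).
  by rewrite sS cauchy_schwarz.
have H : [set z | sqrt_operator dot A z = h /\
    forall y, sqrt_operator dot A y = 0 -> dot z y = 0] !=set0 by exists w.
have [E1 E2] := getPex H; split => //.
suff -> : inv_sqrt_operator dot A h = w by [].
apply/eqP; rewrite -subr_eq0; apply/eqP/(dotxx_eq0 normE).
have E : sqrt_operator dot A (inv_sqrt_operator dot A h - w) = 0.
  by rewrite (linearBP lS) E1 Hw1 subrr.
by rewrite dotBl (E2 _ E) (Hw3 _ E) subrr.
Qed.

End SqrtOperator.

(** * Orthonormal bases and traces *)

Section Orthonormal.
Context (R : realType) (X : completeNormedModType R) (dot : {dot X for idfun}).
Hypothesis normE : induces_norm dot.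
Implicit Types (x y z h : X).

(* Zero vectors are allowed, so that finite orthonormal families and degenerate
   Gram-Schmidt steps need no special case. *)
Definition orthonormal_seq (f : nat -> X) :=
  (forall i, f i = 0 \/ dot (f i) (f i) = 1) /\
  (forall i j, i != j -> dot (f i) (f j) = 0).

Definition total_seq (f : nat -> X) := forall x, (forall i, dot x (f i) = 0) -> x = 0.

Lemma orthonormal_sum_dot f (a : nat -> R) n i : orthonormal_seq f -> (i < n)%N ->
  dot (\sum_(k < n) a k *: f k) (f i) = a i * dot (f i) (f i).
Proof.
move=> [_ f2] ni; rewrite dot_suml (bigD1 (Ordinal ni))//= dotZl big1 ?addr0// => k ki.
by rewrite dotZl f2 ?mulr0.
Qed.

Lemma orthonormal_sum_norm f (a : nat -> R) m n : orthonormal_seq f ->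
  `|\sum_(m <= k < n) a k *: f k| ^+ 2 <= \sum_(m <= k < n) a k ^+ 2.
Proof.
move=> [f1 f2]; rewrite -normE dot_suml big_nat [leRHS]big_nat; apply: ler_sum => i mi.
rewrite dotZl dot_sumr (bigD1_seq i) ?mem_index_iota ?iota_uniq//=.
rewrite big1 ?addr0 => [|k ki]; last by rewrite dotZr f2 ?mulr0// eq_sym.
rewrite dotZr mulrA -expr2; case: (f1 i) => ->; first by rewrite dot0l mulr0 sqr_ge0.
by rewrite mulr1.
Qed.

Lemma bessel f x n : orthonormal_seq f -> \sum_(i < n) dot x (f i) ^+ 2 <= `|x| ^+ 2.
Proof.
move=> of_; have [f1 f2] := of_; pose s := \sum_(i < n) dot x (f i) *: f i.
have ss : dot s s = \sum_(i < n) dot x (f i) ^+ 2.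
  rewrite {2}/s dot_sumr; apply: eq_bigr => i _; rewrite dotZr.
  rewrite (@orthonormal_sum_dot f (fun i => dot x (f i)))//.
  by case: (f1 i) => ->; rewrite ?dot0r ?mulr0 ?expr0n// mulr1.
have xs : dot x s = \sum_(i < n) dot x (f i) ^+ 2.
  by rewrite /s dot_sumr; apply: eq_bigr => i _; rewrite dotZr.
have := dotxx_ge0 normE (x - s).
by rewrite dotBl !dotBr [dot s x]dotC ss xs normE; lra.
Qed.

Lemma orthonormal_series_cvg f (a : nat -> R) M : orthonormal_seq f ->
  (forall n, \sum_(i < n) a i ^+ 2 <= M) ->
  exists y : X, \sum_(i < n) a i *: f i @[n --> \oo] --> y.
Proof.
move=> of_ aM; apply: cauchy_sequence_cvg => e e0.
pose s n := \sum_(i < n) a i ^+ 2.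
have sm m n : (m <= n)%N -> s n = s m + \sum_(m <= i < n) a i ^+ 2.
  by move=> mn; rewrite /s -!(big_mkord xpredT (fun i => a i ^+ 2)) -big_cat_nat.
have cvs : cvgn s.
  apply: nondecreasing_is_cvgn.
    by move=> m n mn; rewrite (sm _ _ mn) lerDl sumr_ge0// => i _; rewrite sqr_ge0.
  by exists M => _ [n _ <-]; exact: aM.
have d0 : 0 < e ^+ 2 / 2 by rewrite divr_gt0 ?exprn_gt0.
have /cvgrPdist_lt/(_ _ d0)[N _ HN] := cvs.
suff H i j : (N <= i)%N -> (i <= j)%N ->
    `|\sum_(k < j) a k *: f k - \sum_(k < i) a k *: f k| < e.
  exists N => i j Ni Nj; have /orP[ij|ij] := leq_total i j; first by rewrite distrC H.
  exact: H.
move=> Ni ij.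
rewrite -!(big_mkord xpredT (fun k => a k *: f k)) (@big_cat_nat _ _ _ i)//= [X in `|X|]addrC addKr.
rewrite -(@ltr_pXn2r _ 2)// ?nnegrE ?(ltW e0)//.
apply: le_lt_trans (orthonormal_sum_norm _ _ _ of_) _.
have -> : \sum_(i <= k < j) a k ^+ 2 = s j - s i by rewrite (sm _ _ ij) addrC addKr.
have Hi := HN i Ni; have Hj := HN j (leq_trans Ni ij).
move: Hi Hj; rewrite /= !ltr_norml; set l := lim _; set d := e ^+ 2; lra.
Qed.

Lemma orthonormal_expansion f x : orthonormal_seq f -> total_seq f ->
  \sum_(i < n) dot x (f i) *: f i @[n --> \oo] --> x.
Proof.
move=> of_ tf; have [y Hy] := @orthonormal_series_cvg f (fun i => dot x (f i)) (`|x| ^+ 2)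
  of_ (fun n => bessel x n of_).
suff yx : y = x by move: Hy; rewrite yx.
apply/eqP; rewrite -subr_eq0; apply/eqP/tf => i; rewrite dotBl.
have H := dot_cvgl normE (y := f i) Hy.
suff -> : dot y (f i) = dot x (f i) by rewrite subrr.
apply: (cvg_unique (@norm_hausdorff _ _) H).
apply: cvg_near_cst; exists i.+1 => // n ni /=.
rewrite (@orthonormal_sum_dot f (fun i => dot x (f i)))//.
by have [f1 _] := of_; case: (f1 i) => ->; rewrite ?dot0r ?mulr0// mulr1.
Qed.

Lemma parseval f x y : orthonormal_seq f -> total_seq f ->
  \sum_(i < n) dot x (f i) * dot y (f i) @[n --> \oo] --> dot x y.
Proof.
move=> of_ tf; have := dot_cvgl normE (y := y) (@orthonormal_expansion f x of_ tf).
rewrite (_ : (fun n => dot _ y) = fun n => \sum_(i < n) dot x (f i) * dot y (f i))//.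
by apply/funext => n; rewrite dot_suml; apply: eq_bigr => i _; rewrite dotZl [dot y _]dotC.
Qed.

Lemma parseval_norm f x : orthonormal_seq f -> total_seq f ->
  \sum_(i < n) dot x (f i) ^+ 2 @[n --> \oo] --> `|x| ^+ 2.
Proof. by move=> of_ tf; rewrite -normE; exact: parseval. Qed.

Section GramSchmidt.
Context (u : nat -> X).

(** The recursion carries the whole list because each step needs all earlier vectors. A vanishing
    residual yields the vector 0, as [orthonormal_seq] allows. *)
Fixpoint gs_seq n : seq X :=
  if n is m.+1 then
    let v := u m - \sum_(w <- gs_seq m) dot (u m) w *: w in
    rcons (gs_seq m) (`|v|^-1 *: v)
  else [::].

Definition gram_schmidt n := nth 0 (gs_seq n.+1) n.
Arguments gram_schmidt : simpl never.
Local Notation gs := gram_schmidt.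

Lemma size_gs_seq n : size (gs_seq n) = n.
Proof. by elim: n => //= n IH; rewrite size_rcons IH. Qed.

Lemma gs_seqE n : gs_seq n = [seq gs i | i <- iota 0 n].
Proof.
elim: n => [//|n IH]; rewrite -[X in iota 0 X]addn1 iotaD map_cat -IH /= cats1; congr (rcons _ _).
by rewrite add0n /gs /= nth_rcons size_gs_seq ltnn eqxx.
Qed.

Let resid n := u n - \sum_(i < n) dot (u n) (gs i) *: gs i.

Let gsE n : gs n = `|resid n|^-1 *: resid n.
Proof.
rewrite {1}/gs /= nth_rcons size_gs_seq ltnn eqxx gs_seqE big_map.
by rewrite -[in iota 0 n](subn0 n) -/(index_iota 0 n) big_mkord.
Qed.

Let residE n : resid n = `|resid n| *: gs n.
Proof.
rewrite gsE scalerA; have [->|r0] := eqVneq (resid n) 0; first by rewrite scaler0.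
by rewrite divff ?normr_eq0// scale1r.
Qed.

Let gs_unit n : gs n = 0 \/ dot (gs n) (gs n) = 1.
Proof.
have [r0|r0] := eqVneq (resid n) 0; first by left; rewrite gsE r0 scaler0.
right; rewrite gsE normE normrZ normfV normr_id mulVf ?expr1n// normr_eq0//.
Qed.

Let gs_orth n : forall i, (i < n)%N -> dot (gs n) (gs i) = 0.
Proof.
elim/ltn_ind: n => n IH i ni; rewrite gsE dotZl.
suff -> : dot (resid n) (gs i) = 0 by rewrite mulr0.
rewrite /resid dotBl dot_suml.
rewrite (bigD1 (Ordinal ni))//= dotZl big1 ?addr0 => [|k ki].
  by case: (gs_unit i) => ->; rewrite ?dot0r ?mulr0 ?subrr// mulr1 subrr.
rewrite dotZl; have [ik|ik|ik] := ltngtP (k : nat) i.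
- by rewrite dotC IH ?mulr0.
- by rewrite IH ?mulr0.
- by move: ki; rewrite -val_eqE /= ik eqxx.
Qed.

Lemma gram_schmidt_orthonormal : orthonormal_seq gs.
Proof.
split=> // i j; case: ltngtP => // ij _; last exact: gs_orth.
by rewrite dotC gs_orth.
Qed.

(** [u n] lies in the span of the first n + 1 Gram-Schmidt vectors, to which all later ones are
    orthogonal. *)
Lemma gram_schmidt_orthogonal_prev n i : (n < i)%N -> dot (u n) (gs i) = 0.
Proof.
move=> ni; rewrite -(subrK (\sum_(i < n) dot (u n) (gs i) *: gs i) (u n)) -/(resid n).
rewrite residE dotDl dotZl dotC gs_orth// mulr0 add0r dot_suml big1// => k _.
by rewrite dotZl [dot (gs k) _]dotC gs_orth ?mulr0// (ltn_trans (ltn_ord k) ni).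
Qed.

Lemma gram_schmidt_expansion n m : (n < m)%N ->
  u n = \sum_(i < m) dot (u n) (gs i) *: gs i.
Proof.
move=> nm; transitivity (\sum_(i < n.+1) dot (u n) (gs i) *: gs i).
  rewrite big_ord_recr /= -{1}(subrK (\sum_(i < n) dot (u n) (gs i) *: gs i) (u n)).
  rewrite addrC -/(resid n); congr (_ + _).
  rewrite -[X in _ = dot X _ *: _](subrK (\sum_(i < n) dot (u n) (gs i) *: gs i) (u n)) -/(resid n) dotDl.
  rewrite dot_suml big1 ?addr0 => [|k _]; last by rewrite dotZl [dot (gs k) _]dotC gs_orth ?mulr0.
  rewrite {1 2}residE dotZl; case: (gs_unit n) => [->|->]; first by rewrite !scaler0.
  by rewrite mulr1.
rewrite -!(big_mkord xpredT (fun i => dot (u n) (gs i) *: gs i)).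
rewrite [RHS](@big_cat_nat _ _ _ n.+1)//= [X in _ + X]big_nat [X in _ + X]big1 ?addr0// => i /andP[ni _].
by rewrite gram_schmidt_orthogonal_prev// scale0r.
Qed.

End GramSchmidt.

Lemma separable_dense_seq : separable X ->
  exists d : nat -> X, forall x (e : R), 0 < e -> exists n, `|x - d n| < e.
Proof.
move=> [D [cD dD]]; have /countable_injP [f finj] := cD.
(* Indices outside the image of f give the default point, which does no harm to density. *)
exists (fun n => get [set v | D v /\ f v = n]) => x e e0.
have [v [xv Dv]] : ball x e `&` D !=set0.
  by apply: dD; [exists x; exact: ballxx|exact: ball_open].
exists (f v); set w := get _.
have [Dw fw] : D w /\ f w = f v.
  by apply: (@getPex _ [set w | D w /\ f w = f v]); exists v.
have -> : w = v by apply: finj; rewrite ?inE.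
by move: xv; rewrite -ball_normE.
Qed.

Lemma orthonormal_basis_exists : separable X -> exists E, orthonormal_basis dot E.
Proof.
move=> /separable_dense_seq[d Hd].
pose g := gram_schmidt d; have [g1 g2] := gram_schmidt_orthonormal d.
exists [set g i | i in [set i | g i <> 0]]; split.
- by move=> _ [i gi0 <-]; case: (g1 i).
- move=> _ _ [i gi0 <-] [j gj0 <-] gij; apply: g2.
  by apply/eqP => ij; apply: gij; rewrite ij.
- move=> x Hx.
  have Hg i : dot x (g i) = 0.
    have [->|/eqP gi0] := eqVneq (g i) 0; first by rewrite dot0r.
    by apply: Hx; exists i.
  have Hxd n : dot x (d n) = 0.
    rewrite (@gram_schmidt_expansion d n n.+1)// dot_sumr big1// => i _.
    by rewrite dotZr -/g Hg mulr0.
  apply/eqP/negPn/negP => x0.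
  have nx0 : 0 < `|x| by rewrite normr_gt0.
  (* A point d orthogonal to x has |x - d|^2 = |x|^2 + |d|^2, so it cannot be closer to x than
     |x|. *)
  have [n] := Hd x `|x| nx0.
  rewrite -(@ltr_pXn2r _ 2)// ?nnegrE// -!normE dotBl !dotBr Hxd [dot (d n) x]dotC Hxd.
  by rewrite !subr0 sub0r opprK gtrDl ltNge (dotxx_ge0 normE).
Qed.

Lemma orthonormal_basis_seq E : separable X -> orthonormal_basis dot E ->
  exists e : nat -> X, [/\ orthonormal_seq e, total_seq e &
    forall q : X -> R, (forall x, 0 <= q x) -> q 0 = 0 -> forall n,
      ((\sum_(i < n) q (e i))%:E <= \esum_(v in E) (q v)%:E)%E].
Proof.
move=> /separable_dense_seq[d Hd] [E1 E2 E3].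
have H2 : 0 < 2^-1 :> R by rewrite invr_gt0.
have [g Hg] := choice (fun x => Hd x _ H2).
have ginj v w : E v -> E w -> g v = g w -> v = w.
  move=> Ev Ew gvw; apply: contrapT => vw.
  have : `|v - w| ^+ 2 < 1 ^+ 2.
    rewrite ltr_pXn2r ?nnegrE// -(subrK (d (g v)) v) -addrA.
    rewrite (le_lt_trans (ler_normD _ _))//.
    have := Hg v; have := Hg w; rewrite -gvw -[`|d (g v) - w|]distrC; lra.
  by rewrite -normE dotBl !dotBr (E1 _ Ev) (E1 _ Ew) (E2 _ _ Ev Ew vw) dotC (E2 _ _ Ev Ew vw); lra.
pose e n := if pselect (exists v, E v /\ g v = n) is left P then proj1_sig (cid P) else 0.
have eP n : (e n = 0) \/ (E (e n) /\ g (e n) = n).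
  by rewrite /e; case: pselect => [P|]; [right; exact: (proj2_sig (cid P))|left].
have eg v : E v -> e (g v) = v.
  move=> Ev; rewrite /e; case: pselect => [P|]; last by case; exists v.
  by have [? ?] := proj2_sig (cid P); apply: ginj.
exists e; split.
- split=> [i|i j ij]; first by case: (eP i) => [->|[? _]]; [left|right; exact: E1].
  case: (eP i) => [->|[Ei gi]]; first by rewrite dot0l.
  case: (eP j) => [->|[Ej gj]]; first by rewrite dot0r.
  by apply: E2 => // eij; move: ij; rewrite -gi -gj eij eqxx.
- by move=> x Hx; apply: E3 => v Ev; rewrite -(eg _ Ev).
- move=> q q0 q00 n; apply: esum_ge.
  pose I := [set i | (i < n)%N /\ E (e i) /\ g (e i) = i].
  have fI : finite_set I by apply: (@sub_finite_set _ _ `I_n) => [i []|].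
  exists [set e i | i in I].
    by split; [exact: finite_image|move=> _ [i [_ [? _]] <-]].
  rewrite fsbig_image; last first.
    by move=> i j /set_mem[_ [_ gi]] /set_mem[_ [_ gj]] eij; rewrite -gi -gj eij.
  rewrite fsumEFin// lee_fin (@fsbig_ord _ _ _ n (fun i => q (e i))) (fsbigID I)//=.
  rewrite [X in _ + X]fsbig1 ?addr0 => [|i [ni /not_andP[//|nE]]]; last first.
    by case: (eP i) => [->//|].
  suff -> : `I_n `&` I = I by [].
  by apply/seteqP; split => i //= [].
Qed.

End Orthonormal.

Section NonnegTrace.
Context (R : realType) (X : completeNormedModType R) (dot : {dot X for idfun}).
Hypothesis normE : induces_norm dot.

(** With S the square root of A, <A x, x> = |S x|^2 is the sum of <x, S e_i>^2, and each term is at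
    most |S e_i|^2 |x|^2 = <A e_i, e_i> |x|^2. *)
Lemma nonneg_trace_bound (A : X -> X) (e : nat -> X) M :
  nonneg_operator dot A -> orthonormal_seq dot e -> total_seq dot e ->
  (forall n, \sum_(i < n) dot (A (e i)) (e i) <= M) ->
  forall x, dot (A x) x <= M * `|x| ^+ 2.
Proof.
move=> nA oe te HM x.
have [[[lS _] sS _] SS] := sqrt_operatorP normE nA; set S := sqrt_operator dot A in lS sS SS.
have AS y : dot (A y) y = `|S y| ^+ 2 by rewrite -SS sS normE.
rewrite AS; apply: (ler_cvg_to (parseval_norm normE (x := S x) oe te) (cvg_cst _)).
near=> n; apply: (@le_trans _ _ (\sum_(i < n) dot (A (e i)) (e i) * `|x| ^+ 2)).
  apply: ler_sum => i _; rewrite AS sS mulrC -exprMn -real_normK ?num_real//.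
  by rewrite ler_pXn2r ?nnegrE// ?mulr_ge0// cauchy_schwarz.
by rewrite -mulr_suml ler_wpM2r ?sqr_ge0.
Unshelve. all: by end_near. Qed.

End NonnegTrace.

(** * Bounded measurable functions *)

(** Against a probability measure these functions are integrable and closed under products, so the
    real-valued [Rintegral] obeys the usual algebra without finiteness conditions. Unbounded
    functions are reached by truncation. *)
Definition bounded_measurable d (T : measurableType d) (R : realType) (f : T -> R) :=
  measurable_fun setT f /\ exists M : R, forall x, `|f x| <= M.

Section BoundedMeasurable.
Context d (T : measurableType d) (R : realType).
Implicit Types (f g : T -> R) (mu nu : probability T R).
Local Notation bm := (@bounded_measurable d T R).

Lemma bm_integrable mu f : bm f -> mu.-integrable setT (EFin \o f).
Proof.
move=> [mf [M HM]]; apply: measurable_bounded_integrable => //.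
  by rewrite [X in (X < _)%E](_ : _ = 1%E) ?ltry//; exact: probability_setT.
exists M; split; first exact: num_real.
by move=> x Mx y _ /=; rewrite (le_trans (HM y))// ltW.
Qed.

Lemma bm_cst c : bm (fun=> c).
Proof. by split; [exact: measurable_cst|exists `|c|]. Qed.

Lemma bmD f g : bm f -> bm g -> bm (fun x => f x + g x).
Proof.
move=> [mf [M HM]] [mg [N HN]]; split; first exact: measurable_funD.
by exists (M + N) => x; rewrite (le_trans (ler_normD _ _))// lerD.
Qed.

Lemma bmM f g : bm f -> bm g -> bm (fun x => f x * g x).
Proof.
move=> [mf [M HM]] [mg [N HN]]; split; first exact: measurable_funM.
by exists (M * N) => x; rewrite normrM ler_pM.
Qed.

Lemma bmZ c f : bm f -> bm (fun x => c * f x).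
Proof. by move=> bf; apply: bmM => //; exact: bm_cst. Qed.

Lemma bmN f : bm f -> bm (fun x => - f x).
Proof. by move=> /(bmZ (-1)); under eq_fun do rewrite mulN1r. Qed.

Lemma bmB f g : bm f -> bm g -> bm (fun x => f x - g x).
Proof. by move=> bf bg; apply: bmD => //; exact: bmN. Qed.

Lemma bmX f n : bm f -> bm (fun x => f x ^+ n).
Proof.
move=> bf; elim: n => [|n IH]; first by under eq_fun do rewrite expr0; exact: bm_cst.
by under eq_fun do rewrite exprS; exact: bmM.
Qed.

Lemma bm_norm f : bm f -> bm (fun x => `|f x|).
Proof.
move=> [mf [M HM]]; split; first exact: measurableT_comp.
by exists M => x; rewrite normr_id.
Qed.

Lemma bm_powR f p : 0 <= p -> bm f -> bm (fun x => `|f x| `^ p).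
Proof.
move=> p0 [mf [M HM]]; split.
  by apply: (measurableT_comp (measurable_powR p)); exact: measurableT_comp.
exists (M `^ p) => x; rewrite ger0_norm ?powR_ge0//.
have M0 : 0 <= M by apply: le_trans (HM x).
by apply: ge0_ler_powR; rewrite ?nnegrE.
Qed.

Lemma bm_cos f : measurable_fun setT f -> bm (fun x => cos (f x)).
Proof.
move=> mf; split; last by exists 1 => x; rewrite ler_norml cos_geN1 cos_le1.
exact: (measurableT_comp (continuous_measurable_fun (@continuous_cos R)) mf).
Qed.

Lemma bm_sin f : measurable_fun setT f -> bm (fun x => sin (f x)).
Proof.
move=> mf; split; last by exists 1 => x; rewrite ler_norml sin_geN1 sin_le1.
exact: (measurableT_comp (continuous_measurable_fun (@continuous_sin R)) mf).
Qed.

Lemma bm_comp d' (T' : measurableType d') (phi : T -> T') (f : T' -> R) :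
  measurable_fun setT phi -> bounded_measurable f -> bm (fun x => f (phi x)).
Proof.
move=> mphi [mf [M HM]]; split; first exact: measurableT_comp.
by exists M.
Qed.

Lemma expectD mu f g : bm f -> bm g ->
  \int[mu]_x (f x + g x) = \int[mu]_x f x + \int[mu]_x g x.
Proof. by move=> bf bg; rewrite RintegralD//; exact: bm_integrable. Qed.

Lemma expectZ mu c f : bm f -> \int[mu]_x (c * f x) = c * \int[mu]_x f x.
Proof. by move=> bf; rewrite RintegralZl//; exact: bm_integrable. Qed.

Lemma expectB mu f g : bm f -> bm g ->
  \int[mu]_x (f x - g x) = \int[mu]_x f x - \int[mu]_x g x.
Proof. by move=> bf bg; rewrite RintegralB//; exact: bm_integrable. Qed.

Lemma expect_cst mu c : \int[mu]_x c = c.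
Proof. rewrite Rintegral_cst// [X in fine X](_ : _ = 1%E) ?mulr1//; exact: probability_setT. Qed.

Lemma expect_ge0 mu f : (forall x, 0 <= f x) -> 0 <= \int[mu]_x f x.
Proof. by move=> f0; exact: Rintegral_ge0. Qed.

Lemma expect_le mu f g : bm f -> bm g -> (forall x, f x <= g x) ->
  \int[mu]_x f x <= \int[mu]_x g x.
Proof. by move=> bf bg fg; apply: le_Rintegral => //; exact: bm_integrable. Qed.

Lemma expect_norm_le mu f M : bm f -> (forall x, `|f x| <= M) -> `|\int[mu]_x f x| <= M.
Proof.
move=> bf fM; rewrite (le_trans (le_normr_Rintegral _ (bm_integrable mu bf)))//.
rewrite -[leRHS](expect_cst mu); apply: expect_le => //; [exact: bm_norm|exact: bm_cst].
Qed.

Lemma expect_EFin mu f : bm f -> (\int[mu]_x (f x)%:E)%E = (\int[mu]_x f x)%:E.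
Proof. by move=> bf; rewrite fineK//; apply: integrable_fin_num => //; exact: bm_integrable. Qed.

Lemma bm_cvg (f_ : nat -> T -> R) f M : (forall n, bm (f_ n)) ->
  (forall n x, `|f_ n x| <= M) -> (forall x, f_ n x @[n --> \oo] --> f x) -> bm f.
Proof.
move=> bf HM fc; split.
  by apply: (measurable_fun_cvg (fun n => (bf n).1)) => x _; exact: fc.
exists M => x; apply: (ler_cvg_to (cvg_norm (fc x)) (cvg_cst M)).
by near=> n.
Unshelve. all: by end_near. Qed.

Lemma expect_cvg mu (f_ : nat -> T -> R) f M : (forall n, bm (f_ n)) ->
  (forall n x, `|f_ n x| <= M) -> (forall x, f_ n x @[n --> \oo] --> f x) ->
  \int[mu]_x f_ n x @[n --> \oo] --> \int[mu]_x f x.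
Proof.
move=> bf HM fc; have bf' := bm_cvg bf HM fc.
have [] := @dominated_convergence _ _ _ mu _ measurableT
  (fun n => EFin \o f_ n) (EFin \o f) (EFin \o (fun=> M)).
- by move=> n; exact: measurable_int (bm_integrable mu (bf n)).
- exact: measurable_int (bm_integrable mu bf').
- by apply: aeW => x _; apply: cvg_EFin; [exact: nearW|exact: fc].
- by apply: bm_integrable; exact: bm_cst.
- by apply: aeW => x n _; rewrite /= lee_fin.
move=> _ _ H; apply: fine_cvg.
by rewrite fineK//; apply: integrable_fin_num => //; exact: bm_integrable.
Qed.

Lemma expect_eq_measure mu nu f : (forall A, measurable A -> mu A = nu A) ->
  \int[mu]_x f x = \int[nu]_x f x.
Proof. by move=> H; congr fine; apply: eq_measure_integral => A mA _; exact: H. Qed.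

Lemma expect_indic mu (A : set T) : measurable A -> \int[mu]_x \1_A x = fine (mu A).
Proof. by move=> mA; rewrite /Rintegral integral_indic// setIT. Qed.

Lemma bm_indic (A : set T) : measurable A -> bm (\1_A).
Proof.
move=> mA; split; first exact: measurable_indic.
by exists 1 => x; rewrite indicE; case: (x \in A); rewrite ?normr1 ?normr0.
Qed.

End BoundedMeasurable.

Section LawProduct.
Context d (T : measurableType d) d' (T' : measurableType d') (R : realType).

Lemma law_exists (mu : probability T R) (phi : T -> T') : measurable_fun setT phi ->
  exists nu : probability T' R, forall A, nu A = mu (phi @^-1` A).
Proof.
move=> mphi.
pose F : {mfun T >-> T'} := HB.pack phi (isMeasurableFun.Build _ _ _ _ _ mphi).
by exists (distribution mu F).
Qed.

Lemma expect_law (mu : probability T R) (phi : T -> T') (nu : probability T' R) f :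
  measurable_fun setT phi -> (forall A, measurable A -> nu A = mu (phi @^-1` A)) ->
  bounded_measurable f -> \int[nu]_y f y = \int[mu]_x f (phi x).
Proof.
move=> mphi H bf.
pose F : {mfun T >-> T'} := HB.pack phi (isMeasurableFun.Build _ _ _ _ _ mphi).
rewrite (@expect_eq_measure _ _ _ nu (distribution mu F))//.
rewrite /Rintegral; congr fine; rewrite integral_distribution//.
  by have [mf _] := bf; exact/measurable_EFinP.
by apply: (@bm_integrable _ _ _ mu (f \o phi)); exact: bm_comp.
Qed.

Lemma ge0_expect_law (mu : probability T R) (phi : T -> T') (nu : probability T' R)
    (f : T' -> \bar R) :
  measurable_fun setT phi -> (forall A, measurable A -> nu A = mu (phi @^-1` A)) ->
  measurable_fun setT f -> (forall y, 0 <= f y)%E ->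
  (\int[nu]_y f y = \int[mu]_x f (phi x))%E.
Proof.
move=> mphi H mf f0.
pose F : {mfun T >-> T'} := HB.pack phi (isMeasurableFun.Build _ _ _ _ _ mphi).
rewrite (@eq_measure_integral _ _ _ _ (distribution mu F)); last by move=> A mA _; exact: H.
by rewrite ge0_integral_pushforward// preimage_setT.
Qed.

Context (mu : probability T R) (nu : probability T' R).

Lemma bm_section (F : T * T' -> R) x : bounded_measurable F ->
  bounded_measurable (fun y => F (x, y)).
Proof. by move=> bF; apply: (bm_comp _ bF); exact: measurable_fun_pair. Qed.

Lemma bm_section2 (F : T * T' -> R) y : bounded_measurable F ->
  bounded_measurable (fun x => F (x, y)).
Proof. by move=> bF; apply: (bm_comp _ bF); exact: measurable_fun_pair. Qed.

Lemma bm_fubini1 (F : T * T' -> R) : bounded_measurable F ->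
  bounded_measurable (fun x => \int[nu]_y F (x, y)).
Proof.
move=> bF; split; last first.
  by have [_ [M HM]] := bF; exists M => x; apply: expect_norm_le => //; exact: bm_section.
apply/measurable_EFinP.
have := @measurable_fubini_F _ _ _ _ _ mu nu _ (bm_integrable (mu \x nu)%E bF).
by apply: eq_measurable_fun => x _ /=; rewrite /fubini_F expect_EFin//; exact: bm_section.
Qed.

Lemma expect_fubini1 (F : T * T' -> R) : bounded_measurable F ->
  \int[(mu \x nu)%E]_z F z = \int[mu]_x \int[nu]_y F (x, y).
Proof.
move=> bF; rewrite {1}/Rintegral -integral12_prod_meas1; last exact: (@bm_integrable _ _ _ (mu \x nu)%E).
by congr fine; apply: eq_integral => x _; rewrite /fubini_F expect_EFin//; exact: bm_section.
Qed.

Lemma expect_fubini2 (F : T * T' -> R) : bounded_measurable F ->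
  \int[(mu \x nu)%E]_z F z = \int[nu]_y \int[mu]_x F (x, y).
Proof.
move=> bF; rewrite {1}/Rintegral -integral21_prod_meas1; last exact: (@bm_integrable _ _ _ (mu \x nu)%E).
by congr fine; apply: eq_integral => x _; rewrite /fubini_G expect_EFin//; exact: bm_section2.
Qed.

Lemma expect_prod (f : T -> R) (g : T' -> R) : bounded_measurable f -> bounded_measurable g ->
  \int[(mu \x nu)%E]_z (f z.1 * g z.2) = (\int[mu]_x f x) * (\int[nu]_y g y).
Proof.
move=> bf bg; rewrite expect_fubini1; last first.
  by apply: bmM; [apply: (bm_comp _ bf)|apply: (bm_comp _ bg)].
under eq_Rintegral do rewrite /= expectZ//.
by rewrite /= [RHS]mulrC -expectZ//; apply: eq_Rintegral => x _; rewrite mulrC.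
Qed.

End LawProduct.

(** * Laws are determined by characteristic functions *)

Section SignIteration.
Context (R : realType).

(* Newton-Schulz iteration: its iterates converge to the sign on [-1, 1]. *)
Definition sign_iter (n : nat) (u : R) := iter n (fun v => 2^-1 * (3 * v - v * (v * v))) u.

Lemma sign_iterS n u : sign_iter n.+1 u =
  2^-1 * (3 * sign_iter n u - sign_iter n u * (sign_iter n u * sign_iter n u)).
Proof. by rewrite /sign_iter iterS. Qed.

Lemma sign_iterN n u : sign_iter n (- u) = - sign_iter n u.
Proof. by elim: n => [//|n IH]; rewrite !sign_iterS IH; ring. Qed.

Lemma sign_iter_pos n u : 0 < u <= 1 -> 0 < sign_iter n u <= 1.
Proof.
move=> /andP[u0 u1]; elim: n => [|n /andP[]]; first by rewrite u0.
rewrite sign_iterS; set v := sign_iter n u => v0 v1.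
have : 0 < v * (3 - v * v) by rewrite mulr_gt0//; nra.
(* This is 2 - 3 v + v^3, twice the distance of the next iterate from 1. *)
have : 0 <= (1 - v) ^+ 2 * (v + 2) by rewrite mulr_ge0 ?sqr_ge0//; lra.
by move=> H1 H2; apply/andP; split; nra.
Qed.

Lemma sign_iter_bound n u : `|u| <= 1 -> `|sign_iter n u| <= 1.
Proof.
have H v : 0 < v -> v <= 1 -> `|sign_iter n v| <= 1.
  move=> v0 v1; have /andP[a b] := sign_iter_pos n (introT andP (conj v0 v1)).
  by rewrite ger0_norm// ltW.
have [u0|u0|->] := ltgtP u 0.
- move=> u1; rewrite -(opprK u) sign_iterN normrN; apply: H; first by rewrite oppr_gt0.
  by rewrite -(ltr0_norm u0).
- by move=> u1; apply: H => //; rewrite -(gtr0_norm u0).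
- move=> _; suff -> : sign_iter n 0 = 0 by rewrite normr0.
  by elim: n {H} => [//|n IH]; rewrite sign_iterS IH; ring.
Qed.

(** On (0, 1] the iterates increase to a positive solution of l = (3 l - l^3) / 2, which can only be
    1; oddness covers negative u. *)
Lemma sign_iter_cvg u : `|u| <= 1 -> sign_iter n u @[n --> \oo] --> Num.sg u.
Proof.
have H v : 0 < v -> v <= 1 -> sign_iter n v @[n --> \oo] --> (1 : R).
  move=> v0 v1; have Hv n := sign_iter_pos n (introT andP (conj v0 v1)).
  have nd : {homo (fun n => sign_iter n v) : m n / (m <= n)%N >-> m <= n}.
    apply/nondecreasing_seqP => n; have := Hv n; rewrite sign_iterS.
    by set w := sign_iter n v => /andP[w0 w1]; nra.
  have cv : cvgn (fun n => sign_iter n v).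
    by apply: nondecreasing_is_cvgn => //; exists 1 => _ [n _ <-]; have /andP[] := Hv n.
  set l := limn (fun n => sign_iter n v).
  have Hl : sign_iter n v @[n --> \oo] --> l by exact: cv.
  have lv : v <= l.
    apply: (ler_cvg_to (cvg_cst v) Hl); near=> n.
    by rewrite -[leLHS]/(sign_iter 0 v); exact: nd.
  have Hl2 : sign_iter n.+1 v @[n --> \oo] --> 2^-1 * (3 * l - l * (l * l)).
    rewrite (_ : (fun n => _) = fun n => 2^-1 * (3 * sign_iter n v -
      sign_iter n v * (sign_iter n v * sign_iter n v))); last first.
      by apply/funext => n; rewrite sign_iterS.
    apply: cvgM; first exact: cvg_cst.
    apply: cvgB; first by apply: cvgM => //; exact: cvg_cst.
    by apply: cvgM => //; exact: cvgM.
  have Hl1 : sign_iter n.+1 v @[n --> \oo] --> l.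
    by rewrite (cvg_shiftS (fun n => sign_iter n v)).
  have El : l = 2^-1 * (3 * l - l * (l * l)) by exact: (cvg_unique (@Rhausdorff R) Hl1 Hl2).
  suff -> : 1 = l by [].
  have l0 : 0 < l := lt_le_trans v0 lv.
  have : l * ((l - 1) * (l + 1)) = 0 by move: El; set k := l in l0 *; lra.
  by move=> /eqP; rewrite !mulf_eq0 gt_eqF//= [l + 1 == 0]gt_eqF ?ltr_wpDr// orbF subr_eq0 => /eqP.
have [u0|u0|->] := ltgtP u 0.
- move=> u1; rewrite ltr0_sg//; have : sign_iter n (- u) @[n --> \oo] --> (1 : R).
    by apply: H; rewrite ?oppr_gt0 -?(ltr0_norm u0).
  rewrite (_ : (fun n => _) = fun n => - sign_iter n u); last by apply/funext => n; rewrite sign_iterN.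
  move=> H1; rewrite (_ : (fun n => sign_iter n u) = fun n => - (- sign_iter n u)).
    exact: cvgN.
  by apply/funext => n; rewrite opprK.
- by move=> u1; rewrite gtr0_sg//; apply: H => //; rewrite -(gtr0_norm u0).
- move=> _; rewrite sgr0 (_ : (fun n => _) = fun=> 0); first exact: cvg_cst.
  apply/funext; elim => [//|n IH]; rewrite sign_iterS IH; ring.
Unshelve. all: by end_near. Qed.

End SignIteration.

Section CharacteristicUniqueness.
Context d (T : measurableType d) (R : realType) (mu nu : probability T R).
Context (L : set (T -> R)).
Hypothesis LD : forall k l, L k -> L l -> L (fun x => k x + l x).
Hypothesis LZ : forall c l, L l -> L (fun x => c * l x).
Hypothesis L0 : L (fun=> 0).
Hypothesis mL : forall l, L l -> measurable_fun setT l.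
Hypothesis genL : forall S : set (set T), sigma_algebra setT S ->
  (forall l c, L l -> S [set x | c < l x]) -> forall A, measurable A -> S A.
Hypothesis eq_cos : forall l, L l -> \int[mu]_x cos (l x) = \int[nu]_x cos (l x).
Hypothesis eq_sin : forall l, L l -> \int[mu]_x sin (l x) = \int[nu]_x sin (l x).

Local Notation bm := (@bounded_measurable d T R).

(** These are the g for which the signed measures g mu and g nu have the same characteristic
    function along L. *)
Let D (g : T -> R) := bm g /\ forall l, L l ->
  \int[mu]_x (g x * cos (l x)) = \int[nu]_x (g x * cos (l x)) /\
  \int[mu]_x (g x * sin (l x)) = \int[nu]_x (g x * sin (l x)).

(* The multipliers of D form an algebra closed under bounded pointwise limits;
   the product-to-sum formulas put cos l and sin l in it. *)
Let W (w : T -> R) := bm w /\ forall g, D g -> D (fun x => w x * g x).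

Let LN l : L l -> L (fun x => - l x).
Proof. by move=> /(LZ (-1)); under eq_fun do rewrite mulN1r. Qed.

Let D1 : D (fun=> 1).
Proof.
split=> [|l Ll]; first exact: bm_cst.
by split; under eq_Rintegral do rewrite mul1r; under [RHS]eq_Rintegral do rewrite mul1r;
  [exact: eq_cos|exact: eq_sin].
Qed.

Let DD f g a b : D f -> D g -> D (fun x => a * f x + b * g x).
Proof.
move=> [bf Hf] [bg Hg]; split=> [|l Ll]; first by apply: bmD; exact: bmZ.
have bc : bm (fun x => cos (l x)) by apply: bm_cos; exact: mL.
have bs : bm (fun x => sin (l x)) by apply: bm_sin; exact: mL.
have E (rho : probability T R) h : bm h -> \int[rho]_x ((a * f x + b * g x) * h x) =
    a * \int[rho]_x (f x * h x) + b * \int[rho]_x (g x * h x).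
  move=> bh; rewrite -!expectZ; [|exact: bmM..].
  rewrite -expectD; [|by apply: bmZ; exact: bmM..].
  by apply: eq_Rintegral => x _; ring.
by have [c1 s1] := Hf l Ll; have [c2 s2] := Hg l Ll; rewrite !E// c1 c2 s1 s2.
Qed.

Let D_cvg (g_ : nat -> T -> R) g M : (forall n, D (g_ n)) ->
  (forall n x, `|g_ n x| <= M) -> (forall x, g_ n x @[n --> \oo] --> g x) -> D g.
Proof.
move=> Dg HM gc; have bg := bm_cvg (fun n => (Dg n).1) HM gc; split => // l Ll.
have E (rho : probability T R) h : bm h -> (forall x, `|h x| <= 1) ->
    \int[rho]_x (g_ n x * h x) @[n --> \oo] --> \int[rho]_x (g x * h x).
  move=> bh h1; apply: (@expect_cvg _ _ _ rho _ _ M) => [n|n x|x].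
  - by apply: bmM => //; exact: (Dg n).1.
  - by rewrite normrM -[leRHS]mulr1 ler_pM.
  - by apply: cvgM => //; exact: cvg_cst.
have bc : bm (fun x => cos (l x)) by apply: bm_cos; exact: mL.
have bs : bm (fun x => sin (l x)) by apply: bm_sin; exact: mL.
have c1 x : `|cos (l x)| <= 1 by rewrite ler_norml cos_geN1 cos_le1.
have s1 x : `|sin (l x)| <= 1 by rewrite ler_norml sin_geN1 sin_le1.
split.
  have H1 := E mu _ bc c1; have H2 := E nu _ bc c1.
  rewrite (_ : (fun n => _) = fun n => \int[nu]_x (g_ n x * cos (l x))) in H1; last first.
    by apply/funext => n; exact: ((Dg n).2 l Ll).1.
  exact: (cvg_unique (@Rhausdorff R) H1 H2).
have H1 := E mu _ bs s1; have H2 := E nu _ bs s1.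
rewrite (_ : (fun n => _) = fun n => \int[nu]_x (g_ n x * sin (l x))) in H1; last first.
  by apply/funext => n; exact: ((Dg n).2 l Ll).2.
exact: (cvg_unique (@Rhausdorff R) H1 H2).
Qed.

Let WD a b v w : W v -> W w -> W (fun x => a * v x + b * w x).
Proof.
move=> [bv Hv] [bw Hw]; split=> [|g Dg]; first by apply: bmD; exact: bmZ.
rewrite (_ : (fun x => _) = fun x => a * (v x * g x) + b * (w x * g x)).
  by apply: DD; [exact: Hv|exact: Hw].
by apply/funext => x; ring.
Qed.

Let WM v w : W v -> W w -> W (fun x => v x * w x).
Proof.
move=> [bv Hv] [bw Hw]; split=> [|g Dg]; first exact: bmM.
by under eq_fun do rewrite -mulrA; exact/Hv/Hw.
Qed.

Let W1 : W (fun=> 1).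
Proof. by split=> [|g]; [exact: bm_cst|under eq_fun do rewrite mul1r]. Qed.

Let W_cvg (w_ : nat -> T -> R) w M : (forall n, W (w_ n)) ->
  (forall n x, `|w_ n x| <= M) -> (forall x, w_ n x @[n --> \oo] --> w x) -> W w.
Proof.
move=> Ww HM wc; have bw := bm_cvg (fun n => (Ww n).1) HM wc; split => // g Dg.
have [[_ [N HN]] _] := Dg.
apply: (@D_cvg (fun n x => w_ n x * g x) _ (M * N)) => [n|n x|x].
- exact: (Ww n).2.
- by rewrite normrM ler_pM.
- by apply: cvgM => //; exact: cvg_cst.
Qed.

Let W_cos_sin l : L l -> W (fun x => cos (l x)) /\ W (fun x => sin (l x)).
Proof.
move=> Ll.
have bc k : L k -> bm (fun x => cos (k x)) by move=> /mL; exact: bm_cos.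
have bs k : L k -> bm (fun x => sin (k x)) by move=> /mL; exact: bm_sin.
have E (rho : probability T R) (g f1 f2 f3 f4 : T -> R) a b : bm g -> bm f3 -> bm f4 ->
    (forall x, f1 x * f2 x = a * f3 x + b * f4 x) ->
    \int[rho]_x (f1 x * g x * f2 x) = a * \int[rho]_x (g x * f3 x) + b * \int[rho]_x (g x * f4 x).
  move=> bg b3 b4 H; rewrite -!expectZ; [|exact: bmM..].
  rewrite -expectD; [|by apply: bmZ; exact: bmM..].
  by apply: eq_Rintegral => x _; rewrite mulrAC H; ring.
have mLkl k : L k -> L (fun x => l x + k x) /\ L (fun x => l x - k x).
  by move=> Lk; split; apply: LD => //; exact: LN.
split; split => [|g [bg Hg]]; try by [exact: bc|exact: bs].
- split; first by apply: bmM => //; exact: bc.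
  move=> k /mLkl[Lp Lm]; have [cp sp] := Hg _ Lp; have [cm sm] := Hg _ Lm.
  split.
    by rewrite !(@E _ g (fun x => cos (l x)) (fun x => cos (k x)) (fun x => cos (l x + k x))
      (fun x => cos (l x - k x)) 2^-1 2^-1) ?cp ?cm//; try exact: bc;
      move=> x; rewrite cosD cosB; field.
  by rewrite !(@E _ g (fun x => cos (l x)) (fun x => sin (k x)) (fun x => sin (l x + k x))
      (fun x => sin (l x - k x)) 2^-1 (- 2^-1)) ?sp ?sm//; try exact: bs;
      move=> x; rewrite sinD sinB; field.
- split; first by apply: bmM => //; exact: bs.
  move=> k /mLkl[Lp Lm]; have [cp sp] := Hg _ Lp; have [cm sm] := Hg _ Lm.
  split.
    by rewrite !(@E _ g (fun x => sin (l x)) (fun x => cos (k x)) (fun x => sin (l x + k x))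
      (fun x => sin (l x - k x)) 2^-1 2^-1) ?sp ?sm//; try exact: bs;
      move=> x; rewrite sinD sinB; field.
  by rewrite !(@E _ g (fun x => sin (l x)) (fun x => sin (k x)) (fun x => cos (l x + k x))
      (fun x => cos (l x - k x)) (- 2^-1) 2^-1) ?cp ?cm//; try exact: bc;
      move=> x; rewrite cosD cosB; field.
Qed.

(** The sign of w is a bounded limit of polynomials in w, and the indicator of w > 0 is (sg^2 + sg)
    / 2. *)
Let W_positive w : W w -> (forall x, `|w x| <= 1) -> W (\1_[set x | 0 < w x]).
Proof.
move=> Ww w1.
have Wi n : W (fun x => sign_iter n (w x)).
  elim: n => [//|n IH].
  rewrite (_ : (fun x => _) = fun x => (3/2) * sign_iter n (w x) +
    (- 2^-1) * (sign_iter n (w x) * (sign_iter n (w x) * sign_iter n (w x)))).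
    by apply: WD => //; apply: WM => //; exact: WM.
  by apply/funext => x; rewrite sign_iterS; field.
have Ws : W (fun x => Num.sg (w x)).
  apply: (@W_cvg _ _ 1 Wi) => [n x|x]; first exact: sign_iter_bound.
  exact: sign_iter_cvg.
rewrite (_ : \1_ _ = fun x => 2^-1 * (Num.sg (w x) * Num.sg (w x)) + 2^-1 * Num.sg (w x)).
  by apply: WD => //; exact: WM.
apply/funext => x; rewrite indicE; have [wx0|wx0|wx0] := ltgtP (w x) 0.
- by rewrite ltr0_sg// memNset /=; [field|rewrite lt_gtF].
- by rewrite gtr0_sg// mem_set//=; field.
- by rewrite wx0 sgr0 memNset /= ?wx0 ?ltxx// !mulr0 addr0.
Qed.

(** The sets with indicator in [W] form a sigma-algebra. Once it contains the generating sets c < l,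
    every indicator multiplies the function 1 of [D] into [D], and the choice l = 0 compares the
    masses. *)
Lemma eq_probability A : measurable A -> mu A = nu A.
Proof.
move=> mA; pose S := [set A | measurable A /\ W (\1_A)].
suff [_ [_ H]] : S A.
  have [_ /(_ _ L0)[+ _]] := H _ D1.
  under eq_Rintegral do rewrite mulr1 cos0 mulr1.
  under [RHS]eq_Rintegral do rewrite mulr1 cos0 mulr1.
  rewrite !expect_indic// => H2.
  by rewrite -(fineK (fin_num_measure mu A mA)) -(fineK (fin_num_measure nu A mA)) H2.
apply: (genL _ _ mA).
- split.
  + split=> //; rewrite indic0 (_ : cst 0 = fun x => 0 * 1 + 0 * 1 :> R); first exact: WD.
    by apply/funext => x; rewrite !mul0r addr0.
  + move=> B [mB WB]; split; first exact: measurableD.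
    rewrite (_ : \1_ _ = fun x => 1 * 1 + (-1) * \1_B x :> R); first exact: WD.
    by apply/funext => x; rewrite !indicE in_setD in_setT; case: (x \in B) => /=; ring.
  + move=> F SF; split; first by apply: bigcup_measurable => k _; exact: (SF k).1.
    (* The complement of a finite union has a product of indicators, so [WM] applies; the countable
       union is then a bounded limit. *)
    have WC n : W (fun x => 1 - \1_(\bigcup_(i < n) F i) x).
      elim: n => [|n IH].
        by rewrite bigcup_mkord big_ord0 indic0 (_ : (fun x => _) = fun=> 1)//;
          apply/funext => x; rewrite subr0.
      rewrite (_ : (fun x => _) = fun x => (1 - \1_(\bigcup_(i < n) F i) x) *
        (1 * 1 + (-1) * \1_(F n) x)).
        by apply: WM => //; apply: WD => //; exact: (SF n).2.
      apply/funext => x; rewrite !bigcup_mkord big_ord_recr /= !indicE in_setU.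
      by case: (x \in \big[_/_]_(_ < n) _); case: (x \in F n) => /=; ring.
    apply: (@W_cvg (fun n x => \1_(\bigcup_(i < n) F i) x) _ 1) => [n|n x|x].
    * rewrite (_ : (fun x => _) = fun x => 1 * 1 + (-1) * (1 - \1_(\bigcup_(i < n) F i) x)).
        exact: WD.
      by apply/funext => x; ring.
    * by rewrite indicE; case: (_ \in _); rewrite ?normr1 ?normr0.
    * apply: cvg_near_cst; have [xF|xF] := pselect ((\bigcup_i F i) x).
        have [i _ Fix] := xF; exists i.+1 => // n ni /=.
        by rewrite !indicE !mem_set//; exists i.
      near=> n; rewrite !indicE !memNset//; apply: contra_not xF => -[i _ Fix].
      by exists i.
- move=> l c Ll; split.
    rewrite (_ : [set x | c < l x] = setT `&` l @^-1` `]c, +oo[); last first.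
      by rewrite setTI; apply/seteqP; split => x /=; rewrite in_itv /= andbT.
    by apply: (mL Ll) => //; exact: measurable_itv.
  (* At a fixed point, this sine has the sign of l - c as soon as |l - c| / (n + 1) < pi, so its
     positivity set is eventually correct there. *)
  have H n : W (fun x => sin ((l x - c) / n.+1%:R)).
    have [Wc Ws] := W_cos_sin (LZ n.+1%:R^-1 Ll).
    rewrite (_ : (fun x => _) = fun x => cos (c / n.+1%:R) * sin (n.+1%:R^-1 * l x) +
      (- sin (c / n.+1%:R)) * cos (n.+1%:R^-1 * l x)); first exact: WD.
    by apply/funext => x; rewrite mulrBl sinB [l x * _]mulrC; ring.
  have H2 n : W (\1_[set x | 0 < sin ((l x - c) / n.+1%:R)]).
    by apply: W_positive => // x; rewrite ler_norml sin_geN1 sin_le1.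
  apply: (@W_cvg _ _ 1 H2) => [n x|x].
    by rewrite indicE; case: (_ \in _); rewrite ?normr1 ?normr0.
  apply: cvg_near_cst.
  have d0 : 0 < pi / (`|l x - c| + 1) by rewrite divr_gt0 ?pi_gt0// ltr_wpDl.
  have [N _ HN] := near_infty_natSinv_lt (PosNum d0).
  exists N => // n /HN /= Hn; rewrite !indicE; congr ((nat_of_bool _)%:R).
  have n0 : 0 < n.+1%:R^-1 :> R by rewrite invr_gt0.
  have Hs : `|l x - c| / n.+1%:R < pi.
    rewrite (@le_lt_trans _ _ ((`|l x - c| + 1) / n.+1%:R))//.
      by rewrite ler_wpM2r ?lerDl// ltW.
    by rewrite mulrC -ltr_pdivlMr// ltr_wpDl.
  apply/idP/idP => /set_mem /= Hx; apply/mem_set => /=.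
    rewrite ltNge; apply/negP => lc; move: Hx; apply/negP; rewrite -leNgt.
    rewrite -(opprK (_ / _)) sinN oppr_le0 sin_ge0_pi// -mulNr opprB.
    move: Hs; rewrite ler0_norm ?subr_le0// opprB => /ltW Hs.
    by rewrite Hs andbT mulr_ge0 ?subr_ge0// ltW.
  move: Hs; rewrite gtr0_norm ?subr_gt0// => Hs.
  by apply: sin_gt0_pi; rewrite Hs andbT mulr_gt0// subr_gt0.
Unshelve. all: by end_near. Qed.

End CharacteristicUniqueness.

(** * The normal law *)

Lemma expect_density d (T : measurableType d) (R : realType) (nu : probability T R)
    (lam : {sigma_finite_measure set T -> \bar R}) (p f : T -> R) :
  nu `<< lam -> lam.-integrable setT (EFin \o p) ->
  (forall A, measurable A -> nu A = \int[lam]_(x in A) (p x)%:E)%E ->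
  bounded_measurable f -> \int[nu]_x f x = \int[lam]_x (f x * p x).
Proof.
move=> dom ip H bf; congr fine.
have if_ := bm_integrable nu bf.
rewrite -(@Radon_Nikodym_change_of_variables _ _ _ nu lam dom (EFin \o f) setT)//.
have iRN := @Radon_Nikodym_integrable _ _ _ (charge_of_finite_measure nu) lam dom.
apply: ae_eq_integral => //.
- apply: emeasurable_funM; first exact: measurable_int if_.
  exact: measurable_int iRN.
- rewrite (_ : (fun x => _) = (EFin \o f) \* (EFin \o p))%E; last by apply/funext.
  apply: emeasurable_funM; first exact: measurable_int if_.
  exact: measurable_int ip.
have : ae_eq lam setT (Radon_Nikodym (charge_of_finite_measure nu) lam) (EFin \o p).
  apply: integral_ae_eq => //; first exact: measurable_int ip.
  move=> A _ mA.
  by rewrite -Radon_Nikodym_integral// -[LHS]/(nu A) H.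
by apply: filterS => x /(_ I) E _; rewrite E -EFinM.
Qed.

Section NormalCharacteristic.
Context (R : realType) (m s : R).
Hypothesis s0 : s != 0.
Local Notation leb := (@lebesgue_measure R).
Local Notation p := (normal_pdf m s).

Let s2 : 0 < s ^+ 2. Proof. by rewrite exprn_even_gt0. Qed.

(** The quadratic weight is paid for by doubling the variance. With a = (x - m)^2 / (4 s^2), the
    density at s carries exp(-2 a), the one at sqrt 2 * s carries exp(-a), and 1 + x^2 <= K (1 + a)
    <= K exp(a). *)
Let normal_pdf_moment_bound : exists2 C, 0 < C & forall x, (1 + x ^+ 2) * p x <= C * normal_pdf m (Num.sqrt 2 * s) x.
Proof.
have s0' : Num.sqrt 2 * s != 0 by rewrite mulf_neq0// gt_eqF// sqrtr_gt0.
pose K := (1 + 2 * m ^+ 2) + 2 * (4 * s ^+ 2).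
have K0 : 0 < K by rewrite /K; have := sqr_ge0 m; have := s2; lra.
pose k := normal_peak s / normal_peak (Num.sqrt 2 * s).
have k0 : 0 < k by rewrite divr_gt0 ?normal_peak_gt0.
exists (K * k); first by rewrite mulr_gt0.
move=> x; rewrite !normal_pdfE// /normal_fun exprMn sqr_sqrtr//.
have v0 := s2; set y := (x - m) ^+ 2; set v := s ^+ 2 in v0 K K0 *.
pose a := y / (4 * v).
have y0 : 0 <= y by rewrite sqr_ge0.
have a0 : 0 <= a by rewrite divr_ge0// mulr_ge0// ltW.
have vn0 : v != 0 by rewrite gt_eqF.
have -> : - y / (2 * v *+ 2) = - a by rewrite -[_ *+ 2]mulr_natl /a; field.
have -> : - y / (v *+ 2) = - a - a by rewrite -[_ *+ 2]mulr_natl /a; field.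
have H1 : 1 + x ^+ 2 <= K * expR a.
  have H : 1 + x ^+ 2 <= K * (1 + a).
    have Hx : x ^+ 2 <= 2 * m ^+ 2 + 2 * y.
      by rewrite -subr_ge0 /y (_ : _ - _ = (x - 2 * m) ^+ 2) ?sqr_ge0//; ring.
    have Hy : y = 4 * v * a by rewrite /a; field; rewrite gt_eqF.
    rewrite /K; have m0 := sqr_ge0 m; move: Hx; rewrite Hy.
    set mm := m ^+ 2 in m0 *; set xx := x ^+ 2.
    have : 0 <= mm * a by rewrite mulr_ge0.
    have : 0 <= v * a by rewrite mulr_ge0// ltW.
    nra.
  by rewrite (le_trans H)// ler_pM2l// expR_ge1Dx.
rewrite expRD expRN.
have -> : K * k * (normal_peak (Num.sqrt 2 * s) * (expR a)^-1) =
    K * expR a * (normal_peak s * ((expR a)^-1 * (expR a)^-1)).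
  by rewrite /k; field; rewrite !gt_eqF ?expR_gt0 ?normal_peak_gt0.
by rewrite ler_wpM2r// mulr_ge0 ?normal_peak_ge0// mulr_ge0// invr_ge0 expR_ge0.
Qed.

Let mp : measurable_fun [set: R] p. Proof. exact: measurable_normal_pdf. Qed.
Let p0 x : 0 <= p x. Proof. exact: normal_pdf_ge0. Qed.

Lemma integrable_normal_moment (h : R -> R) K : measurable_fun [set: R] h -> 0 <= K ->
  (forall x, `|h x| <= K * (1 + x ^+ 2)) -> leb.-integrable [set: R] (fun x => (h x * p x)%:E).
Proof.
move=> mh K0 hx; have [C C0 HC] := normal_pdf_moment_bound.
apply: (@le_integrable _ _ _ leb _ measurableT _
  (fun x => (K * C)%:E * (normal_pdf m (Num.sqrt 2 * s) x)%:E)%E).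
- by apply/measurable_EFinP; exact: measurable_funM.
- move=> x _; rewrite /= lee_fin normrM (ger0_norm (p0 x)).
  rewrite [leRHS]ger0_norm; last by rewrite mulr_ge0 ?normal_pdf_ge0// mulr_ge0// ltW.
  by rewrite -mulrA (le_trans _ (ler_wpM2l K0 (HC x)))// mulrA ler_wpM2r.
- by apply: integrableZl => //; exact: integrable_normal_pdf.
Qed.

Let continuous_p : continuous p. Proof. exact: continuous_normal_pdf. Qed.


Let is_derive_p (x : R) : is_derive x (1 : R) (p : R -> R) (- ((x - m) / s ^+ 2) * p x).
Proof.
have vn0 : s ^+ 2 != 0 by rewrite gt_eqF.
rewrite normal_pdfE// /normal_fun; apply: is_derive_eq.
by rewrite -[_ *+ 2]mulr_natl /GRing.scale /=; set E := expR _; field.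
Qed.

Let p_decay : exists2 C, 0 <= C & forall n : nat,
  p n.+1%:R <= C / n.+1%:R /\ p (- n.+1%:R) <= C / n.+1%:R.
Proof.
have [C C0 HC] := normal_pdf_moment_bound.
have s0' : Num.sqrt 2 * s != 0 by rewrite mulf_neq0// gt_eqF// sqrtr_gt0.
exists (C * normal_peak (Num.sqrt 2 * s)).
  by rewrite mulr_ge0 ?normal_peak_ge0// ltW.
move=> n; have H x : n.+1%:R = `|x| -> p x <= C * normal_peak (Num.sqrt 2 * s) / n.+1%:R.
  move=> nx; rewrite ler_pdivlMr ?ltr0n// mulrC.
  rewrite (@le_trans _ _ ((1 + x ^+ 2) * p x))//; last first.
    by rewrite (le_trans (HC x))// ler_pM2l// normal_pdf_ub.
  rewrite ler_wpM2r//; rewrite -real_normK ?num_real// -nx.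
  have : (1 : R) <= n.+1%:R by rewrite ler1n.
  by set N := n.+1%:R; nra.
by split; apply: H; rewrite ?normrN ger0_norm.
Qed.

(** Stein's identity: the integrand is the derivative of g * p, and the boundary terms at n + 1 and
    - (n + 1) vanish by [p_decay]. *)
Lemma normal_integration_by_parts (g g' : R -> R) K : 0 <= K ->
  (forall x : R, is_derive x (1 : R) g (g' x)) -> continuous g' ->
  (forall x, `|g x| <= 1) -> (forall x, `|g' x| <= K) ->
  \int[leb]_x ((g' x - g x * ((x - m) / s ^+ 2)) * p x) = 0.
Proof.
move=> K0 dg cg' g1 gK.
have cg : continuous g.
  by move=> x; apply: differentiable_continuous; apply/derivable1_diffP; case: (dg x).
pose q x := g' x - g x * ((x - m) / s ^+ 2).
have cq : continuous q.
  move=> x; apply: cvgB; first exact: cg'.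
  apply: cvgM; first exact: cg.
  apply: cvgM; last exact: cvg_cst.
  by apply: cvgB; [exact: cvg_id|exact: cvg_cst].
have mq : measurable_fun [set: R] q by exact: continuous_measurable_fun.
pose K1 := K + (1 + `|m|) / s ^+ 2.
have K10 : 0 <= K1 by rewrite addr_ge0// divr_ge0 ?addr_ge0// ltW.
have qb x : `|q x| <= K1 * (1 + x ^+ 2).
  have x2 : 0 <= x ^+ 2 by rewrite sqr_ge0.
  rewrite /q (le_trans (ler_normB _ _))// /K1 [leRHS]mulrDl lerD//.
    by rewrite (le_trans (gK x))// ler_peMr// lerDl.
  rewrite normrM normrM normfV (ger0_norm (ltW s2)) -mulrA mulrCA mulrA.
  rewrite [leRHS]mulrA [leRHS]mulrAC ler_wpM2r ?invr_ge0 ?(ltW s2)//.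
  rewrite (@le_trans _ _ (1 * `|x - m|))//; first by rewrite mulrC ler_wpM2r.
  rewrite mul1r (le_trans (ler_normB _ _))//.
  have := normr_ge0 x; rewrite -[x ^+ 2]real_normK ?num_real//.
  have := normr_ge0 m; set a := `|x|; set b := `|m| => b0 a0.
  by have : 0 <= b * a ^+ 2; [rewrite mulr_ge0 ?sqr_ge0|nra].
have iq := integrable_normal_moment mq K10 qb.
pose h x := q x * p x.
have ch : continuous h by move=> x; apply: cvgM; [exact: cq|exact: continuous_p].
pose J n : set R := [set` `[- n.+1%:R, n.+1%:R]].
have mJ n : measurable (J n) by exact: measurable_itv.
have cv1 : (\int[leb]_(x in J n) (h x)%:E @[n --> \oo] --> \int[leb]_x (h x)%:E)%E.
  rewrite (_ : (fun n => _) = fun n => (\int[leb]_x ((EFin \o h) \_ (J n)) x)%E); last first.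
    by apply/funext => n; rewrite -integral_mkcond.
  have [] := @dominated_convergence _ _ _ leb _ measurableT
    (fun n => (EFin \o h) \_ (J n)) (EFin \o h) (abse \o (EFin \o h)).
  - move=> n; apply/(measurable_restrictT _ (mJ n)).
    by apply: measurable_funTS; exact: measurable_int iq.
  - exact: measurable_int iq.
  - apply: aeW => x _; apply: cvg_near_cst.
    exists (Num.truncn `|x|) => // n /= xn; rewrite patchE mem_set// /J /= in_itv /= -ler_norml.
    rewrite (le_trans (ltW (truncnS_gt _)))// ler_nat ltnS//.
  - exact: integrable_abse.
  - apply: aeW => x n _; rewrite patchE; case: ifP => _ //; rewrite abse0 abse_ge0//.
  by [].
pose H x := g x * p x.
have dH (x : R) : is_derive x (1 : R) H (h x).
  have := dg x; have := is_derive_p x => d1 d2.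
  rewrite /H; apply: is_derive_eq.
  by rewrite /GRing.scale /= /h /q; ring.
have cH : continuous H.
  by move=> x; apply: differentiable_continuous; apply/derivable1_diffP; case: (dH x).
have E n : (\int[leb]_(x in J n) (h x)%:E = (H n.+1%:R - H (- n.+1%:R))%:E)%E.
  rewrite (@continuous_FTC2 _ h H)//.
  - by rewrite gtrN// ltr0n.
  - exact: continuous_subspaceT.
  - split => [x _||].
    + by case: (dH x).
    + by apply: cvg_at_right_filter; exact: cH.
    + by apply: cvg_at_left_filter; exact: cH.
  - by move=> x _; rewrite derive1E; apply: derive_val.
have [C C0 HC] := p_decay.
have cv0 : H n.+1%:R - H (- n.+1%:R) @[n --> \oo] --> 0.
  apply/norm_cvg0P.
  apply: (@squeeze_cvgr _ _ _ _ (fun=> 0) (fun n => (C + C) * n.+1%:R^-1)).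
  - apply: nearW => n; rewrite normr_ge0/= (le_trans (ler_normB _ _))// mulrDl.
    have [H1 H2] := HC n.
    rewrite lerD// /H normrM (ger0_norm (p0 _)).
      by rewrite (le_trans _ H1)// ler_piMl.
    by rewrite (le_trans _ H2)// ler_piMl.
  - exact: cvg_cst.
  - rewrite -[X in _ --> X](mulr0 (C + C)); apply: cvgM; first exact: cvg_cst.
    exact: cvg_harmonic.
have cv2 : (\int[leb]_(x in J n) (h x)%:E @[n --> \oo] --> 0%:E)%E.
  under eq_fun do rewrite E.
  by apply: cvg_EFin => //; exact: nearW.
have := cvg_unique (@ereal_hausdorff R) cv1 cv2.
by rewrite /Rintegral => ->.
Qed.


Let c t := \int[leb]_x (cos (t * x) * p x).
Let S t := \int[leb]_x (sin (t * x) * p x).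

Let m_lin t : measurable_fun [set: R] (fun x => t * x : R).
Proof. exact: measurable_funM. Qed.

Let int_p (h : R -> R) : measurable_fun [set: R] h -> (forall x, `|h x| <= 1) ->
  leb.-integrable [set: R] (fun x => (h x * p x)%:E).
Proof.
move=> mh h1; apply: (@integrable_normal_moment _ 1) => // x.
by rewrite mul1r (le_trans (h1 x))// lerDl sqr_ge0.
Qed.

Let int_xp (h : R -> R) : measurable_fun [set: R] h -> (forall x, `|h x| <= 1) ->
  leb.-integrable [set: R] (fun x => (x * h x * p x)%:E).
Proof.
move=> mh h1; apply: (@integrable_normal_moment _ 1) => // [|x].
  exact: measurable_funM.
rewrite mul1r normrM (@le_trans _ _ (`|x| * 1))//; first by rewrite ler_wpM2l.
by rewrite mulr1 -real_normK ?num_real//; have := normr_ge0 x; set a := `|x|; nra.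
Qed.

Let cos1 (x : R) : `|cos x| <= 1. Proof. by rewrite ler_norml cos_geN1 cos_le1. Qed.
Let sin1 (x : R) : `|sin x| <= 1. Proof. by rewrite ler_norml sin_geN1 sin_le1. Qed.
Let mcos t : measurable_fun [set: R] (fun x : R => cos (t * x)).
Proof. exact: (measurableT_comp (continuous_measurable_fun (@continuous_cos R)) (m_lin t)). Qed.
Let msin t : measurable_fun [set: R] (fun x : R => sin (t * x)).
Proof. exact: (measurableT_comp (continuous_measurable_fun (@continuous_sin R)) (m_lin t)). Qed.

Let X_sin t := \int[leb]_x (x * sin (t * x) * p x).
Let X_cos t := \int[leb]_x (x * cos (t * x) * p x).

(** The derivative in u is dominated by the integrable |x| p(x) uniformly in u, so any neighbourhood
    of t serves; the one of radius 1 is taken. *)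
Let derive_under (f df : R -> R -> R) (t : R) :
  (forall u, leb.-integrable [set: R] (fun x => (f u x * p x)%:E)) ->
  (forall u x : R, is_derive u (1 : R) (f ^~ x) (df u x)) ->
  (forall u x, `|df u x| <= `|x|) ->
  is_derive t (1 : R) (fun u => \int[leb]_x (f u x * p x)) (\int[leb]_x (df t x * p x)).
Proof.
move=> intf df1 dfx.
have d1 u x : is_derive u (1 : R) (fun v => f v x * p x) (df u x * p x).
  have := df1 u x => H; apply: is_derive_eq.
  by rewrite /GRing.scale /= mulr0 add0r mulrC.
have D u x : partial1of2 (fun v y => f v y * p y) u x = df u x * p x.
  by rewrite /partial1of2 derive1E; apply: derive_val.
have It : `]t - 1, t + 1[%classic t by rewrite /= in_itv /=; apply/andP; split; lra.
have iG : leb.-integrable [set: R] (EFin \o (fun x => `|x| * p x)).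
  apply: (@integrable_normal_moment _ 1) => // x.
  rewrite mul1r normr_id -real_normK ?num_real//; have := normr_ge0 x; set a := `|x|; nra.
have G0 x : 0 <= `|x| * p x by rewrite mulr_ge0.
have Gub u x : `]t - 1, t + 1[%classic u -> [set: R] x ->
    `|partial1of2 (fun v y => f v y * p y) u x| <= `|x| * p x.
  by move=> _ _; rewrite D normrM (ger0_norm (p0 x)) ler_wpM2r.
apply: DeriveDef.
  exact: (@derivable_under_integral R _ _ leb (fun v y => f v y * p y) setT measurableT
    t (t - 1) (t + 1) It (fun u _ => intf u) (fun u x _ _ => @ex_derive _ _ _ _ _ _ _ (d1 u x))
    (fun x => `|x| * p x) G0 iG Gub).
rewrite -derive1E (@differentiation_under_integral R _ _ leb (fun v y => f v y * p y) setT
  measurableT t (t - 1) (t + 1) It (fun u _ => intf u)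
  (fun u x _ _ => @ex_derive _ _ _ _ _ _ _ (d1 u x)) (fun x => `|x| * p x) G0 iG Gub).
by apply: eq_Rintegral => x _; rewrite D.
Qed.

Let is_derive_c (t : R) : is_derive t (1 : R) c (- X_sin t).
Proof.
have -> : - X_sin t = \int[leb]_x ((- (x * sin (t * x))) * p x).
  rewrite -mulN1r -RintegralZl//; last exact: int_xp.
  by apply: eq_Rintegral => x _; ring.
apply: (@derive_under (fun u x => cos (u * x)) (fun u x => - (x * sin (u * x)))) => [u|u x|u x]; first exact: int_p.
- by apply: is_derive_eq; rewrite /GRing.scale /=; ring.
- by rewrite normrN normrM ler_piMr.
Qed.

Let is_derive_S (t : R) : is_derive t (1 : R) S (X_cos t).
Proof.
apply: (@derive_under (fun u x => sin (u * x)) (fun u x => x * cos (u * x))) => [u|u x|u x]; first exact: int_p.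
- by apply: is_derive_eq; rewrite /GRing.scale /=; ring.
- by rewrite normrM ler_piMr.
Qed.

Let int_comb3 (f g h : R -> R) (a b d : R) : leb.-integrable setT (EFin \o f) ->
  leb.-integrable setT (EFin \o g) -> leb.-integrable setT (EFin \o h) ->
  \int[leb]_x (a * f x + b * g x + d * h x) =
  a * \int[leb]_x f x + b * \int[leb]_x g x + d * \int[leb]_x h x.
Proof.
move=> If Ig Ih.
have Z k l : leb.-integrable setT (EFin \o k) -> leb.-integrable setT (EFin \o (fun x => l * k x)).
  by move=> Ik; exact: (integrableZl measurableT l Ik).
rewrite RintegralD//; [|exact: (integrableD measurableT (Z _ a If) (Z _ b Ig))|exact: Z].
by rewrite RintegralD//; [|exact: Z..]; rewrite !RintegralZl.
Qed.

(** Stein's identity for sin (t x). Together with [X_cosE] it expresses the derivatives of the pair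
    (c, S) through the pair itself, a linear differential system. *)
Let X_sinE t : X_sin t = s ^+ 2 * t * c t + m * S t.
Proof.
have vn0 : s ^+ 2 != 0 by rewrite gt_eqF.
have := @normal_integration_by_parts (fun x => sin (t * x)) (fun x => t * cos (t * x)) `|t|.
have dg (x : R) : is_derive x (1 : R) (fun x => sin (t * x)) (t * cos (t * x)).
  by apply: is_derive_eq; rewrite /GRing.scale /=; ring.
move=> /(_ (normr_ge0 _) dg) H.
have {H} : \int[leb]_x ((t * cos (t * x) - sin (t * x) * ((x - m) / s ^+ 2)) * p x) = 0.
  apply: H => // [x|x]; last by rewrite normrM ler_piMr.
  apply: cvgM; first exact: cvg_cst.
  apply: (cvg_comp (fun x => t * x) cos); last exact: continuous_cos.
  by apply: cvgM; [exact: cvg_cst|exact: cvg_id].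
rewrite (_ : \int[leb]_x _ = t * c t + (- (s ^+ 2)^-1) * X_sin t + (m / s ^+ 2) * S t).
  move=> /(congr1 (fun z => s ^+ 2 * z)); rewrite mulr0 => H.
  have E : s ^+ 2 * (t * c t + (- (s ^+ 2)^-1) * X_sin t + (m / s ^+ 2) * S t) =
    s ^+ 2 * (t * c t) - X_sin t + m * S t by field.
  by move: H; rewrite E; lra.
rewrite -int_comb3; [|exact: int_p|exact: int_xp|exact: int_p].
by apply: eq_Rintegral => x _; field.
Qed.

Let X_cosE t : X_cos t = m * c t - s ^+ 2 * t * S t.
Proof.
have vn0 : s ^+ 2 != 0 by rewrite gt_eqF.
have := @normal_integration_by_parts (fun x => cos (t * x)) (fun x => - t * sin (t * x)) `|t|.
have dg (x : R) : is_derive x (1 : R) (fun x => cos (t * x)) (- t * sin (t * x)).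
  by apply: is_derive_eq; rewrite /GRing.scale /=; ring.
move=> /(_ (normr_ge0 _) dg) H.
have {H} : \int[leb]_x ((- t * sin (t * x) - cos (t * x) * ((x - m) / s ^+ 2)) * p x) = 0.
  apply: H => // [x|x]; last by rewrite normrM normrN ler_piMr.
  apply: cvgM; first exact: cvg_cst.
  apply: (cvg_comp (fun x => t * x) sin); last exact: continuous_sin.
  by apply: cvgM; [exact: cvg_cst|exact: cvg_id].
rewrite (_ : \int[leb]_x _ = - t * S t + (- (s ^+ 2)^-1) * X_cos t + (m / s ^+ 2) * c t).
  move=> /(congr1 (fun z => s ^+ 2 * z)); rewrite mulr0 => H.
  have E : s ^+ 2 * (- t * S t + (- (s ^+ 2)^-1) * X_cos t + (m / s ^+ 2) * c t) =
    s ^+ 2 * (- t * S t) - X_cos t + m * c t by field.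
  by move: H; rewrite E; lra.
rewrite -int_comb3; [|exact: int_p|exact: int_xp|exact: int_p].
by apply: eq_Rintegral => x _; field.
Qed.

(** In complex form, E = c + i S solves E' = (i m - s^2 t) E. [A] and [B] are the real and imaginary
    parts of E(t) exp(- i m t + s^2 t^2 / 2), which is constant. *)
Lemma normal_characteristic t :
  \int[leb]_x (cos (t * x) * p x) = cos (m * t) * expR (- (s ^+ 2 * t ^+ 2 / 2)) /\
  \int[leb]_x (sin (t * x) * p x) = sin (m * t) * expR (- (s ^+ 2 * t ^+ 2 / 2)).
Proof.
rewrite -/(c t) -/(S t).
pose e (t : R) := expR (s ^+ 2 * t ^+ 2 / 2).
have de (u : R) : is_derive u (1 : R) e (e u * (s ^+ 2 * u)).
  by rewrite /e; apply: is_derive_eq; rewrite /GRing.scale /=; field.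
pose A t := (c t * cos (m * t) + S t * sin (m * t)) * e t.
pose B t := (S t * cos (m * t) - c t * sin (m * t)) * e t.
have dA (u : R) : is_derive u (1 : R) A 0.
  have := is_derive_c u; have := is_derive_S u; have := de u => H1 H2 H3.
  by rewrite /A; apply: is_derive_eq; rewrite /GRing.scale /= X_sinE X_cosE; ring.
have dB (u : R) : is_derive u (1 : R) B 0.
  have := is_derive_c u; have := is_derive_S u; have := de u => H1 H2 H3.
  by rewrite /B; apply: is_derive_eq; rewrite /GRing.scale /= X_sinE X_cosE; ring.
have At : A t = A 0 by exact: is_derive_0_is_cst.
have Bt : B t = B 0 by exact: is_derive_0_is_cst.
have e0 : e 0 = 1 by rewrite /e expr0n /= mulr0 mul0r expR0.
have c0 : c 0 = 1.
  rewrite /c; under eq_Rintegral do rewrite mul0r cos0 mul1r.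
  by rewrite /Rintegral integral_normal_pdf.
have S0 : S 0 = 0.
  rewrite /S; under eq_Rintegral do rewrite mul0r sin0 mul0r.
  by rewrite /Rintegral integral0.
have A0 : A 0 = 1 by rewrite /A e0 c0 S0 mulr0 cos0 sin0; ring.
have B0 : B 0 = 0 by rewrite /B e0 c0 S0 mulr0 cos0 sin0; ring.
have et : 0 < e t by exact: expR_gt0.
have E1 : c t * cos (m * t) + S t * sin (m * t) = (e t)^-1.
  by apply: (mulIf (lt0r_neq0 et)); rewrite mulVf ?gt_eqF// -A0 -At.
have E2 : S t * cos (m * t) - c t * sin (m * t) = 0.
  by apply: (mulIf (lt0r_neq0 et)); rewrite mul0r -B0 -Bt.
have cs := cos2Dsin2 (m * t).
rewrite expRN -/(e t) -E1; split.
- transitivity (c t * (cos (m * t) ^+ 2 + sin (m * t) ^+ 2)); first by rewrite cs mulr1.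
  have -> : cos (m * t) * (c t * cos (m * t) + S t * sin (m * t)) =
    c t * (cos (m * t) ^+ 2 + sin (m * t) ^+ 2) +
    (S t * cos (m * t) - c t * sin (m * t)) * sin (m * t) by ring.
  by rewrite E2 mul0r addr0.
- transitivity (S t * (cos (m * t) ^+ 2 + sin (m * t) ^+ 2)); first by rewrite cs mulr1.
  have -> : sin (m * t) * (c t * cos (m * t) + S t * sin (m * t)) =
    S t * (cos (m * t) ^+ 2 + sin (m * t) ^+ 2) -
    (S t * cos (m * t) - c t * sin (m * t)) * cos (m * t) by ring.
  by rewrite E2 mul0r subr0.
Qed.

End NormalCharacteristic.

(** * Quantiles and the uniform law *)

Lemma normal_law_characteristic (R : realType) (nu : probability (measurableTypeR R) R) (m v t : R) :
  0 <= v -> (forall A, measurable A -> nu A = normal_law m v A) ->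
  \int[nu]_x cos (t * x) = cos (m * t) * expR (- (v * t ^+ 2 / 2)) /\
  \int[nu]_x sin (t * x) = sin (m * t) * expR (- (v * t ^+ 2 / 2)).
Proof.
move=> v0 H.
have mt : measurable_fun [set: measurableTypeR R] (fun x : measurableTypeR R => t * x : R).
  exact: measurable_funM.
have [v00|vn0] := eqVneq v 0.
  have E f : bounded_measurable f -> \int[nu]_x f x = f m.
    move=> [mf _]; rewrite (@expect_eq_measure _ _ _ nu (\d_(m : measurableTypeR R))); last first.
      by move=> A mA; rewrite H// /normal_law v00 eqxx.
    rewrite /Rintegral integral_dirac//; last exact/measurable_EFinP.
    by rewrite diracT mul1e.
  rewrite v00 mul0r mul0r oppr0 expR0 !mulr1 (E (fun x => cos (t * x))); last exact: bm_cos.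
  by rewrite (E (fun x => sin (t * x))) 1?[t * m]mulrC//; exact: bm_sin.
have s0 : Num.sqrt v != 0 by rewrite gt_eqF// sqrtr_gt0 lt_neqAle eq_sym vn0.
have E f : bounded_measurable f ->
    \int[nu]_x f x = \int[lebesgue_measure]_x (f x * normal_pdf m (Num.sqrt v) x).
  move=> bf; rewrite (@expect_eq_measure _ _ _ nu (normal_prob m (Num.sqrt v))); last first.
    by move=> A mA; rewrite H// /normal_law (negbTE vn0).
  apply: expect_density => //; first exact: normal_prob_dominates.
  exact: integrable_normal_pdf.
rewrite !E; [|exact: bm_sin|exact: bm_cos].
by have := normal_characteristic m s0 t; rewrite sqr_sqrtr.
Qed.


Section RealLaws.
Context (R : realType).
Local Notation TR := (measurableTypeR R).

Lemma sigma_algebra_real (S : set (set TR)) : sigma_algebra setT S ->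
  (forall c, S [set x : TR | c < x]) -> forall A : set TR, measurable A -> S A.
Proof.
move=> sS HS A mA.
have : (RGenOInfty.G (R:=R)).-sigma.-measurable A by rewrite -RGenOInfty.measurableE.
apply: smallest_sub => // _ [x ->].
by rewrite (_ : `]x, +oo[%classic = [set y : TR | x < y])//; apply/seteqP; split => y /=;
  rewrite in_itv /= andbT.
Qed.

Lemma eq_real_law (mu nu : probability TR R) :
  (forall t : R, \int[mu]_x cos (t * x) = \int[nu]_x cos (t * x)) ->
  (forall t : R, \int[mu]_x sin (t * x) = \int[nu]_x sin (t * x)) ->
  forall A : set TR, measurable A -> mu A = nu A.
Proof.
move=> Hc Hs A mA.
pose L := [set l : TR -> R | exists t, l = fun x => t * x].
apply: (@eq_probability _ _ _ mu nu L) => //.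
- by move=> _ _ [t ->] [u ->]; exists (t + u); apply/funext => x; rewrite mulrDl.
- by move=> c _ [t ->]; exists (c * t); apply/funext => x; rewrite mulrA.
- by exists 0; apply/funext => x; rewrite mul0r.
- by move=> _ [t ->]; exact: measurable_funM.
- move=> S sS HS; apply: sigma_algebra_real => // c.
  have := HS (fun x => 1 * x) c; rewrite (_ : [set x : TR | c < 1 * x] = [set x : TR | c < x]).
    by apply; exists 1.
  by apply/seteqP; split => x /=; rewrite mul1r.
- by move=> _ [t ->]; exact: Hc.
- by move=> _ [t ->]; exact: Hs.
Qed.

Lemma eq_half_line_law (mu nu : probability TR R) :
  (forall c : R, mu [set x : TR | c < x] = nu [set x : TR | c < x]) ->
  forall A : set TR, measurable A -> mu A = nu A.
Proof.
move=> H A mA.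
have mG (c : R) : measurable [set x : TR | c < x].
  rewrite (_ : [set x : TR | c < x] = `]c, +oo[%classic); first exact: measurable_itv.
  by apply/seteqP; split => x /=; rewrite in_itv /= andbT.
pose G := [set B : set TR | exists c : R, B = [set x : TR | c < x]].
apply: (@g_sigma_algebra_measure_unique _ _ _ G _ (fun n => [set x : TR | - n%:R < x])).
- by move=> _ [c ->].
- by move=> n; exists (- n%:R).
- apply/seteqP; split => // x _; exists (Num.truncn `|x|).+1 => //=.
  rewrite ltrNl (le_lt_trans (ler_norm _))// normrN.
  exact: truncnS_gt.
- move=> _ _ [c ->] [d ->]; exists (Num.max c d).
  by apply/seteqP; split => x /=; rewrite gt_max; [move=> [-> ->]|move=> /andP].
- by move=> _ [c ->]; exact: H.
- by move=> n; apply: (le_lt_trans (probability_le1 _ (mG _))); rewrite ltry.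
- apply: (@sigma_algebra_real <<s G >> (smallest_sigma_algebra setT G)) => // c.
  by apply: sub_gen_smallest; exists c.
Qed.

Lemma sigma_algebra_preimage (U V : Type) (f : U -> V) (S : set (set U)) :
  sigma_algebra setT S -> sigma_algebra setT [set A | S (f @^-1` A)].
Proof.
move=> [S0 SD SU]; split => /=.
- by rewrite preimage_set0.
- by move=> A /SD; rewrite !setTD preimage_setC.
- by move=> F HF; rewrite preimage_bigcup; exact: SU.
Qed.

Lemma sigma_algebra_setI (U : Type) (S : set (set U)) A B :
  sigma_algebra setT S -> S A -> S B -> S (A `&` B).
Proof.
move=> sS SA SB; have [S0 SD SU] := sS.
have -> : A `&` B = setT `\` (\bigcup_i (if i is 0%N then setT `\` A else setT `\` B)).
  apply/seteqP; split => x /=.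
    by move=> [Ax Bx]; split => // -[[|i] _ [_]]; [apply|apply].
  move=> [_ H]; split; apply: contrapT => Hn; apply: H; [exists 0%N|exists 1%N] => //.
by apply: (SD); apply: (SU) => -[|i]; exact: (SD).
Qed.

Lemma sigma_algebra_prod d1 d2 (T1 : measurableType d1) (T2 : measurableType d2)
    (S : set (set (T1 * T2))) : sigma_algebra setT S ->
  (forall A, measurable A -> S (fst @^-1` A)) ->
  (forall B, measurable B -> S (snd @^-1` B)) ->
  forall C, measurable C -> S C.
Proof.
move=> sS S1 S2 C; rewrite measurable_prod_measurableType.
apply: smallest_sub => // _ [A mA [B mB <-]].
rewrite (_ : A `*` B = (fst @^-1` A) `&` (snd @^-1` B)).
  by apply: sigma_algebra_setI => //; [exact: S1|exact: S2].
by apply/seteqP; split => -[x y].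
Qed.

End RealLaws.

Section Uniform.
Context (R : realType).
Local Notation TR := (measurableTypeR R).

Definition unif : probability TR R := uniform_prob (@ltr01 R).

Lemma expect_unif (f : TR -> R) : bounded_measurable f ->
  \int[unif]_x f x = \int[lebesgue_measure]_(x in `[0, 1]) f x.
Proof.
move=> bf.
rewrite (@expect_density _ _ _ unif lebesgue_measure (uniform_pdf 0 1) f)//; last 2 first.
- exact: dominates_uniform_prob.
- exact: (integrable_uniform_pdf (@ltr01 R)).
rewrite [RHS]Rintegral_mkcond; apply: eq_Rintegral => x _.
rewrite patchE mem_setE in_itv /= /uniform_pdf; case: ifP => _; last by rewrite mulr0.
by rewrite subr0 invr1 mulr1.
Qed.

Lemma eq_expect_unif (f g : TR -> R) : bounded_measurable f -> bounded_measurable g ->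
  (forall x, 0 < x < 1 -> f x = g x) -> \int[unif]_x f x = \int[unif]_x g x.
Proof.
move=> bf bg fg; rewrite !expect_unif//.
have mf : measurable_fun [set: TR] f by case: bf.
have mg : measurable_fun [set: TR] g by case: bg.
congr fine; apply: ae_eq_integral => //.
- by apply/measurable_EFinP; exact: measurable_funTS.
- by apply/measurable_EFinP; exact: measurable_funTS.
exists ([set 0] `|` [set 1]); split.
- by apply: measurableU; exact: measurable_set1.
- by apply: countable_lebesgue_measure0; apply: finite_set_countable.
- move=> x /= /not_implyP[]; rewrite in_itv /= => /andP[x0 x1] H.
  apply: contrapT => /not_orP[/eqP xn0 /eqP xn1]; apply: H; congr EFin; apply: fg.
  by rewrite !lt_neqAle x0 x1 eq_sym xn0 xn1.
Qed.

(** The endpoints 0, 1 and b are null, so only the points of (0, 1) constrain A, and b may belong to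
    A or not. *)
Lemma unif_itv (a b : R) (A : set TR) : 0 <= a -> a <= b -> b <= 1 -> measurable A ->
  (forall x, 0 < x < 1 -> A x <-> a < x < b \/ (x = b /\ A b)) -> unif A = (b - a)%:E.
Proof.
move=> a0 ab b1 mA HA.
have mI : measurable [set` `]a, b[] by exact: measurable_itv.
rewrite -(fineK (fin_num_measure unif A mA)); congr EFin.
rewrite -expect_indic// expect_unif; last exact: bm_indic.
have -> : \int[lebesgue_measure]_(x in `[0, 1]) (\1_A x : R) =
  \int[lebesgue_measure]_(x in `[0, 1]) (\1_[set` `]a, b[] x : R).
  congr fine; apply: ae_eq_integral => //.
  - by apply/measurable_EFinP; exact: measurable_indic.
  - by apply/measurable_EFinP; exact: measurable_indic.
  exists ([set 0] `|` [set 1] `|` [set b]); split.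
  - by apply: measurableU; [apply: measurableU|]; exact: measurable_set1.
  - by apply: countable_lebesgue_measure0; apply: finite_set_countable; rewrite !finite_setU.
  - move=> x /= /not_implyP[]; rewrite in_itv /= => /andP[x0 x1] H.
    apply: contrapT => /not_orP[/not_orP[/eqP xn0 /eqP xn1] xnb]; apply: H; congr EFin.
    have x01 : 0 < x < 1 by rewrite !lt_neqAle x0 x1 eq_sym xn0 xn1.
    rewrite !indicE; congr ((nat_of_bool _)%:R); apply/idP/idP => /set_mem Hx; apply/mem_set.
      by move: Hx => /(HA x x01)[|[/xnb]//]; rewrite /= in_itv.
    by apply/(HA x x01); left; move: Hx; rewrite /= in_itv.
rewrite /Rintegral integral_indic//.
rewrite setIidl; last first.
  move=> x /=; rewrite !in_itv /= => /andP[ax xb].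
  by rewrite (le_trans a0 (ltW ax)) (le_trans (ltW xb) b1).
rewrite [X in fine X](_ : _ = (b - a)%:E)//.
apply: etrans (lebesgue_measure_itv `]a, b[) _; rewrite /= lte_fin.
case: ifPn => [//|]; rewrite -leNgt => ba.
by rewrite (le_anti (introT andP (conj ab ba))) subrr.
Qed.

(** Inverse transform: with G u the supremum of the x with F x < u, right continuity of F gives c <
    G u iff F c < u. *)
Lemma quantile_exists (nu : probability TR R) : exists G : TR -> TR,
  measurable_fun setT G /\ forall A, measurable A -> nu A = unif (G @^-1` A).
Proof.
have mid : measurable_fun [set: TR] (idfun : TR -> R) by exact: measurable_id.
pose X : {mfun TR >-> R} := HB.pack (idfun : TR -> R) (isMeasurableFun.Build _ _ TR R (idfun : TR -> R) mid).
pose F x := fine (cdf (X : {RV nu >-> R}) x).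
have FE x : (F x)%:E = cdf (X : {RV nu >-> R}) x.
  by rewrite fineK// /cdf; apply: fin_num_measure; exact: measurable_itv.
have Fnd x y : x <= y -> F x <= F y.
  by move=> xy; rewrite -lee_fin !FE; exact: cdf_nondecreasing.
have F0 x : 0 <= F x by rewrite -lee_fin FE cdf_ge0.
have F1 x : F x <= 1 by rewrite -lee_fin FE cdf_le1.
have Fr x u : (forall y, x < y -> u <= F y) -> u <= F x.
  move=> H; rewrite -lee_fin FE.
  have /cvg_lim <- // := @cdf_right_continuous _ _ _ nu (X : {RV nu >-> R}) x.
  apply: lime_ge; first by apply/cvg_ex; eexists; exact: cdf_right_continuous.
  by near=> y; rewrite -FE lee_fin; apply: H; near: y; exact: nbhs_right_gt.
pose A (u : R) := [set x : R | F x < u].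
have hsA u : 0 < u < 1 -> has_sup (A u).
  move=> /andP[u0 u1]; split.
    have : cdf (X : {RV nu >-> R}) x @[x --> -oo] --> 0%E by exact: cvg_cdfNy0.
    move=> /fine_cvg /cvgr_lt /(_ _ u0) H.
    by near (ninfty_nbhs R) => x; exists x; rewrite /A /= /F; near: x.
  have : cdf (X : {RV nu >-> R}) x @[x --> +oo] --> 1%:E by exact: cvg_cdfy1.
  move=> /fine_cvg /cvgr_gt /(_ _ u1) H.
  near (pinfty_nbhs R) => x; exists x => y /= Ay; rewrite leNgt; apply/negP => xy.
  have : u < F x by near: x.
  by rewrite ltNge (le_trans (Fnd _ _ (ltW xy)) (ltW Ay)).
(* Outside (0, 1), where [A u] may be empty or unbounded, G takes the default value 0; only u in (0,
   1) carries mass. *)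
pose G (u : TR) : TR := if (0 < u < 1) then sup (A u) else 0.
have GE u c : 0 < u < 1 -> (c < G u) = (F c < u).
  move=> u01; rewrite /G u01; apply/idP/idP => H; last first.
    rewrite ltNge; apply/negP => Gc.
    have : u <= F c; last by rewrite leNgt H.
    apply: Fr => y cy; rewrite leNgt; apply/negP => Hy.
    have : y <= sup (A u) by apply: sup_upper_bound => //; exact: hsA.
    by rewrite leNgt (le_lt_trans Gc cy).
  rewrite ltNge; apply/negP => uF; move: H; apply/negP; rewrite -leNgt.
  have [ne _] := hsA u u01.
  apply: ge_sup => // y /= Hy; rewrite leNgt; apply/negP => cy.
  by move: (lt_le_trans Hy (le_trans uF (Fnd _ _ (ltW cy)))); rewrite ltxx.
have m01 : measurable [set u : TR | 0 < u < 1].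
  rewrite (_ : [set u | _] = [set` `]0, 1[]); first exact: measurable_itv.
  by apply/seteqP; split => x /=; rewrite in_itv.
have mgt (c : R) : measurable [set u : TR | c < u].
  rewrite (_ : [set x : TR | c < x] = `]c, +oo[%classic); first exact: measurable_itv.
  by apply/seteqP; split => x /=; rewrite in_itv /= andbT.
have mGc c : measurable (G @^-1` [set x : TR | c < x]).
  rewrite (_ : _ @^-1` _ = ([set u : TR | 0 < u < 1] `&` [set u : TR | F c < u]) `|`
    (~` [set u : TR | 0 < u < 1] `&` (if c < 0 then setT else set0))).
    apply: measurableU; apply: measurableI => //; first exact: measurableC.
    by case: ifP.
  apply/seteqP; split => u /=.
    have [u01|u01] := boolP (0 < u < 1); first by rewrite GE// => ?; left.
    by rewrite {1}/G (negbTE u01) => c0; right; rewrite c0; split => //; exact/negP.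
  move=> [[u01 Fu]|[/negP u01]]; first by rewrite GE.
  by rewrite {1}/G (negbTE u01); case: ifP.
have mG : measurable_fun setT G.
  move=> _ B mB; rewrite setTI; move: B mB.
  apply: (@sigma_algebra_real R [set B | measurable (G @^-1` B)]) => //.
  by apply: sigma_algebra_preimage; exact: sigma_algebra_measurable.
exists G; split => // B mB.
have [rho Hrho] := law_exists unif mG.
rewrite -Hrho; move: B mB; apply: eq_half_line_law => c.
rewrite Hrho (@unif_itv (F c) 1)//; last first.
  move=> u u01; rewrite /= GE//; split; first by move=> ->; left; case/andP: u01.
  by move=> [/andP[]//|[u1 _]]; move: u01; rewrite u1 ltxx andbF.
have -> : [set x : TR | c < x] = ~` `]-oo, c]%classic.
  apply/seteqP; split => x /=; rewrite in_itv /=.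
    by move=> cx; apply/negP; rewrite -ltNge.
  by move=> /negP; rewrite -ltNge.
rewrite probability_setC; last exact: measurable_itv.
by rewrite EFinB FE.
Unshelve. all: by end_near. Qed.

End Uniform.

(** * Independent normal variables on the unit interval *)

Lemma bm_trunc d (T : measurableType d) (R : realType) (f : T -> R) (n : nat) :
  measurable_fun setT f -> (forall x, 0 <= f x) ->
  bounded_measurable (fun x => Num.min (f x) n%:R).
Proof.
move=> mf f0; split; first exact: measurable_minr.
by exists n%:R => x; rewrite ger0_norm ?ge_min ?lexx ?orbT// le_min f0 ler0n.
Qed.

Lemma integral_trunc d (T : measurableType d) (R : realType) (mu : probability T R)
    (f : T -> R) :
  measurable_fun setT f -> (forall x, 0 <= f x) ->
  (\int[mu]_x Num.min (f x) n%:R)%:E @[n --> \oo] --> (\int[mu]_x (f x)%:E)%E.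
Proof.
move=> mf f0.
have E : (fun n : nat => (\int[mu]_x Num.min (f x) n%:R)%:E) =
    (fun n => \int[mu]_x (Num.min (f x) n%:R)%:E)%E.
  by apply/funext => n; rewrite expect_EFin//; exact: bm_trunc.
rewrite E; have := @cvg_monotone_convergence _ _ _ mu setT measurableT
  (fun n x => (Num.min (f x) n%:R)%:E).
have L x : limn (fun n : nat => (Num.min (f x) n%:R)%:E) = (f x)%:E.
  apply/cvg_lim => //; apply: cvg_near_cst; near=> n; congr EFin.
  by apply/min_idPl; near: n; exact: nbhs_infty_ger.
under [X in _ -> X --> _]eq_fun do idtac.
rewrite (_ : \int[mu]_x (f x)%:E = \int[mu]_x (limn (fun n : nat => (Num.min (f x) n%:R)%:E)))%E; last first.
  by apply: eq_integral => x _; rewrite L.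
apply.
- by move=> n; apply/measurable_EFinP; case: (bm_trunc n mf f0).
- by move=> n x _; rewrite lee_fin le_min f0 ler0n.
- move=> x _ m n mn; rewrite lee_fin le_min ge_min lexx/= ge_min.
  by rewrite ler_nat mn orbT.
Unshelve. all: by end_near. Qed.

(** Monotone convergence: a common bound on the truncations bounds the full integral and makes it
    finite. Estimates for bounded functions pass to unbounded nonnegative ones in this way. *)
Lemma ge0_integral_le d (T : measurableType d) (R : realType) (mu : probability T R)
    (f : T -> R) (C : R) :
  measurable_fun setT f -> (forall x, 0 <= f x) ->
  (forall n : nat, \int[mu]_x Num.min (f x) n%:R <= C) ->
  (\int[mu]_x (f x)%:E <= C%:E)%E.
Proof.
move=> mf f0 H; have c := integral_trunc (mu := mu) mf f0.
rewrite -(cvg_lim _ c)//; apply: lime_le; first by apply/cvg_ex; eexists; exact: c.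
by near=> n; rewrite lee_fin; exact: H.
Unshelve. all: by end_near. Qed.

Section UniformSplitting.
Context (R : realType).
Local Notation TR := (measurableTypeR R).
Local Notation U := (@unif R).
Local Notation bm := (@bounded_measurable _ TR R).

Let H1 : 0 <= (2^-1 : R) <= 1. Proof. by apply/andP; split; lra. Qed.

Let coin : probability bool R := bernoulli_prob (2^-1 : R).

Let expect_coin (f : bool -> R) : \int[coin]_b f b = 2^-1 * f true + 2^-1 * f false.
Proof.
have b1 : bounded_measurable (\1_[set true] : bool -> R) by exact: bm_indic.
have E1 : \int[coin]_b (\1_[set true] b : R) = 2^-1.
  rewrite /Rintegral integral_bernoulli_prob//.
  by rewrite !indicE mem_set// memNset//= mulr1 mulr0 addr0.
rewrite (_ : \int[coin]_b f b = \int[coin]_b (f false + (f true - f false) * \1_[set true] b)).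
  rewrite expectD; [|exact: bm_cst|exact: bmZ].
  by rewrite expect_cst expectZ// E1; field.
apply: eq_Rintegral => -[] _; rewrite indicE.
  by rewrite mem_set// mulr1 addrC subrK.
by rewrite memNset// mulr0 addr0.
Qed.

Let int_cos (a b : R) : b != 0 -> \int[U]_x cos (a + b * x) = (sin (a + b) - sin a) / b.
Proof.
move=> b0; have mb : measurable_fun [set: TR] (fun x : TR => a + b * x : R).
  by apply: measurable_funD => //; exact: measurable_funM.
have d (x : R) : is_derive x (1 : R) (fun x : R => sin (a + b * x) / b) (cos (a + b * x)).
  by apply: is_derive_eq; rewrite /GRing.scale /=; field.
have c (f : R -> R) : continuous f -> continuous (fun x : R => f (a + b * x)).
  move=> cf x; apply: (cvg_comp (fun x => a + b * x) f); last exact: cf.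
  by apply: cvgD; [exact: cvg_cst|apply: cvgM; [exact: cvg_cst|exact: cvg_id]].
have cF : continuous (fun x : R => sin (a + b * x) / b).
  by move=> x; apply: cvgM; [exact: (c _ (@continuous_sin R))|exact: cvg_cst].
rewrite expect_unif; last exact: bm_cos.
rewrite /Rintegral (@continuous_FTC2 _ (fun x => cos (a + b * x)) (fun x => sin (a + b * x) / b))//.
- by rewrite mulr1 mulr0 addr0 -EFinB /=; field.
- exact/continuous_subspaceT/c/continuous_cos.
- split => [x _||]; first by case: (d x).
  + by apply: cvg_at_right_filter; exact: cF.
  + by apply: cvg_at_left_filter; exact: cF.
- by move=> x _; rewrite derive1E; apply: derive_val.
Qed.

Let int_sin (a b : R) : b != 0 -> \int[U]_x sin (a + b * x) = (cos a - cos (a + b)) / b.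
Proof.
move=> b0; have := int_cos (a - pi / 2) b0.
under eq_Rintegral do rewrite addrAC cosBpihalf.
by move=> ->; rewrite addrAC !sinBpihalf; congr (_ / _); ring.
Qed.

(** Self-similarity of the uniform law: it is the law of (b + x) / 2 for a fair bit b and an
    independent uniform x. Both sides have explicit characteristic functions, which agree. *)
Lemma unif_split (H : TR -> R) : bm H ->
  \int[U]_x H x = 2^-1 * \int[U]_x H ((1 + x) / 2) + 2^-1 * \int[U]_x H (x / 2).
Proof.
move=> bH.
have mhalf (e : R) : measurable_fun [set: TR] (fun x : TR => (e + x) / 2 : R).
  by apply: measurable_funM => //; exact: measurable_funD.
pose phi (z : bool * TR) : TR := ((if z.1 then 1 else 0) + z.2) / 2.
have mphi : measurable_fun setT phi.
  apply: measurable_funM => //; apply: measurable_funD => //.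
  by apply: (measurableT_comp (f := fun b : bool => if b then 1 else 0 : R)) => //.
have [nu Hnu] := law_exists (coin \x U)%E mphi.
have E f : bm f -> \int[nu]_x f x =
    2^-1 * \int[U]_x f ((1 + x) / 2) + 2^-1 * \int[U]_x f (x / 2).
  move=> bf; rewrite (@expect_law _ _ _ _ _ (coin \x U)%E phi nu f mphi)//.
  rewrite (@expect_fubini1 _ _ _ _ _ coin U); last exact: bm_comp.
  rewrite expect_coin /phi /=; congr (_ + _ * _).
  by apply: eq_Rintegral => x _; rewrite add0r.
rewrite -E//; apply: expect_eq_measure; apply: eq_real_law => t.
  rewrite E; last by apply: bm_cos; exact: measurable_funM.
  have [->|t0] := eqVneq t 0.
    by under eq_Rintegral do rewrite mul0r; under [X in _ = _ * X + _]eq_Rintegral do rewrite mul0r;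
    under [X in _ = _ + _ * X]eq_Rintegral do rewrite mul0r; rewrite !expect_cst; field.
  have t20 : t / 2 != 0 by rewrite mulf_neq0// invr_neq0.
  rewrite (_ : \int[U]_x cos (t * x) = \int[U]_x cos (0 + t * x)); last first.
    by apply: eq_Rintegral => x _; rewrite add0r.
  rewrite (_ : \int[U]_x cos (t * ((1 + x) / 2)) = \int[U]_x cos (t / 2 + t / 2 * x)); last first.
    by apply: eq_Rintegral => x _; congr cos; field.
  rewrite (_ : \int[U]_x cos (t * (x / 2)) = \int[U]_x cos (0 + t / 2 * x)); last first.
    by apply: eq_Rintegral => x _; congr cos; field.
  rewrite !int_cos// !add0r sin0 -splitr; field.
  by [].
rewrite E; last by apply: bm_sin; exact: measurable_funM.
have [->|t0] := eqVneq t 0.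
  by under eq_Rintegral do rewrite mul0r; under [X in _ = _ * X + _]eq_Rintegral do rewrite mul0r;
  under [X in _ = _ + _ * X]eq_Rintegral do rewrite mul0r; rewrite !expect_cst; field.
have t20 : t / 2 != 0 by rewrite mulf_neq0// invr_neq0.
rewrite (_ : \int[U]_x sin (t * x) = \int[U]_x sin (0 + t * x)); last first.
  by apply: eq_Rintegral => x _; rewrite add0r.
rewrite (_ : \int[U]_x sin (t * ((1 + x) / 2)) = \int[U]_x sin (t / 2 + t / 2 * x)); last first.
  by apply: eq_Rintegral => x _; congr sin; field.
rewrite (_ : \int[U]_x sin (t * (x / 2)) = \int[U]_x sin (0 + t / 2 * x)); last first.
  by apply: eq_Rintegral => x _; congr sin; field.
rewrite !int_sin// !add0r cos0 -splitr; field.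
by [].
Qed.

Let digit (x : TR) : R := if 2^-1 <= x then 1 else 0.
Let shift (x : TR) : TR := 2 * x - digit x.

Let mdigit : measurable_fun [set: TR] digit.
Proof. by apply: measurable_fun_if => //; apply: measurable_fun_ler. Qed.

Let mshift : measurable_fun [set: TR] shift.
Proof. by apply: measurable_funB => //; exact: measurable_funM. Qed.

(** [digit] reads the first binary digit and [shift] deletes it, so two shifts skip one digit.
    Keeping n digits makes each stage visibly measurable. *)
Fixpoint even_digits_trunc n (x : TR) : R :=
  if n is m.+1 then (digit x + even_digits_trunc m (shift (shift x))) / 2 else 0.
Local Notation et := even_digits_trunc.

Let met n : measurable_fun [set: TR] (et n).
Proof.
elim: n => [|n IH]; first exact: measurable_cst.
apply: measurable_funM => //; apply: measurable_funD => //.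
by apply: measurableT_comp => //; exact: measurableT_comp.
Qed.

Let et01 n x : 0 <= et n x <= 1.
Proof.
elim: n x => [|n IH] x; first by rewrite lexx ler01.
have /andP[h0 h1] := IH (shift (shift x)).
by rewrite /= /digit; case: ifP => _; apply/andP; split; lra.
Qed.

Let et_nd x : {homo et ^~ x : m n / (m <= n)%N >-> m <= n}.
Proof.
apply/nondecreasing_seqP => n; elim: n x => [|n IH] x.
  by have /andP[] := et01 1 x.
by rewrite -[et n.+2 x]/((_ + et n.+1 _) / 2) -[et n.+1 x]/((_ + et n _) / 2) ler_pM2r// lerD2l.
Qed.

(* The number whose binary digits are every second digit of x. *)
Definition even_digits (x : TR) : TR := limn (et ^~ x).
Definition odd_digits (x : TR) : TR := even_digits (shift x).

Let et_cvg x : et n x @[n --> \oo] --> (even_digits x : R).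
Proof.
apply: nondecreasing_is_cvgn; first exact: et_nd.
by exists 1 => _ [n _ <-]; have /andP[] := et01 n x.
Qed.

Let even_rec x : even_digits x = (digit x + even_digits (shift (shift x))) / 2.
Proof.
have A : et n.+1 x @[n --> \oo] --> (even_digits x : R).
  by rewrite (cvg_shiftS (et ^~ x)); exact: et_cvg.
have B : et n.+1 x @[n --> \oo] --> (digit x + even_digits (shift (shift x))) / 2.
  apply: cvgM; last exact: cvg_cst.
  by apply: cvgD; [exact: cvg_cst|exact: et_cvg].
exact: (cvg_unique (@Rhausdorff R) A B).
Qed.

Lemma measurable_even_digits : measurable_fun [set: TR] even_digits.
Proof. by apply: (measurable_fun_cvg met) => x _; exact: et_cvg. Qed.

Lemma measurable_odd_digits : measurable_fun [set: TR] odd_digits.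
Proof. by apply: measurableT_comp => //; exact: measurable_even_digits. Qed.

Local Notation ev := even_digits.
Local Notation od := odd_digits.

(** At u = 1 the number (0 + u) / 2 would have digit 1 instead of 0; the open interval excludes
    this, at the cost of a null set. *)
Let dig_half (e : bool) (u : TR) : 0 < u < 1 ->
  digit ((e%:R + u) / 2) = e%:R /\ shift ((e%:R + u) / 2) = u.
Proof.
move=> /andP[u0 u1].
have D : digit ((e%:R + u) / 2) = e%:R.
  rewrite /digit; case: e; rewrite /= ?mulr1n ?mulr0n ?add0r.
    by rewrite ifT//; lra.
  by rewrite ifF//; apply/negbTE; rewrite -ltNge; lra.
by split => //; rewrite /shift D; field.
Qed.

Let ev_od_half (e f : bool) (u : TR) : 0 < u < 1 ->
  ev ((e%:R + (f%:R + u) / 2) / 2) = (e%:R + ev u) / 2 /\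
  od ((e%:R + (f%:R + u) / 2) / 2) = (f%:R + od u) / 2.
Proof.
move=> u01; have v01 : 0 < (f%:R + u) / 2 < 1.
  by case/andP: u01 => u0 u1; apply/andP; split; case: f; rewrite /= ?mulr1n ?mulr0n ?add0r; lra.
have [d1 s1] := dig_half e v01; have [d2 s2] := dig_half f u01.
split; first by rewrite even_rec d1 s1 s2.
by rewrite /od s1 even_rec d2 s2.
Qed.

Let bm_ev_od (F : TR * TR -> R) : bounded_measurable F -> bm (fun x : TR => F (ev x, od x)).
Proof.
move=> bF; apply: (bm_comp _ bF); apply: measurable_fun_pair.
  exact: measurable_even_digits.
exact: measurable_odd_digits.
Qed.

Let mscal (e : bool) : measurable_fun [set: TR] (fun x : TR => (e%:R + x) / 2 : TR).
Proof. by apply: measurable_funM => //; exact: measurable_funD. Qed.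

Let unif_split_bool (H : TR -> R) : bm H ->
  \int[U]_x H x = 2^-1 * \sum_(e : bool) \int[U]_x H ((e%:R + x) / 2).
Proof.
move=> bH; rewrite unif_split// big_bool mulrDr /=; congr (_ * _ + _ * _).
by apply: eq_Rintegral => x _; rewrite add0r.
Qed.

Let sc (e f : bool) (z : TR * TR) : TR * TR := ((e%:R + z.1) / 2, (f%:R + z.2) / 2).
Let msc e f : measurable_fun setT (sc e f).
Proof.
by apply: measurable_fun_pair; [exact: (measurableT_comp (mscal e))|exact: (measurableT_comp (mscal f))].
Qed.

(** Two splittings expose the two leading digits of x, one for each coordinate. [E2_rec] gives the
    same recursion for the product law, and this is how the two laws get compared. *)
Let E1_rec (F : TR * TR -> R) : bounded_measurable F ->
  \int[U]_x F (ev x, od x) =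
  4^-1 * \sum_(e : bool) \sum_(f : bool) \int[U]_x F (sc e f (ev x, od x)).
Proof.
move=> bF; rewrite unif_split_bool; last exact: bm_ev_od.
have -> : 4^-1 = 2^-1 * 2^-1 :> R by field.
rewrite -mulrA; congr (_ * _); rewrite mulr_sumr; apply: eq_bigr => e _.
have bFe : bm (fun x => F (ev ((e%:R + x) / 2), od ((e%:R + x) / 2))).
  exact: (@bm_comp _ _ _ _ _ (fun x : TR => (e%:R + x) / 2 : TR) (fun x : TR => F (ev x, od x)) (mscal e) (bm_ev_od bF)).
rewrite unif_split_bool//.
congr (_ * _); apply: eq_bigr => f _; apply: eq_expect_unif.
- exact: (@bm_comp _ _ _ _ _ (fun x : TR => (f%:R + x) / 2 : TR) _ (mscal f) bFe).
- exact: (bm_ev_od (bm_comp (msc e f) bF)).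
- by move=> x x01; have [-> ->] := ev_od_half e f x01.
Qed.

Let E2_rec (F : TR * TR -> R) : bounded_measurable F ->
  \int[(U \x U)%E]_z F z =
  4^-1 * \sum_(e : bool) \sum_(f : bool) \int[(U \x U)%E]_z F (sc e f z).
Proof.
move=> bF; rewrite expect_fubini1// (unif_split_bool (bm_fubini1 U U bF)).
have -> : 4^-1 = 2^-1 * 2^-1 :> R by field.
rewrite -mulrA; congr (_ * _); rewrite mulr_sumr; apply: eq_bigr => e _.
have bs (x : TR) (f : bool) : bm (fun y => F (x, (f%:R + y) / 2)).
  exact: (@bm_comp _ _ _ _ _ (fun y : TR => (f%:R + y) / 2 : TR) (fun y : TR => F (x, y)) (mscal f) (bm_section x bF)).
rewrite (@eq_Rintegral _ _ _ U _ (fun x : TR => 2^-1 *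
    (\int[U]_y F ((e%:R + x) / 2, (true%:R + y) / 2) +
     \int[U]_y F ((e%:R + x) / 2, (false%:R + y) / 2)))); last first.
  by move=> x _; rewrite unif_split_bool ?big_bool//; exact: bm_section.
have bsc (f : bool) : bm (fun x => \int[U]_y F ((e%:R + x) / 2, (f%:R + y) / 2)).
  exact: (bm_fubini1 U U (bm_comp (msc e f) bF)).
rewrite expectZ; last exact: (bmD (bsc true) (bsc false)).
rewrite (expectD U (bsc true) (bsc false)).
congr (_ * _); rewrite big_bool /=; congr (_ + _).
  rewrite (expect_fubini1 U U (bm_comp (msc e true) bF)) //.
by rewrite (expect_fubini1 U U (bm_comp (msc e false) bF)).
Qed.

Let unif_bound (f : TR -> R) (c : R) : bm f -> (forall x, 0 < x < 1 -> `|f x| <= c) ->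
  `|\int[U]_x f x| <= c.
Proof.
move=> bf fc.
have c0 : 0 <= c by apply: le_trans (fc 2^-1 _) => //; lra.
have mI : measurable (`]0, 1[%classic : set TR) by exact: measurable_itv.
have bg := bmM bf (@bm_indic _ _ R _ mI).
rewrite (eq_expect_unif bf bg); last first.
  by move=> x x01; rewrite indicE mem_set ?mulr1//= in_itv.
apply: expect_norm_le => // x; rewrite indicE.
have [/set_mem|_] := boolP (x \in _); rewrite /= ?mulr1 ?mulr0 ?normr0//.
by rewrite in_itv; exact: fc.
Qed.

Let ev01 (x : TR) : 0 <= (even_digits x : R) <= 1.
Proof.
have c : cvgn (et ^~ x) by apply/cvg_ex; exists (even_digits x); exact: et_cvg.
apply/andP; split.
  by apply: (limr_ge c); near=> n; have /andP[] := et01 n x.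
by apply: (limr_le c); near=> n; have /andP[] := et01 n x.
Unshelve. all: by end_near. Qed.

(** [sc] halves distances, so each use of the common recursion halves the Lipschitz constant of F.
    At n = 0 both integrals are within 2 * L of F (0, 0), as the points lie in the unit square. *)
Let E_close (F : TR * TR -> R) (L : R) n : bounded_measurable F ->
  (forall z w, `|F z - F w| <= L * (`|z.1 - w.1| + `|z.2 - w.2|)) ->
  `|\int[U]_x F (ev x, od x) - \int[(U \x U)%E]_z F z| <= 4 * L / 2 ^+ n.
Proof.
have L0 (G : TR * TR -> R) (K : R) : (forall z w, `|G z - G w| <= K * (`|z.1 - w.1| + `|z.2 - w.2|)) -> 0 <= K.
  move=> /(_ (1, 0) (0, 0)) /= H; have := le_trans (normr_ge0 _) H.
  by rewrite subr0 subrr normr1 normr0 addr0 mulr1.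
elim: n F L => [|n IH] F L bF FL.
  have K0 := L0 _ _ FL.
  have bG : bounded_measurable (fun z => F z - F (0, 0)) by apply: bmB => //; exact: bm_cst.
  have e1 : `|\int[U]_x F (ev x, od x) - F (0, 0)| <= 2 * L.
    rewrite -{1}(expect_cst U (F (0, 0))) -expectB; [|exact: bm_ev_od|exact: bm_cst].
    apply: expect_norm_le; first exact: (bm_ev_od bG).
    move=> x; rewrite (le_trans (FL _ _))//= !subr0 mulrC ler_wpM2r//.
    have /andP[a0 a1] := ev01 x; have /andP[b0 b1] := ev01 (shift x).
    by rewrite !ger0_norm//=; move: a0 a1 b0 b1; rewrite /od; lra.
  have e2 : `|\int[(U \x U)%E]_z F z - F (0, 0)| <= 2 * L.
    rewrite -{1}(expect_cst (U \x U)%E (F (0, 0))) -expectB; [|exact: bF|exact: bm_cst].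
    rewrite expect_fubini1//; apply: unif_bound => [|x x01]; first exact: (bm_fubini1 U U bG).
    apply: unif_bound => [|y y01]; first exact: (bm_section _ bG).
    rewrite (le_trans (FL _ _))//= !subr0 mulrC ler_wpM2r//.
    by case/andP: x01 => ? ?; case/andP: y01 => ? ?; rewrite !gtr0_norm//; lra.
  rewrite expr0 divr1; apply: le_trans (ler_distD (F (0, 0)) _ _) _.
  rewrite (_ : 4 * L = 2 * L + 2 * L); last by ring.
  by apply: lerD => //; rewrite distrC.
rewrite E1_rec// E2_rec// -mulrBr -sumrB normrM ger0_norm//.
have H e f : `|\int[U]_x F (sc e f (ev x, od x)) - \int[(U \x U)%E]_z F (sc e f z)| <=
    4 * (L / 2) / 2 ^+ n.
  apply: (IH (fun z => F (sc e f z))); first exact: (bm_comp (msc e f) bF).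
  move=> z w; rewrite (le_trans (FL _ _))// /sc /= -!mulrBl !normrM.
  rewrite (_ : e%:R + z.1 - (e%:R + w.1) = z.1 - w.1); last by ring.
  rewrite (_ : f%:R + z.2 - (f%:R + w.2) = z.2 - w.2); last by ring.
  by rewrite !(@ger0_norm _ 2^-1)// -mulrDl mulrA mulrAC.
rewrite ler_pdivrMl// !big_bool.
have E : 4 * (4 * L / 2 ^+ n.+1) = 4 * (L / 2) / 2 ^+ n + 4 * (L / 2) / 2 ^+ n + (4 * (L / 2) / 2 ^+ n + 4 * (L / 2) / 2 ^+ n).
  by rewrite exprS; field; rewrite expf_neq0.
rewrite E; set k := 4 * (L / 2) / 2 ^+ n.
have T (a b c d a' b' c' d' : R) : `|a - a'| <= k -> `|b - b'| <= k -> `|c - c'| <= k -> `|d - d'| <= k ->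
    `|a + b - (a' + b') + (c + d - (c' + d'))| <= k + k + (k + k).
  by rewrite !ler_norml => /andP[? ?] /andP[? ?] /andP[? ?] /andP[? ?]; apply/andP; split; lra.
exact: T (H _ _) (H _ _) (H _ _) (H _ _).
Qed.

Let cos_lipschitz (u v : R) : `|cos u - cos v| <= `|u - v|.
Proof.
wlog uv : u v / u <= v.
  by move=> H; have [/H//|/ltW /H] := leP u v; rewrite distrC [leRHS]distrC.
have [c _ E] := @MVT_segment R cos (fun x => - sin x) u v uv
  (fun x _ => is_derive_cos x) (continuous_subspaceT (@continuous_cos R)).
rewrite distrC E normrM normrN distrC ler_piMl//.
by rewrite ler_norml sin_geN1 sin_le1.
Qed.

(** The bound of [E_close] tends to 0 with n. The free phase c serves the sine, because cos (y - pi
    / 2) = sin y. *)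
Let E_cos (c a b : R) :
  \int[U]_x cos (c + (a * ev x + b * od x)) =
  \int[(U \x U)%E]_z cos (c + (a * z.1 + b * z.2)).
Proof.
have mF : measurable_fun setT (fun z : TR * TR => c + (a * z.1 + b * z.2) : R).
  by apply: measurable_funD => //; apply: measurable_funD; apply: measurable_funM.
have E n := @E_close (fun z => cos (c + (a * z.1 + b * z.2))) (`|a| + `|b|) n (bm_cos mF).
apply/eqP; rewrite -subr_eq0 -normr_le0.
have := @cvg_geometric R (4 * (`|a| + `|b|)) (2^-1); rewrite ger0_norm// => /(_ _) C.
have {}C : geometric (4 * (`|a| + `|b|)) (2^-1) n @[n --> \oo] --> (0 : R) by apply: C; lra.
apply: (@ler_cvg_to _ \oo _ R (fun=> `|_|) _ _ 0 (cvg_cst _) C).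
near=> n; rewrite /geometric /= exprVn; apply: E => z w.
rewrite (le_trans (cos_lipschitz _ _))//.
rewrite (_ : _ - _ = a * (z.1 - w.1) + b * (z.2 - w.2)); last by ring.
rewrite (le_trans (ler_normD _ _))// !normrM mulrDl.
by apply: lerD; apply: ler_wpM2l => //; rewrite ?lerDl ?lerDr.
Unshelve. all: by end_near. Qed.

Lemma expect_digits (F : TR * TR -> R) : bounded_measurable F ->
  \int[U]_x F (ev x, od x) = \int[(U \x U)%E]_z F z.
Proof.
move=> bF.
have mphi : measurable_fun setT (fun x : TR => (ev x, od x)).
  by apply: measurable_fun_pair; [exact: measurable_even_digits|exact: measurable_odd_digits].
have [nu Hnu] := law_exists U mphi.
have E f : bounded_measurable f -> \int[nu]_z f z = \int[U]_x f (ev x, od x).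
  by move=> bf; exact: (@expect_law _ _ _ _ _ U _ nu f mphi (fun A _ => Hnu A) bf).
rewrite -E//; apply: expect_eq_measure.
pose L := [set l : TR * TR -> R | exists a b : R, l = fun z => a * z.1 + b * z.2].
have mL l : L l -> measurable_fun setT l.
  by move=> [a [b ->]]; apply: measurable_funD; apply: measurable_funM.
apply: (@eq_probability _ _ _ nu (U \x U)%E L) => //.
- move=> _ _ [a [b ->]] [a' [b' ->]]; exists (a + a'), (b + b').
  by apply/funext => z; ring.
- by move=> c _ [a [b ->]]; exists (c * a), (c * b); apply/funext => z; ring.
- by exists 0, 0; apply/funext => z; ring.
- move=> S sS HS C mC; apply: (sigma_algebra_prod sS) => // A mA.
    apply: (sigma_algebra_real (sigma_algebra_preimage fst sS)) => // c.
    have := HS (fun z => 1 * z.1 + 0 * z.2) c; rewrite /preimage /=.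
    under eq_set do rewrite mul1r mul0r addr0.
    by apply; exists 1, 0.
  apply: (sigma_algebra_real (sigma_algebra_preimage snd sS)) => // c.
  have := HS (fun z => 0 * z.1 + 1 * z.2) c; rewrite /preimage /=.
  under eq_set do rewrite mul1r mul0r add0r.
  by apply; exists 0, 1.
- move=> l Ll; rewrite E; last exact: bm_cos (mL _ Ll).
  by case: Ll => a [b ->] /=; have := E_cos 0 a b; under eq_Rintegral do rewrite add0r; under [X in _ = X]eq_Rintegral do rewrite add0r.
- move=> l Ll; rewrite E; last exact: bm_sin (mL _ Ll).
  case: Ll => a [b ->] /=; have := E_cos (- (pi / 2)) a b.
  by under eq_Rintegral do rewrite addrC cosBpihalf; under [X in _ = X]eq_Rintegral do rewrite addrC cosBpihalf.
Qed.

(** Passing j times to the odd digits and then to the even ones selects disjoint sets of digits for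
    different j; the quantile map makes each N j standard normal. Independence is recorded by
    characteristic functions of linear combinations, with a phase c that carries the induction on n.
    The second moment is what later makes a random series converge. *)
Lemma iid_normal_exists : exists N : nat -> TR -> TR,
  [/\ forall j, measurable_fun setT (N j),
      forall n (a : nat -> R) (c : R), \int[U]_x cos (c + \sum_(j < n) a j * N j x) =
        cos c * expR (- (\sum_(j < n) a j ^+ 2) / 2)
    & (\int[U]_x ((N 0%N x : R) ^+ 2)%:E < +oo)%E].
Proof.
pose nu := normal_prob (0 : R) 1.
have [G [mG HG]] := quantile_exists nu.
have nuE A : measurable A -> nu A = normal_law 0 1 A.
  by move=> mA; rewrite /normal_law oner_eq0 sqrtr1.
pose N j x := G (ev (iter j od x)).
have mN j : measurable_fun setT (N j).
  apply: (measurableT_comp mG); apply: (measurableT_comp measurable_even_digits).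
  elim: j => [|j IH]; first exact: measurable_id.
  exact: (measurableT_comp measurable_odd_digits).
have EG (h : TR -> R) : bm h -> \int[U]_x h (G x) = \int[nu]_x h x.
  by move=> bh; rewrite (@expect_law _ _ _ _ _ U G nu h mG).
have mS n (a : nat -> R) (c : R) : measurable_fun [set: TR] (fun x => c + \sum_(j < n) a j * N j x : R).
  by apply: measurable_funD => //; apply: measurable_sum => j; apply: measurable_funM => //; exact: mN.
exists N; split => //.
  elim=> [|n IH] a c.
    under eq_Rintegral do rewrite big_ord0 addr0.
    by rewrite expect_cst big_ord0 oppr0 mul0r expR0 mulr1.
  (* The head depends on the even digits and the tail on the odd ones. The tail is integrated first,
     by induction with the phase c + a 0 * G z.1. *)
  pose H (z : TR * TR) : R := cos ((c + a 0%N * G z.1) + \sum_(j < n) a j.+1 * N j z.2).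
  have bH : bounded_measurable H.
    apply: bm_cos; apply: measurable_funD.
      apply: measurable_funD => //; apply: measurable_funM => //.
      exact: (measurableT_comp mG).
    have := mS n (fun j => a j.+1) 0; under eq_fun do rewrite add0r.
    by move=> mS0; exact: (measurableT_comp mS0).
  rewrite (_ : \int[U]_x _ = \int[U]_x H (ev x, od x)); last first.
    apply: eq_Rintegral => x _; rewrite /H big_ord_recl /= addrA.
    congr (cos (_ + _)); apply: eq_bigr => j _; congr (_ * G (ev _)).
    exact: (iterSr j od x).
  rewrite expect_digits// expect_fubini1//.
  rewrite /H; under eq_Rintegral do rewrite /= (IH (fun j => a j.+1)).
  have bc : bm (fun x => cos (c + a 0%N * x)).
    by apply: bm_cos; apply: measurable_funD => //; exact: measurable_funM.
  have [Ec Es] := @normal_law_characteristic R nu 0 1 (a 0%N) ler01 nuE.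
  under eq_Rintegral do rewrite mulrC.
  rewrite expectZ; last exact: (bm_comp mG bc).
  rewrite (EG _ bc).
  under eq_Rintegral do rewrite cosD.
  have mM : measurable_fun [set: TR] (fun x : TR => a 0%N * x : R) by exact: measurable_funM.
  rewrite expectB; [|exact/bmZ/bm_cos|exact/bmZ/bm_sin].
  rewrite !expectZ; [|exact: bm_sin|exact: bm_cos].
  rewrite Ec Es mul0r cos0 sin0 !mul0r mulr0 subr0 !mul1r mulrC -mulrA -expRD.
  by rewrite big_ord_recl; congr (_ * expR _); field.
have mq : measurable_fun [set: R] (fun x : R => x ^+ 2) by exact: measurable_funX.
have ip : (@lebesgue_measure R).-integrable setT (fun x => (x ^+ 2 * normal_pdf 0 1 x)%:E).
  apply: (@integrable_normal_moment _ 0 1 _ _ 1) => // x.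
  by rewrite ger0_norm ?sqr_ge0// mul1r lerDr.
apply: (@le_lt_trans _ _ (\int[lebesgue_measure]_x (x ^+ 2 * normal_pdf 0 1 x))%:E); last exact: ltry.
have mq' : measurable_fun [set: TR] (fun x : TR => (x : R) ^+ 2) by exact: mq.
apply: ge0_integral_le => [|x|n]; [|exact: sqr_ge0|].
  by apply: measurable_funX; exact: mN.
pose h (x : TR) : R := Num.min ((x : R) ^+ 2) n%:R.
have bh : bm h by apply: bm_trunc => // x; exact: sqr_ge0.
rewrite (_ : \int[U]_x _ = \int[U]_x (h (G (ev x))))//.
have bhG := bm_comp mG bh.
rewrite (@expect_digits (fun z => h (G z.1))); last exact: (bm_comp _ bhG).
rewrite expect_fubini1; last exact: (bm_comp _ bhG).
under eq_Rintegral do rewrite /= expect_cst.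
rewrite (EG _ bh) (@expect_density _ _ _ nu lebesgue_measure (normal_pdf 0 1) h)//; last 2 first.
- exact: normal_prob_dominates.
- exact: integrable_normal_pdf.
have hq x : h x <= x ^+ 2 by rewrite /h ge_min lexx.
have h0 x : 0 <= h x by rewrite /h le_min sqr_ge0 ler0n.
apply: le_Rintegral => //.
  apply: (@integrable_normal_moment _ 0 1 _ h 1) => //; first by case: bh.
  by move=> x; rewrite ger0_norm// mul1r (le_trans (hq x))// lerDr.
by move=> x _; rewrite ler_wpM2r// normal_pdf_ge0.
Qed.

End UniformSplitting.

(** * Gaussian measures on a separable Hilbert space *)

(** Equal characteristic functions give equal laws, hence equal integrals of unbounded nonnegative h
    as well. Second moments can then be found by comparison with a known variable. *)
Lemma eq_law_ge0_integral d (T : measurableType d) (R : realType) (mu : probability T R)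
    (f g : T -> R) (h : R -> R) :
  measurable_fun setT f -> measurable_fun setT g ->
  (forall c t, \int[mu]_x cos (c + t * f x) = \int[mu]_x cos (c + t * g x)) ->
  measurable_fun setT h -> (forall y, 0 <= h y) ->
  (\int[mu]_x (h (f x))%:E = \int[mu]_x (h (g x))%:E)%E.
Proof.
move=> mf mg fg mh h0.
have mf' : measurable_fun setT (f : T -> measurableTypeR R) by [].
have mg' : measurable_fun setT (g : T -> measurableTypeR R) by [].
have [nu Hnu] := law_exists mu mf'; have [nu' Hnu'] := law_exists mu mg'.
have E k : bounded_measurable k -> \int[nu]_y k y = \int[mu]_x k (f x).
  by move=> bk; exact: (@expect_law _ _ _ _ _ mu _ nu k mf').
have E' k : bounded_measurable k -> \int[nu']_y k y = \int[mu]_x k (g x).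
  by move=> bk; exact: (@expect_law _ _ _ _ _ mu _ nu' k mg').
have mM (t : R) : measurable_fun [set: measurableTypeR R] (fun x : measurableTypeR R => t * x : R).
  exact: measurable_funM.
have mh' : measurable_fun [set: measurableTypeR R] (fun y : measurableTypeR R => (h y)%:E).
  exact/measurable_EFinP.
rewrite -(@ge0_expect_law _ _ _ _ _ mu _ nu (fun y : measurableTypeR R => (h y)%:E) mf')//.
rewrite -(@ge0_expect_law _ _ _ _ _ mu _ nu' (fun y : measurableTypeR R => (h y)%:E) mg')//.
apply: eq_measure_integral => A mA _; apply: eq_real_law mA => t.
  rewrite (E _ (bm_cos (mM t))) (E' _ (bm_cos (mM t))); have := fg 0 t.
  by under eq_Rintegral do rewrite add0r; under [X in _ = X -> _]eq_Rintegral do rewrite add0r.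
rewrite (E _ (bm_sin (mM t))) (E' _ (bm_sin (mM t))); have := fg (- (pi / 2)) t.
by under eq_Rintegral do rewrite addrC cosBpihalf;
  under [X in _ = X -> _]eq_Rintegral do rewrite addrC cosBpihalf.
Qed.

Section BorelHilbert.
Context (R : realType) (X : completeNormedModType R) (dot : {dot X for idfun}).
Hypothesis normE : induces_norm dot.
Hypothesis sepX : separable X.
Local Notation BX := (borel X).

(** Over a dense sequence d, a closed ball is the countable intersection of the half-spaces <x - a,
    d_k> <= r |d_k|, and an open set is a countable union of closed balls centred at the d_n with
    radii 1 / (m + 1). *)
Lemma sigma_algebra_borel (S : set (set X)) : sigma_algebra setT S ->
  (forall h c, S [set x | c < dot x h]) -> forall A : set BX, measurable A -> S A.
Proof.
move=> sS HS; have [S0 SD SU] := sS.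
have [d Hd] := separable_dense_seq sepX.
have pos (n : nat) : 0 < (n.+1%:R^-1 : R) by rewrite invr_gt0.
have inv_small (e : R) : 0 < e -> \forall n \near \oo, (n.+1%:R^-1 : R) < e.
  move=> e0; near=> n; rewrite invf_plt ?posrE// (@lt_le_trans _ _ n%:R)// ?ler_nat//.
  by near: n; exact: nbhs_infty_gtr.
have SC B : S B -> S (~` B) by move=> SB; rewrite -setTD; exact: SD.
have SI (F : nat -> set X) : (forall n, S (F n)) -> S (\bigcap_n F n).
  move=> SF; rewrite -[X in S X]setCK setC_bigcap.
  by apply/(SC (bigcup _ _))/SU => n; exact: SC.
have Sb a r : 0 <= r -> S [set x | `|x - a| <= r].
  move=> r0; rewrite (_ : [set x | _] = \bigcap_k [set x | dot x (d k) <= r * `|d k| + dot a (d k)]).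
    apply: SI => k; rewrite (_ : [set x | _] = ~` [set x | r * `|d k| + dot a (d k) < dot x (d k)]).
      exact/SC/HS.
    by apply/seteqP; split => x /=; rewrite leNgt; move/negP.
  apply/seteqP; split => x /=.
    move=> xa k _ /=; rewrite -lerBlDr -dotBl (le_trans (dot_le normE _ _))//.
    by rewrite ler_wpM2r.
  move=> H; have H' k : dot (x - a) (d k) <= r * `|d k|.
    by rewrite dotBl lerBlDr; exact: H.
  have {}H' z : dot (x - a) z <= r * `|z|.
    have [z_ Hz] : exists z_ : nat -> nat, d (z_ n) @[n --> \oo] --> z.
      have [z_ Hz] := choice (fun n : nat => Hd z n.+1%:R^-1 (pos n)).
      exists z_; apply/cvgrPdist_lt => e e0; near=> n.
      rewrite (lt_trans (Hz n))//.
      by near: n; exact: inv_small.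
    have A := dot_cvgr normE (y := x - a) Hz.
    have B : r * `|d (z_ n)| @[n --> \oo] --> r * `|z|.
      by apply: cvgM; [exact: cvg_cst|exact: cvg_norm].
    by apply: (ler_cvg_to A B); near=> n.
  have := H' (x - a); rewrite normE expr2.
  have [->|n0] := eqVneq (x - a) 0.
    by rewrite normr0.
  by rewrite ler_pM2r// normr_gt0.
move=> A mA; apply: (smallest_sub sS) mA => O oO.
have oO' x : O x -> exists n m, `|x - d n| <= m.+1%:R^-1 /\ forall y, `|y - d n| <= m.+1%:R^-1 -> O y.
  move=> Ox; have /nbhs_ballP[e /= e0 He] := open_nbhs_nbhs (conj oO Ox).
  have [m Hm] : exists m : nat, m.+1%:R^-1 < e / 2.
    near \oo => m; exists m.
    by near: m; apply: inv_small; rewrite divr_gt0.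
  have [n Hn] := Hd x m.+1%:R^-1 (pos m).
  exists n, m; split; first exact: ltW.
  move=> y Hy; apply: He; rewrite -ball_normE /=.
  rewrite (le_lt_trans (ler_distD (d n) _ _))// (splitr e) ltrD//.
    exact: lt_trans Hn Hm.
  by rewrite distrC (le_lt_trans Hy).
pose C (n m : nat) : set X := [set x | `|x - d n| <= m.+1%:R^-1 /\
  (forall y, `|y - d n| <= m.+1%:R^-1 -> O y)].
have -> : O = \bigcup_n \bigcup_m C n m.
  apply/seteqP; split => [x /oO' [n [m H]]|x [n _ [m _ [H /(_ _ H)]]]//].
  by exists n => //; exists m.
apply: (SU _) => n; apply: (SU _) => m.
have [H|H] := pselect (forall y, `|y - d n| <= m.+1%:R^-1 -> O y).
  by rewrite (_ : C n m = [set x | `|x - d n| <= m.+1%:R^-1]); [exact: Sb|apply/seteqP; split=> x //= []].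
by rewrite (_ : C n m = set0)//; apply/seteqP; split=> x //= [].
Unshelve. all: by end_near. Qed.

Lemma measurable_dot h : measurable_fun [set: BX] (fun x : BX => dot (x : X) h : R).
Proof.
move=> mT; apply: (measurability _ (RGenOInfty.measurableE R)) => //.
move=> _ [_ [c ->] <-]; rewrite setTI; apply: sub_sigma_algebra.
apply: (@open_comp X R (fun x => dot x h)); last exact: interval_open.
by move=> x _; exact: dot_continuousl.
Qed.

Lemma measurable_borel d (T : measurableType d) (phi : T -> BX) :
  (forall h, measurable_fun setT (fun t => dot (phi t : X) h : R)) -> measurable_fun setT phi.
Proof.
move=> H _ A mA; rewrite setTI.
have sM : sigma_algebra setT [set B | measurable (phi @^-1` B)].
  by apply: sigma_algebra_preimage; exact: sigma_algebra_measurable.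
apply: (sigma_algebra_borel sM) => // h c /=.
have := H h measurableT [set` `]c, +oo[] (measurable_itv _); rewrite setTI.
suff -> : (fun t => dot (phi t) h) @^-1` `]c, +oo[ = phi @^-1` [set x | c < dot x h] by [].
by apply/seteqP; split=> x /=; rewrite in_itv/= andbT.
Qed.

Lemma eq_borel_law (mu nu : probability BX R) :
  (forall h, \int[mu]_x cos (dot (x : X) h) = \int[nu]_x cos (dot (x : X) h)) ->
  (forall h, \int[mu]_x sin (dot (x : X) h) = \int[nu]_x sin (dot (x : X) h)) ->
  forall A, measurable A -> mu A = nu A.
Proof.
move=> Hc Hs.
apply: (@eq_probability _ _ _ mu nu [set l : BX -> R | exists h, l = fun x => dot (x : X) h]).
- by move=> _ _ [h ->] [k ->]; exists (h + k); apply/funext => x; rewrite dotDr.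
- by move=> c _ [h ->]; exists (c *: h); apply/funext => x; rewrite dotZr.
- by exists 0; apply/funext => x; rewrite dot0r.
- by move=> _ [h ->]; exact: measurable_dot.
- move=> S sS HS A mA; apply: (sigma_algebra_borel sS) => // h c.
  by have := HS (fun x => dot (x : X) h) c; apply; exists h.
- by move=> _ [h ->].
- by move=> _ [h ->].
Qed.

Lemma eq_borel_prod_law (mu nu : probability (BX * BX)%type R) :
  (forall h k, \int[mu]_z cos (dot (z.1 : X) h + dot (z.2 : X) k) =
               \int[nu]_z cos (dot (z.1 : X) h + dot (z.2 : X) k)) ->
  (forall h k, \int[mu]_z sin (dot (z.1 : X) h + dot (z.2 : X) k) =
               \int[nu]_z sin (dot (z.1 : X) h + dot (z.2 : X) k)) ->
  forall A, measurable A -> mu A = nu A.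
Proof.
move=> Hc Hs.
apply: (@eq_probability _ _ _ mu nu
  [set l : BX * BX -> R | exists h k, l = fun z => dot (z.1 : X) h + dot (z.2 : X) k]).
- move=> _ _ [h [k ->]] [h' [k' ->]]; exists (h + h'), (k + k').
  by apply/funext => x; rewrite !dotDr addrACA.
- by move=> c _ [h [k ->]]; exists (c *: h), (c *: k); apply/funext => x; rewrite !dotZr mulrDr.
- by exists 0, 0; apply/funext => x; rewrite !dot0r addr0.
- move=> _ [h [k ->]]; apply: measurable_funD.
    exact: (measurableT_comp (measurable_dot h) measurable_fst).
  exact: (measurableT_comp (measurable_dot k) measurable_snd).
- move=> S sS HS A mA; apply: (sigma_algebra_prod sS) => // B mB.
    apply: (sigma_algebra_borel (sigma_algebra_preimage fst sS)) => // h c.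
    have := HS (fun z => dot (z.1 : X) h + dot (z.2 : X) 0) c; rewrite /preimage /=.
    under eq_set do rewrite dot0r addr0.
    by apply; exists h, 0.
  apply: (sigma_algebra_borel (sigma_algebra_preimage snd sS)) => // h c.
  have := HS (fun z => dot (z.1 : X) 0 + dot (z.2 : X) h) c; rewrite /preimage /=.
  under eq_set do rewrite dot0r add0r.
  by apply; exists 0, h.
- by move=> _ [h [k ->]].
- by move=> _ [h [k ->]].
Qed.

Lemma normal_law_probability (m v : R) : exists nu : probability (measurableTypeR R) R,
  forall A, nu A = normal_law m v A.
Proof.
rewrite /normal_law; case: eqP => _; last by exists (normal_prob m (Num.sqrt v)).
by exists (\d_(m : measurableTypeR R)).
Qed.

(** Testing with t *: h for all t recovers the whole characteristic function of the marginal along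
    h. *)
Lemma is_gaussianP a Q (mu : probability BX R) : nonneg_operator dot Q ->
  is_gaussian dot a Q mu <-> forall h,
   \int[mu]_x cos (dot (x : X) h) = cos (dot a h) * expR (- (dot (Q h) h / 2)) /\
   \int[mu]_x sin (dot (x : X) h) = sin (dot a h) * expR (- (dot (Q h) h / 2)).
Proof.
move=> [[lQ _] _ Q0]; have law h : exists nu : probability (measurableTypeR R) R,
    (forall A, nu A = pushforward mu (fun x : BX => dot (x : X) h : measurableTypeR R) A) /\
    forall f, bounded_measurable f -> \int[nu]_t f t = \int[mu]_x f (dot (x : X) h).
  have mh : measurable_fun [set: BX] (fun x : BX => dot (x : X) h : measurableTypeR R).
    exact: measurable_dot.
  have [nu Hnu] := law_exists mu mh; exists nu; split => // f bf.
  exact: (@expect_law _ _ _ _ _ mu _ nu f mh).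
have mM (t : R) : measurable_fun [set: measurableTypeR R] (fun x : measurableTypeR R => t * x : R).
  exact: measurable_funM.
split=> [G h|H h A mA].
  have [nu [nuE E]] := law h.
  have nuN A : measurable A -> nu A = normal_law (dot a h) (dot (Q h) h) A.
    by move=> mA; rewrite nuE G.
  have := normal_law_characteristic 1 (Q0 h) nuN.
  rewrite !(E _ (bm_cos (mM 1))) !(E _ (bm_sin (mM 1))) expr1n !mulr1.
  by under eq_Rintegral do rewrite mul1r; under [X in _ /\ X = _ -> _]eq_Rintegral do rewrite mul1r.
have [nu [nuE E]] := law h; rewrite -nuE.
have [nu' nuE'] := normal_law_probability (dot a h) (dot (Q h) h).
have nc t := normal_law_characteristic t (Q0 h) (fun A _ => nuE' A).
rewrite -nuE'; apply: eq_real_law mA => t; have [nc1 nc2] := nc t.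
  rewrite nc1 (E _ (bm_cos (mM t))); have [+ _] := H (t *: h).
  under eq_Rintegral do rewrite dotZr; move=> ->.
  by rewrite dotZr [t * _]mulrC; congr (_ * expR _); rewrite (linearZP lQ) dotZl dotZr; ring.
rewrite nc2 (E _ (bm_sin (mM t))); have [_] := H (t *: h).
under eq_Rintegral do rewrite dotZr; move=> ->.
by rewrite dotZr [t * _]mulrC; congr (_ * expR _); rewrite (linearZP lQ) dotZl dotZr; ring.
Qed.

Section GaussianExistence.
Context (Q : X -> X) (e : nat -> X) (M : R).
Hypothesis nQ : nonneg_operator dot Q.
Hypotheses (oe : orthonormal_seq dot e) (te : total_seq dot e).
Hypothesis QM : forall n, \sum_(i < n) dot (Q (e i)) (e i) <= M.

Local Notation TR := (measurableTypeR R).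
Local Notation S := (sqrt_operator dot Q).
(** The wanted random vector is the sum of the xi_k e_k, where the xi_k are jointly normal with
    covariances <a k, a l>. Gram-Schmidt applied to [a] makes each xi_k a finite combination of
    independent normals. *)
Let a k := S (e k).
Let f := gram_schmidt dot a.

Let SP : [/\ linear S, forall x y, dot (S x) y = dot x (S y) & forall x, S (S x) = Q x].
Proof. by have [[[lS _] sS _] SS] := sqrt_operatorP normE nQ. Qed.

(** Parseval in the span of a 0, ..., a (n - 1), where the first n Gram-Schmidt vectors already give
    the full norm. *)
Let expansion (h : X) n : (exists c : nat -> R, h = \sum_(k < n) c k *: a k) ->
  \sum_(j < n) dot h (f j) ^+ 2 = dot h h.
Proof.
move=> [c hE].
have {2}-> : h = \sum_(j < n) dot h (f j) *: f j.
  rewrite {1}hE; under [LHS]eq_bigr => k _ do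
    rewrite (gram_schmidt_expansion normE a (ltn_ord k)) scaler_sumr.
  rewrite exchange_big; apply: eq_bigr => j _ /=.
  under eq_bigr do rewrite scalerA.
  rewrite -scaler_suml; congr (_ *: _).
  by rewrite hE dot_suml; apply: eq_bigr => k _; rewrite dotZl.
by rewrite dotC dot_sumr; apply: eq_bigr => j _; rewrite dotZr expr2.
Qed.

(** The sum of the xi_k^2 has expectation at most M times the second moment of N 0, so it is finite
    almost surely and the random series converges in X. The characteristic functions of the partial
    sums converge to the Gaussian one. *)
Lemma centered_gaussian_exists : exists mu : probability BX R, is_gaussian dot 0 Q mu.
Proof.
have [lS sS SS] := SP.
have [[[_ cS] _ _] _] := sqrt_operatorP normE nQ.
have [N [mN NE N2]] := iid_normal_exists R.
pose xi k (x : TR) : R := \sum_(j < k.+1) dot (a k) (f j) * N j x.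
have xiE k n x : (k < n)%N -> xi k x = \sum_(j < n) dot (a k) (f j) * N j x.
  move=> kn; rewrite /xi -!(big_mkord xpredT (fun j => dot (a k) (f j) * N j x)).
  rewrite [RHS](@big_cat_nat _ _ _ k.+1)//= [X in _ = _ + X]big_nat [X in _ = _ + X]big1 ?addr0// => j /andP[kj _].
  by rewrite gram_schmidt_orthogonal_prev ?mul0r.
have mxi k : measurable_fun [set: TR] (xi k : TR -> R).
  by apply: measurable_sum => j; apply: measurable_funM => //; exact: mN.
have anorm k : \sum_(j < k.+1) dot (a k) (f j) ^+ 2 = dot (a k) (a k).
  apply: expansion; exists (fun i => (i == k)%:R).
  rewrite big_ord_recr /= eqxx scale1r big1 ?add0r// => i _.
  by rewrite lt_eqF ?scale0r// ltEnat /=.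
pose m2 := (\int[unif R]_x ((N 0%N x : R) ^+ 2)%:E)%E.
have msq (g : TR -> R) : measurable_fun setT g -> measurable_fun setT (fun x => (g x ^+ 2)%:E).
  by move=> mg; apply/measurable_EFinP; exact: measurable_funX.
(* xi_k has the characteristic function of |a k| * N 0, so its second moment is read off without
   computing covariances. *)
have xi2 k : (\int[unif R]_x ((xi k x) ^+ 2)%:E = (dot (a k) (a k))%:E * m2)%E.
  transitivity (\int[unif R]_x ((`|a k| * (N 0%N x : R)) ^+ 2)%:E)%E.
    apply: (@eq_law_ge0_integral _ _ _ _ (xi k) (fun x => `|a k| * (N 0%N x : R)) (fun y => y ^+ 2)) => //.
    - by apply: measurable_funM => //; exact: mN.
    - move=> c t; have := NE k.+1 (fun j => t * dot (a k) (f j)) c.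
      have := NE 1%N (fun=> t * `|a k|) c.
      under eq_Rintegral do rewrite big_ord1 -mulrA; move=> ->.
      rewrite (_ : \int[unif R]_x cos (c + t * xi k x) = \int[unif R]_x cos (c + \sum_(j < k.+1) t * dot (a k) (f j) * N j x)); last first.
        by apply: eq_Rintegral => x _; rewrite mulr_sumr; under eq_bigr do rewrite mulrA.
      move=> ->; congr (_ * expR (- _ / 2)).
      under eq_bigr do rewrite exprMn.
      by rewrite -mulr_sumr anorm big_ord1 exprMn normE.
    - by move=> y; exact: sqr_ge0.
  under eq_integral do rewrite exprMn EFinM.
  rewrite normE; apply: ge0_integralZl => //.
  - exact: (msq (fun x => (N 0%N x : R)) (mN 0%N)).
  - by move=> x _; rewrite lee_fin sqr_ge0.
have m2f : m2 \is a fin_num by rewrite ge0_fin_numE// integral_ge0// => x _; rewrite lee_fin sqr_ge0.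
have m20 : (0 <= m2)%E by apply: integral_ge0 => x _; rewrite lee_fin sqr_ge0.
pose g x : \bar R := (\sum_(0 <= k <oo) (xi k x ^+ 2)%:E)%E.
have ig : (\int[unif R]_x g x < +oo)%E.
  rewrite integral_nneseries//; last 2 first.
  - by move=> n; exact: msq.
  - by move=> n x _; rewrite lee_fin sqr_ge0.
  under eq_eseriesr do rewrite xi2.
  apply: (@le_lt_trans _ _ (M%:E * m2)%E); last by rewrite -(fineK m2f) -EFinM ltry.
  apply: lime_le.
    by apply: is_cvg_nneseries => k _ _; rewrite mule_ge0// lee_fin normE sqr_ge0.
  near=> n; rewrite -ge0_sume_distrl; last by move=> k _; rewrite lee_fin normE sqr_ge0.
  rewrite lee_wpmul2r// sumEFin lee_fin big_mkord; apply: le_trans (QM n).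
  by apply: ler_sum => k _; rewrite /a -sS SS.
have mg : measurable_fun setT g.
  apply: (@ge0_emeasurable_sum _ _ _ setT (fun k x => (xi k x ^+ 2)%:E) xpredT) => //.
    by move=> k x _ _; rewrite lee_fin sqr_ge0.
  by move=> k _; exact: msq.
have g0 x : (0 <= g x)%E by apply: nneseries_ge0 => k _ _; rewrite lee_fin sqr_ge0.
pose G := [set x | (g x < +oo)%E].
have mG : measurable G by rewrite -[G]setTI; exact: emeasurable_fun_infty_o.
have aeG : {ae unif R, forall x, G x}.
  have : (unif R).-integrable setT g.
    apply/integrableP; split => //.
    by under eq_integral do rewrite gee0_abs//.
  move=> /(integrable_ae measurableT); apply: filterS => x /(_ I).
  by rewrite /G /= ge0_fin_numE.
have GY x : exists y : X, (G x -> \sum_(k < n) xi k x *: e k @[n --> \oo] --> y) /\ (~ G x -> y = 0).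
  have [Gx|nGx] := pselect (G x); last by exists 0.
  have B n : \sum_(i < n) xi i x ^+ 2 <= fine (g x).
    rewrite -lee_fin fineK; last by rewrite ge0_fin_numE.
    rewrite -sumEFin -(big_mkord xpredT (fun i => (xi i x ^+ 2)%:E)).
    by apply: nneseries_lim_ge => k _ _; rewrite lee_fin sqr_ge0.
  have [y Hy] := orthonormal_series_cvg normE (a := fun k => xi k x) oe B.
  by exists y.
have [Y HY] := choice GY.
(* The factor [\1_G x] makes these sums converge to [dot (Y x) h] at every x, which gives
   measurability of Y. *)
pose s h n x : R := \1_G x * \sum_(k < n) xi k x * dot (e k) h.
have Ys h x : s h n x @[n --> \oo] --> dot (Y x) h.
  have [Gx|nGx] := pselect (G x).
    rewrite /s; under eq_fun do rewrite indicE mem_set//= mul1r.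
    have := dot_cvgl normE (y := h) ((HY x).1 Gx).
    by under eq_fun do (rewrite dot_suml; under eq_bigr do rewrite dotZl).
  rewrite ((HY x).2 nGx) dot0l /s; under eq_fun do rewrite indicE memNset//= mul0r.
  exact: cvg_cst.
have msum h n : measurable_fun [set: TR] (fun x : TR => \sum_(k < n) xi k x * dot (e k) h : R).
  by apply: measurable_sum => k; apply: measurable_funM => //; exact: mxi.
have ms h n : measurable_fun [set: TR] (s h n : TR -> R).
  by apply: measurable_funM; [exact: measurable_indic|exact: msum].
have mY : measurable_fun [set: TR] (Y : TR -> BX).
  apply: measurable_borel => h; apply: (measurable_fun_cvg (ms h)) => x _.
  exact: Ys.
pose hn h n : X := \sum_(k < n) dot h (e k) *: e k.
have En c h n : \int[unif R]_x cos (c + s h n x) =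
    cos c * expR (- (`|S (hn h n)| ^+ 2 / 2)).
  transitivity (\int[unif R]_x cos (c + \sum_(k < n) xi k x * dot (e k) h)).
    congr fine; apply: ae_eq_integral => //.
    - by apply/measurable_EFinP; apply: (bm_cos _).1; apply: measurable_funD => //; exact: ms.
    - by apply/measurable_EFinP; apply: (bm_cos _).1; apply: measurable_funD => //; exact: msum.
    - by apply: filterS aeG => x Gx _; rewrite /s indicE mem_set// mul1r.
  rewrite (_ : \int[unif R]_x _ = \int[unif R]_x cos (c + \sum_(j < n) dot (S (hn h n)) (f j) * N j x)).
    rewrite (NE n (fun j => dot (S (hn h n)) (f j))) mulNr -normE (expansion (n := n))//.
    exists (fun k => dot h (e k)).
    by rewrite /hn (linear_sumP lS); apply: eq_bigr => k _; rewrite (linearZP lS).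
  apply: eq_Rintegral => x _; congr (cos (_ + _)).
  under eq_bigr => k _ do rewrite (xiE _ _ _ (ltn_ord k)) mulr_suml.
  rewrite exchange_big; apply: eq_bigr => j _ /=.
  rewrite /hn (linear_sumP lS) dot_suml mulr_suml; apply: eq_bigr => k _.
  by rewrite (linearZP lS) dotZl [dot (e k) h]dotC; ring.
have E c h : \int[unif R]_x cos (c + dot (Y x) h) = cos c * expR (- (dot (Q h) h / 2)).
  have A : \int[unif R]_x cos (c + s h n x) @[n --> \oo] --> \int[unif R]_x cos (c + dot (Y x) h).
    apply: (expect_cvg (M := 1)) => [n|n x|x].
    - by apply: bm_cos; apply: measurable_funD => //; exact: ms.
    - by rewrite ler_norml cos_geN1 cos_le1.
    - apply: (cvg_comp _ cos _ (@continuous_cos R _)).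
      by apply: cvgD; [exact: cvg_cst|exact: Ys].
  have B : cos c * expR (- (`|S (hn h n)| ^+ 2 / 2)) @[n --> \oo] --> cos c * expR (- (dot (Q h) h / 2)).
    apply: cvgM; first exact: cvg_cst.
    apply: (cvg_comp _ (@expR R) _ (@continuous_expR R _)).
    apply: cvgN; apply: cvgM; last exact: cvg_cst.
    rewrite (_ : dot (Q h) h = `|S h| ^+ 2); last by rewrite -normE -sS SS dotC.
    apply: cvgM; apply: cvg_norm; (apply: (cvg_comp (hn h) S); last exact: cS);
    exact: orthonormal_expansion.
  apply: (cvg_unique (@Rhausdorff R) A).
  by move: B; under eq_fun do rewrite -En.
have [mu Hmu] := law_exists (unif R) mY.
exists mu; apply/is_gaussianP => // h.
have mh : measurable_fun [set: BX] (fun x : BX => dot (x : X) h : R) by exact: measurable_dot.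
have EE (k : BX -> R) : bounded_measurable k -> \int[mu]_y k y = \int[unif R]_x k (Y x).
  by move=> bk; exact: (@expect_law _ _ _ _ _ (unif R) _ mu k mY).
rewrite (EE _ (bm_cos mh)) (EE _ (bm_sin mh)) dot0l cos0 sin0 mul1r mul0r; split.
  have := E 0 h; rewrite cos0 mul1r => <-.
  by apply: eq_Rintegral => x _; rewrite add0r.
have := E (- (pi / 2)) h; rewrite cosN cos_pihalf mul0r => E0; rewrite -[RHS]E0.
by apply: eq_Rintegral => x _; rewrite addrC cosBpihalf.
Unshelve. all: by end_near. Qed.

End GaussianExistence.

Lemma finite_trace_basis Q : nonneg_operator dot Q -> (trace dot Q < +oo)%E ->
  exists (e : nat -> X) (M : R), [/\ orthonormal_seq dot e, total_seq dot e &
    forall n, \sum_(i < n) dot (Q (e i)) (e i) <= M].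
Proof.
move=> [[lQ _] _ Q0] tQ.
have oE : orthonormal_basis dot (get (orthonormal_basis dot)).
  by apply: getPex; exact: orthonormal_basis_exists.
have [e [oe te He]] := orthonormal_basis_seq normE sepX oE.
exists e, (fine (trace dot Q)); split => // n.
have t0 : (0 <= trace dot Q)%E by apply: esum_ge0 => x _; rewrite lee_fin.
rewrite -lee_fin fineK ?ge0_fin_numE//.
by apply: (He (fun x => dot (Q x) x)) => //; rewrite dot0r.
Qed.

Lemma gaussianP a Q : nonneg_operator dot Q -> (trace dot Q < +oo)%E ->
  is_gaussian dot a Q (gaussian dot a Q).
Proof.
move=> nQ /(finite_trace_basis nQ) [e [M [oe te QM]]].
apply: (@getPex _ (is_gaussian dot a Q)).
have [mu /(is_gaussianP _ _ nQ) Hmu] := centered_gaussian_exists nQ oe te QM.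
have mphi : measurable_fun setT (fun x : BX => (x : X) + a : BX).
  apply: measurable_borel => h; under eq_fun do rewrite dotDl.
  by apply: measurable_funD => //; exact: measurable_dot.
have [nu Hnu] := law_exists mu mphi.
exists nu; apply/is_gaussianP => // h.
have mh : measurable_fun [set: BX] (fun x : BX => dot (x : X) h : R) by exact: measurable_dot.
have E (k : BX -> R) : bounded_measurable k -> \int[nu]_y k y = \int[mu]_x k ((x : X) + a).
  by move=> bk; exact: (@expect_law _ _ _ _ _ mu _ nu k mphi).
rewrite (E _ (bm_cos mh)) (E _ (bm_sin mh)).
have [c0 s0] := Hmu h; rewrite dot0l cos0 sin0 mul1r mul0r in c0 s0.
have bc := bm_cos mh; have bs := bm_sin mh.
split.
  under eq_Rintegral do rewrite dotDl addrC cosD.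
  rewrite expectB; [|exact: bmZ|exact: bmZ].
  by rewrite !expectZ// c0 s0 mulr0 subr0.
under eq_Rintegral do rewrite dotDl addrC sinD.
rewrite expectD; [|exact: bmZ|exact: bmZ].
by rewrite !expectZ// c0 s0 mulr0 addr0.
Qed.

End BorelHilbert.

(** * The covariance operators of the evolution *)

Section OperatorIntegral.
Context (R : realType) (X : completeNormedModType R) (dot : {dot X for idfun}).
Hypothesis normE : induces_norm dot.
Local Notation leb := (@lebesgue_measure R).

(** The integrand has the weak form v^* v, so the diagonal integrals control all others: 2 |<v x, v
    y>| <= |v x|^2 + |v y|^2 yields integrability and a bounded form, and Riesz' theorem the
    operator. *)
Lemma operator_integralP (D : set (measurableTypeR R)) (F : R -> X -> X) (v : R -> X -> X) (C : R) :
  measurable D -> 0 <= C ->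
  (forall r, D r -> linear (v r)) ->
  (forall r x y, D r -> dot (F r x) y = dot (v r x) (v r y)) ->
  (forall x y, measurable_fun D (fun r : measurableTypeR R => dot (v r x) (v r y) : R)) ->
  (forall x, \int[leb]_(r in D) (dot (v r x) (v r x))%:E <= (C * `|x| ^+ 2)%:E)%E ->
  let A := operator_integral dot D F in
  nonneg_operator dot A /\ forall x y,
    leb.-integrable D (fun r => (dot (v r x) (v r y))%:E) /\
    dot (A x) y = \int[leb]_(r in D) dot (v r x) (v r y).
Proof.
move=> mD C0 lv Fv mv HC.
have ix x : leb.-integrable D (fun r => (dot (v r x) (v r x))%:E).
  apply/integrableP; split; first by apply/measurable_EFinP; exact: mv.
  under eq_integral do rewrite gee0_abs ?lee_fin ?dotxx_ge0//.
  exact: le_lt_trans (HC x) (ltry _).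
have le2 r x y : `|dot (v r x) (v r y)| <= 2^-1 * (dot (v r x) (v r x) + dot (v r y) (v r y)).
  have := dotxx_ge0 normE (v r x - v r y); have := dotxx_ge0 normE (v r x + v r y).
  rewrite !dotDl !dotDr !dotNl !dotNr [dot (v r y) (v r x)]dotC.
  by rewrite ler_norml => H1 H2; apply/andP; split; lra.
have ixy x y : leb.-integrable D (fun r => (2^-1 * (dot (v r x) (v r x) + dot (v r y) (v r y)))%:E).
  under eq_fun do rewrite EFinM EFinD.
  by apply: integrableZl => //; apply: integrableD.
have i x y : leb.-integrable D (fun r => (dot (v r x) (v r y))%:E).
  apply: le_integrable (ixy x y) => //; first by apply/measurable_EFinP; exact: mv.
  move=> r Dr; rewrite /= lee_fin (le_trans (le2 r x y))// ger0_norm//.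
  by rewrite mulr_ge0// addr_ge0// dotxx_ge0.
pose b x y := \int[leb]_(r in D) dot (v r x) (v r y).
have bC x : 0 <= b x x <= C * `|x| ^+ 2.
  apply/andP; split; first by apply: Rintegral_ge0 => r _; exact: dotxx_ge0.
  by rewrite -lee_fin fineK ?HC//; exact: integrable_fin_num.
have bl a x y z : b (a *: x + y) z = a * b x z + b y z.
  transitivity (\int[leb]_(r in D) (a * dot (v r x) (v r z) + dot (v r y) (v r z))).
    by apply: eq_Rintegral => r /set_mem Dr; rewrite lv// dotDl dotZl.
  rewrite RintegralD ?RintegralZl//; [exact: i| |exact: i].
  have := integrableZl mD a (i x z).
  by under eq_fun do rewrite -EFinM.
have bs x y : b x y = b y x by apply: eq_Rintegral => r _; rewrite dotC.
have b2 x y : `|b x y| <= 2^-1 * (b x x + b y y).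
  rewrite (_ : 2^-1 * _ = \int[leb]_(r in D) (2^-1 * (dot (v r x) (v r x) + dot (v r y) (v r y)))).
    rewrite (le_trans (le_normr_Rintegral mD (i x y)))//.
    by apply: le_Rintegral => //; [exact: (integrable_abse (i x y))|exact: ixy].
  rewrite RintegralZl// ?RintegralD//; [exact: ix|exact: ix|].
  have := integrableD mD (ix x) (ix y).
  by under eq_fun do rewrite -EFinD.
(* [b2] bounds b by a sum only; on unit vectors half that sum is at most C, and scaling back gives
   the product. *)
have bb x y : `|b x y| <= C * `|x| * `|y|.
  have b0 z : b 0 z = 0.
    by have := bl 1 0 0 z; rewrite scaler0 addr0 mul1r => h; lra.
  have [->|x0] := eqVneq x 0; first by rewrite b0 !normr0 mulr0 mul0r.
  have [->|y0] := eqVneq y 0; first by rewrite bs b0 !normr0 mulr0.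
  have nx : 0 < `|x| by rewrite normr_gt0.
  have ny : 0 < `|y| by rewrite normr_gt0.
  have bz a z w : b (a *: z) w = a * b z w by rewrite -[a *: z]addr0 bl b0 addr0.
  have n1 (z : X) : 0 < `|z| -> `| `|z|^-1 *: z| = 1.
    by move=> nz; rewrite normrZ normfV normr_id mulVf// gt_eqF.
  have := b2 (`|x|^-1 *: x) (`|y|^-1 *: y).
  have /andP[_] := bC (`|x|^-1 *: x); have /andP[_] := bC (`|y|^-1 *: y).
  rewrite !n1// expr1n mulr1 => h1 h2 h3.
  have {h1 h2 h3} : `|b (`|x|^-1 *: x) (`|y|^-1 *: y)| <= C by lra.
  rewrite bz bs bz bs !normrM !normfV !normr_id ler_pdivrMl// ler_pdivrMl//.
  by rewrite (_ : _ * (_ * C) = C * `|x| * `|y|)//; ring.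
have br a x y z : b z (a *: x + y) = a * b z x + b z y by rewrite bs bl [b x z]bs [b y z]bs.
have [A bA AE] := riesz_form normE C0 bl br bb.
have Abs : bounded_operator (operator_integral dot D F) /\ forall x y,
    leb.-integrable D (fun r => (dot (F r x) y)%:E) /\
    dot (operator_integral dot D F x) y = \int[leb]_(r in D) dot (F r x) y.
  apply: (@getPex _ [set A | bounded_operator A /\ forall x y,
    leb.-integrable D (fun r => (dot (F r x) y)%:E) /\
    dot (A x) y = \int[leb]_(r in D) dot (F r x) y]).
  exists A; split => // x y; split.
    by apply: eq_integrable (i x y) => // r /set_mem Dr; rewrite Fv.
  by rewrite AE; apply: eq_Rintegral => r /set_mem Dr; rewrite Fv.
have {AE}AE x y : dot (operator_integral dot D F x) y = b x y.
  have [_ /(_ x y) [_ ->]] := Abs; apply: eq_Rintegral => r /set_mem Dr; exact: Fv.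
split; last by move=> x y; split; [exact: i|exact: AE].
split; first exact: Abs.1.
- by move=> x y; rewrite AE dotC AE.
- by move=> x; rewrite AE; have /andP[] := bC x.
Qed.

End OperatorIntegral.

Section CameronMartinNorm.
Context (R : realType) (X : completeNormedModType R) (dot : {dot X for idfun}).
Hypothesis normE : induces_norm dot.

Lemma sqrt_operator_norm A x : nonneg_operator dot A ->
  `|sqrt_operator dot A x| ^+ 2 = dot (A x) x.
Proof.
move=> nA; have [[_ sS _] SS] := sqrt_operatorP normE nA.
by rewrite -normE -SS [RHS]sS.
Qed.

(* With S_s, S_t the square roots of Qs, Qt, the Cameron-Martin norm r of L is
   the best constant in |S_s L^* k| <= r |S_t k|. *)
Lemma cm_operator_norm (Qs Qt L L' : X -> X) :
  nonneg_operator dot Qs -> nonneg_operator dot Qt -> linear L ->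
  (forall x y, dot (L x) y = dot x (L' y)) ->
  (forall k, dot (Qs (L' k)) (L' k) <= dot (Qt k) k) ->
  exists2 r, operator_norm (cm_space dot Qs) (cm_norm dot Qs) (cm_norm dot Qt) L = r%:E &
  0 <= r <= 1 /\ forall k, dot (Qs (L' k)) (L' k) <= r ^+ 2 * dot (Qt k) k.
Proof.
move=> nQs nQt lU aU contr0.
have [[[lSt _] sSt _] _] := sqrt_operatorP normE nQt.
have [[[lSs _] sSs _] _] := sqrt_operatorP normE nQs.
have normSt k := sqrt_operator_norm k nQt.
have normSs k := sqrt_operator_norm k nQs.
have contr k : `|sqrt_operator dot Qs (L' k)| <= `|sqrt_operator dot Qt k|.
  by rewrite -ler_sqr ?nnegrE// normSt normSs.
(* <L S_s w, k> = <w, S_s L' k> is at most |w| |S_t k|, so [range_sqrt] puts L S_s w into the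
   Cameron-Martin space of Qt. *)
have image w : exists w', [/\ (sqrt_operator dot Qt) w' = L (sqrt_operator dot Qs w), `|w'| <= `|w| & forall z, (sqrt_operator dot Qt) z = 0 -> dot w' z = 0].
  apply: (range_sqrt normE nQt) => // k.
  rewrite aU sSs (le_trans (cauchy_schwarz normE _ _))// ler_wpM2l//.
have cmU w : [/\ (sqrt_operator dot Qt) (inv_sqrt_operator dot Qt (L (sqrt_operator dot Qs w))) = L (sqrt_operator dot Qs w) &
    cm_norm dot Qt (L (sqrt_operator dot Qs w)) <= `|w|].
  have [w' [<- w'w _]] := image w.
  by have [H1 H2] := inv_sqrt_operatorP normE w' nQt; split => //; exact: le_trans H2 w'w.
have cm0 : cm_norm dot Qs 0 = 0.
  have [_] := inv_sqrt_operatorP normE 0 nQs.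
  by rewrite (linear0P lSs) normr0 normr_le0 => /eqP; rewrite /cm_norm => ->; rewrite normr0.
rewrite /operator_norm; set N := ereal_sup _.
have N0 : (0 <= N)%E.
  apply: (@le_trans _ _ (cm_norm dot Qt (L 0))%:E); first by rewrite lee_fin /cm_norm.
  apply: ereal_sup_ubound; exists 0 => //; split; last by rewrite cm0.
  by exists 0 => //; rewrite (linear0P lSs).
have N1 : (N <= 1)%E.
  apply: ge_ereal_sup => _ [h [[w _ <-] hw] <-]; rewrite lee_fin.
  have [H1 _] := inv_sqrt_operatorP normE w nQs.
  rewrite -H1; have [_ H2] := cmU (inv_sqrt_operator dot Qs (sqrt_operator dot Qs w)).
  exact: le_trans H2 hw.
have Nf : N \is a fin_num by rewrite ge0_fin_numE// (le_lt_trans N1)// ltry.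
exists (fine N); first by rewrite fineK.
split; first by rewrite fine_ge0//= -lee_fin fineK.
have key w : cm_norm dot Qt (L (sqrt_operator dot Qs w)) <= fine N * `|w|.
  have [E|w0] := eqVneq `|w| 0.
    by rewrite E mulr0 -[leRHS]E; have [] := cmU w.
  set u := `|w|^-1 *: w.
  have uN : ((cm_norm dot Qt (L (sqrt_operator dot Qs u)))%:E <= N)%E.
    apply: ereal_sup_ubound; exists (sqrt_operator dot Qs u) => //; split; first by exists u.
    have [_ /le_trans] := inv_sqrt_operatorP normE u nQs; apply.
    by rewrite normrZ normfV normr_id mulVf.
  have [H1 _] := cmU u.
  have E : L (sqrt_operator dot Qs w) = (sqrt_operator dot Qt) (`|w| *: inv_sqrt_operator dot Qt (L (sqrt_operator dot Qs u))).
    by rewrite (linearZP lSt) H1 /u (linearZP lSs) (linearZP lU) scalerA divff ?scale1r.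
  rewrite E; have [_ /le_trans] := inv_sqrt_operatorP normE (`|w| *: inv_sqrt_operator dot Qt (L (sqrt_operator dot Qs u))) nQt.
  apply; rewrite normrZ normr_id mulrC ler_wpM2r//.
  by rewrite -lee_fin fineK.
move=> k; rewrite -normSs -normSt -exprMn ler_sqr ?nnegrE ?mulr_ge0 ?fine_ge0//.
(* Duality: |w|^2 = <L S_s w, k> = <z, S_t k>, where z is the preimage of L S_s w under S_t, whose
   norm [key] bounds by the operator norm times |w|. *)
set w := (sqrt_operator dot Qs) (L' k).
have [->|w0] := eqVneq `|w| 0; first by rewrite mulr_ge0 ?fine_ge0.
have w0' : 0 < `|w| by rewrite lt_neqAle eq_sym w0/=.
rewrite -(ler_pM2l w0') -expr2 -{1}normE {2}/w -sSs -aU.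
have [<- _] := cmU w; rewrite sSt (le_trans (dot_le normE _ _))//.
by rewrite mulrA ler_wpM2r// mulrC; exact: key.
Qed.

End CameronMartinNorm.

Section Covariance.
Context (R : realType) (X : completeNormedModType R) (dot : {dot X for idfun}).
Hypothesis normE : induces_norm dot.
Hypothesis sepX : separable X.
Context (U : R -> R -> X -> X) (B : R -> X -> X).
Hypothesis hU : evolution_operator U.
Hypothesis hB : bounded_strongly_measurable B.
Hypothesis hT : finite_traces dot U B.
Hypothesis hS : stable dot U B.
Local Notation leb := (@lebesgue_measure R).
Local Notation Us t r := (adjoint dot (U t r)).
Local Notation Bs r := (adjoint dot (B r)).

(** The covariance integrand is the square of this operator, <Q_integrand x, y> = <v x, v y>, which
    is the shape [operator_integralP] works with. *)
Definition noise_adjoint t r x : X := Bs r (Us t r x).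
Local Notation v := noise_adjoint.

Let bU s t : s <= t -> bounded_operator (U t s).
Proof. by case: hU => H _ _ _; exact: H. Qed.
Let bB r : bounded_operator (B r).
Proof. by case: hB. Qed.

Let v_linear t r : r <= t -> linear (v t r).
Proof.
move=> rt a x y; rewrite /noise_adjoint.
have [[lu _] _] := adjointP normE (bU rt); have [[lb _] _] := adjointP normE (bB r).
by rewrite lu lb.
Qed.

Let Q_integrandE t r x y : r <= t -> dot (Q_integrand dot U B t r x) y = dot (v t r x) (v t r y).
Proof.
move=> rt; rewrite /Q_integrand /=.
have [_ au] := adjointP normE (bU rt); have [_ ab] := adjointP normE (bB r).
by rewrite au ab.
Qed.

Lemma U_continuous t x : {within `]-oo, t], continuous (fun r => U t r x)}.
Proof.
have [_ cU _ _] := hU; have /subspace_continuousP {}cU := cU x.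
apply/subspace_continuousP => r /= rt W /(cU (r, t)).
rewrite in_itv /= in rt => /(_ rt) H.
have c : (r', t) @[r' --> (r : R)] --> ((r, t) : R * R).
  exact: (@cvg_pair R R R (nbhs (r : R)) (nbhs (r : R)) (nbhs t) _ _ _ (fun r' => r') (fun=> t) cvg_id (cvg_cst t)).
have H' : nbhs (r : R) [set q : R | q <= t -> W (U t q x)] by exact: (c _ H).
suff : nbhs (r : R) [set q : R | q \in `]-oo, t] -> W (U t q x)] by [].
by apply: filterS H' => q /= Hq; rewrite in_itv /=.
Qed.


Let mdotU t x y : measurable_fun (`]-oo, t] : set (measurableTypeR R))
  (fun r : measurableTypeR R => dot x (U t r y) : R).
Proof.
apply: (@subspace_continuous_measurable_fun R `]-oo, t] (fun r => dot x (U t r y))).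
  exact: measurable_itv.
move=> r; apply: (@continuous_comp (subspace `]-oo, t]) X R (fun r => U t r y) (dot x)).
  exact: U_continuous.
rewrite (_ : (dot x : X -> R) = fun z => dot z x); last by apply/funext => z; rewrite dotC.
exact: (dot_continuousl normE).
Qed.

Let mdotB x y : measurable_fun [set: measurableTypeR R]
  (fun r : measurableTypeR R => dot (B r x) y : R).
Proof.
have [_ _ mB] := hB.
exact: (measurableT_comp (measurable_dot normE y) (mB x)).
Qed.

(** U and B are measurable only vector by vector and occur here through a product of adjoints.
    Parseval separates them: <v z, e_i> is the sum over j of <z, U e_j> <B e_i, e_j>. *)
Let measurable_v t x y : measurable_fun (`]-oo, t] : set (measurableTypeR R))
  (fun r : measurableTypeR R => dot (v t r x) (v t r y) : R).
Proof.
have [E oE] := orthonormal_basis_exists normE sepX.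
have [e [oe te _]] := orthonormal_basis_seq normE sepX oE.
have mI : measurable (`]-oo, t] : set (measurableTypeR R)) by exact: measurable_itv.
have mv1 z i : measurable_fun (`]-oo, t] : set (measurableTypeR R))
    (fun r : measurableTypeR R => dot (v t r z) (e i) : R).
  apply: (@measurable_fun_cvg _ _ _ _ (fun n r =>
    \sum_(j < n) dot z (U t r (e j)) * dot (B r (e i)) (e j))).
    move=> n; apply: measurable_sum => j; apply: measurable_funM; first exact: mdotU.
    exact: (measurable_funTS (mdotB _ _)).
  move=> r; rewrite /= in_itv /= => rt.
  have := parseval normE (x := Us t r z) (y := B r (e i)) oe te.
  have [_ au] := adjointP normE (bU rt); have [_ ab] := adjointP normE (bB r).
  rewrite dotC ab dotC; under eq_fun do under eq_bigr do rewrite dotC -au dotC.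
  by [].
apply: (@measurable_fun_cvg _ _ _ _ (fun n r =>
    \sum_(j < n) dot (v t r x) (e j) * dot (v t r y) (e j))).
  by move=> n; apply: measurable_sum => j; apply: measurable_funM; exact: mv1.
by move=> r _; exact: parseval.
Qed.

Let B_bound : exists2 b, 0 <= b & forall r x, `|B r x| <= b * `|x|.
Proof.
have [bB' supB _] := hB.
set S := ereal_sup _ in supB.
have HS r : (norm_LX (B r) <= S)%E by apply: ereal_sup_ubound; exists r.
have n0 r : (0 <= norm_LX (B r))%E.
  apply: ereal_sup_ubound; exists 0 => /=; first by rewrite normr0 ler01.
  by have [l _] := bB r; rewrite (linear0P l) normr0.
have S0 : (0 <= S)%E by exact: le_trans (n0 0) (HS 0).
have Sf : S \is a fin_num by rewrite ge0_fin_numE.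
exists (fine S); first exact: fine_ge0.
move=> r x; have [l _] := bB r.
have [->|x0] := eqVneq x 0; first by rewrite (linear0P l) !normr0 mulr0.
have nx : 0 < `|x| by rewrite normr_gt0.
have : (`|B r (`|x|^-1 *: x)|%:E <= S)%E.
  apply: le_trans (HS r); apply: ereal_sup_ubound; exists (`|x|^-1 *: x) => //=.
  by split => //; rewrite normrZ normfV normr_id mulVf// gt_eqF.
by rewrite -[S]fineK// lee_fin (linearZP l) normrZ normfV normr_id ler_pdivrMl// mulrC.
Qed.

(** Strong continuity bounds each orbit on the compact interval [s, t]; Banach-Steinhaus makes the
    bound uniform. *)
Let U_bound s t : s <= t -> exists2 u, 0 <= u & forall r x, s <= r <= t -> `|U t r x| <= u * `|x|.
Proof.
move=> st.
have [M HM] : exists M, forall r, s <= r <= t -> forall x, `|x| <= 1 -> `|U t r x| <= M.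
  pose F := [set U t r | r in [set r | s <= r <= t]].
  have bF f : F f -> bounded_fun_norm f /\ linear f.
    move=> [r /= /andP[sr rt] <-]; have bUr := bU rt; split; last by case: bUr.
    have [M M0 HM] := bounded_operator_bound bUr.
    by move=> c; exists (M * c) => x xc; rewrite (le_trans (HM x))// ler_wpM2l// ltW.
  have pF : pointwise_bounded F.
    move=> x; have c : {within `[s, t], continuous (fun r => `|U t r x|)}.
      apply: (@continuous_subspaceW _ _ `[s, t] `]-oo, t]).
        by move=> r /=; rewrite !in_itv /= => /andP[].
      move=> r; apply: (@continuous_comp (subspace `]-oo, t]) X R (fun r => U t r x) Num.norm).
        exact: U_continuous.
      exact: norm_continuous.
    have [c0 _ Hc] := EVT_max st c.
    by exists `|U t c0 x| => _ [r /= rst <-]; apply: Hc; rewrite in_itv/=.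
  have [M HM] := Banach_Steinhauss bF pF 1.
  by exists M => r rst x x1; apply: HM => //; exists r.
exists (Num.max 0 M); first by rewrite le_max lexx.
move=> r x rst; have /andP[sr rt] := rst; have [l _] := bU rt.
have [->|x0] := eqVneq x 0; first by rewrite (linear0P l) !normr0 mulr0.
have nx : 0 < `|x| by rewrite normr_gt0.
have := HM r rst (`|x|^-1 *: x); rewrite normrZ normfV normr_id mulVf ?gt_eqF// lexx => /(_ isT).
rewrite (linearZP l) normrZ normfV normr_id ler_pdivrMl// => /le_trans; apply.
by rewrite mulrC ler_wpM2r// le_max lexx orbT.
Qed.

Lemma Q_P s t : s <= t -> nonneg_operator dot (Q_ dot U B t s) /\ forall x y,
    leb.-integrable `[s, t] (fun r => (dot (v t r x) (v t r y))%:E) /\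
    dot (Q_ dot U B t s x) y = \int[leb]_(r in `[s, t]) dot (v t r x) (v t r y).
Proof.
move=> st; have [b b0 Hb] := B_bound; have [u u0 Hu] := U_bound st.
have vb r x : s <= r <= t -> `|v t r x| <= b * u * `|x|.
  move=> rst; have /andP[sr rt] := rst.
  rewrite /noise_adjoint (le_trans (adjoint_bound normE b0 (bB r) (Hb r) _))// -mulrA ler_wpM2l//.
  exact: (adjoint_bound normE u0 (bU rt) (Hu r ^~ rst)).
have mv x y : measurable_fun (`[s, t] : set (measurableTypeR R))
    (fun r : measurableTypeR R => dot (v t r x) (v t r y) : R).
  apply: (@measurable_funS _ _ _ _ (`]-oo, t] : set (measurableTypeR R))) => //.
  by move=> r /=; rewrite !in_itv /= => /andP[].
apply: (@operator_integralP _ _ _ normE (`[s, t] : set (measurableTypeR R)) _ (v t) ((b * u) ^+ 2 * (t - s))) => //.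
- by rewrite mulr_ge0 ?sqr_ge0 ?subr_ge0.
- by move=> r; rewrite /= in_itv /= => /andP[_ rt]; exact: v_linear.
- by move=> r x y; rewrite /= in_itv /= => /andP[_ rt]; exact: Q_integrandE.
move=> x; apply: (@le_trans _ _ (\int[leb]_(r in `[s, t]) ((b * u) ^+ 2 * `|x| ^+ 2)%:E)%E).
  apply: ge0_le_integral => //.
  - by move=> r _; rewrite lee_fin dotxx_ge0.
  - by apply/measurable_EFinP; exact: mv.
  - move=> r; rewrite /= in_itv /= => rst; rewrite lee_fin normE -exprMn.
    by rewrite ler_sqr ?nnegrE ?mulr_ge0//; exact: vb.
rewrite integral_cst//= lebesgue_measure_itv /= lte_fin.
case: ifP => [_|_]; first by rewrite -EFinB -EFinM lee_fin mulrAC.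
by rewrite mule0 lee_fin mulr_ge0 ?mulr_ge0 ?sqr_ge0// subr_ge0.
Qed.

Let trace_bound t : exists2 M, 0 <= M & (forall s, s < t -> (trace dot (Q_ dot U B t s) <= M%:E)%E).
Proof.
have [/(_ t) + _] := hS; set S := ereal_sup _ => Soo.
have HS s : s < t -> (trace dot (Q_ dot U B t s) <= S)%E.
  by move=> st; apply: ereal_sup_ubound; exists s.
have S0 : (0 <= S)%E.
  apply: le_trans (HS (t - 1) _); last by rewrite gtrBl.
  have t1 : t - 1 <= t by rewrite gerBl.
  have [[_ _ Q0] _] := Q_P t1.
  by apply: esum_ge0 => x _; rewrite lee_fin.
exists (fine S); first exact: fine_ge0.
by move=> s st; rewrite fineK ?HS// ge0_fin_numE.
Qed.

(** The trace dominates the quadratic form, so assumption [stable] bounds these forms uniformly in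
    s; this lets the lower end of the integral tend to -oo. *)
Let Q_form_bound t : exists2 M, 0 <= M & forall s x, s < t ->
  dot (Q_ dot U B t s x) x <= M * `|x| ^+ 2.
Proof.
have [M M0 HM] := trace_bound t; exists M => // s x st.
have [nQ _] := Q_P (ltW st); have [_ _ Q0] := nQ.
have oE : orthonormal_basis dot (get (orthonormal_basis dot)).
  by apply: getPex; exact: orthonormal_basis_exists.
have [e [oe te He]] := orthonormal_basis_seq normE sepX oE.
apply: (nonneg_trace_bound normE nQ oe te) => n.
rewrite -lee_fin; apply: le_trans (HM s st).
by apply: (He (fun x => dot (Q_ dot U B t s x) x)) => //; rewrite dot0r.
Qed.

Let Icvg (t : R) (x : X) : (\int[leb]_(r in `[(t - n.+1%:R)%R, t]) (dot (v t r x) (v t r x))%:E)%E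
  @[n --> \oo] --> (\int[leb]_(r in `]-oo, t]) (dot (v t r x) (v t r x))%:E)%E.
Proof.
have -> : `]-oo, t]%classic = \bigcup_n `[t - n.+1%:R, t]%classic.
  apply/seteqP; split => r; last by case=> n _; rewrite /= !in_itv /= => /andP[].
  rewrite /= in_itv /= => rt; exists (Num.truncn (t - r)) => //=.
  rewrite in_itv /= rt andbT lerBlDr -lerBlDl.
  by rewrite ltW// truncnS_gt.
apply: ge0_nondecreasing_set_cvg_integral.
- move=> m n mn; apply/subsetPset => r /=; rewrite !in_itv /= => /andP[mr ->].
  by rewrite andbT (le_trans _ mr)// lerD2l lerN2 ler_nat.
- by move=> n; exact: measurable_itv.
- move=> n; apply/measurable_EFinP.
  apply: (@measurable_funS _ _ _ _ (`]-oo, t] : set (measurableTypeR R))) => //.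
  by move=> r /=; rewrite !in_itv /= => /andP[].
- by move=> n r _; rewrite lee_fin dotxx_ge0.
Qed.

Lemma Q_inftyP t : nonneg_operator dot (Q_infty dot U B t) /\ forall x y,
    leb.-integrable `]-oo, t] (fun r => (dot (v t r x) (v t r y))%:E) /\
    dot (Q_infty dot U B t x) y = \int[leb]_(r in `]-oo, t]) dot (v t r x) (v t r y).
Proof.
have [M M0 HM] := Q_form_bound t.
apply: (@operator_integralP _ _ _ normE (`]-oo, t] : set (measurableTypeR R)) _ (v t) M) => //.
- by move=> r; rewrite /= in_itv /= => rt; exact: v_linear.
- by move=> r x y; rewrite /= in_itv /= => rt; exact: Q_integrandE.
move=> x; have C := @Icvg t x; rewrite -(cvg_lim _ C)//.
apply: lime_le; first by apply/cvg_ex; eexists; exact: C.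
near=> n; have tn : t - n.+1%:R < t by rewrite gtrBl.
have [_ /(_ x x) [ix Qx]] := Q_P (ltW tn).
apply: le_trans (_ : ((dot (Q_ dot U B t (t - n.+1%:R) x) x)%:E <= _)%E); last by rewrite lee_fin HM.
by rewrite Qx fineK//; exact: integrable_fin_num.
Unshelve. all: by end_near. Qed.

Let Q_cvg t x : dot (Q_ dot U B t (t - n.+1%:R) x) x @[n --> \oo] --> dot (Q_infty dot U B t x) x.
Proof.
have [_ /(_ x x) [ix ->]] := Q_inftyP t.
have : (dot (Q_ dot U B t (t - n.+1%:R) x) x)%:E @[n --> \oo] -->
    (\int[leb]_(r in `]-oo, t]) dot (v t r x) (v t r x))%:E.
  rewrite fineK; last exact: integrable_fin_num.
  rewrite (_ : (fun n => _) = (fun n => \int[leb]_(r in `[(t - n.+1%:R)%R, t]) (dot (v t r x) (v t r x))%:E)%E).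
    exact: Icvg.
  apply/funext => n.
  have tn : t - n.+1%:R <= t by rewrite gerBl.
  have [_ /(_ x x) [ixn ->]] := Q_P tn.
  by rewrite fineK//; exact: integrable_fin_num.
by move/fine_cvgP => [_]; apply.
Qed.

(** Each finite part of the trace sum is the limit of the same part for Q(t, t - n - 1), and these
    are all bounded by M. *)
Lemma trace_Q_infty t : (trace dot (Q_infty dot U B t) < +oo)%E.
Proof.
have [M M0 HM] := trace_bound t.
apply: (@le_lt_trans _ _ M%:E); last exact: ltry.
rewrite /trace; set E := get _.
apply: ge_ereal_sup => _ /= [A [finA AE] <-].
rewrite fsbig_finite//= sumEFin lee_fin.
set As := (X in \sum_(i <- X) _).
have C : \sum_(i <- As) dot (Q_ dot U B t (t - n.+1%:R) i) i @[n --> \oo] -->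
   \sum_(i <- As) dot (Q_infty dot U B t i) i.
  elim: As => [|a s IH].
    by rewrite big_nil; under eq_fun do rewrite big_nil; exact: cvg_cst.
  rewrite big_cons; under eq_fun do rewrite big_cons.
  by apply: cvgD => //; exact: Q_cvg.
apply: (ler_cvg_to C (cvg_cst M)); near=> n.
have tn : t - n.+1%:R < t by rewrite gtrBl.
rewrite -lee_fin; apply: le_trans (HM _ tn).
apply: ereal_sup_ubound; exists A; first by split.
by rewrite fsbig_finite//= sumEFin.
Unshelve. all: by end_near. Qed.

(** For r <= s the evolution law gives v t r = v s r U(t,s)^*, so cutting the integral at s yields
    Q_t = Q(t,s) + U Q_s U^*. Both the bound 1 for the Cameron-Martin norm and the identity P_{s,t}
    = P_1 come from this. *)
Lemma Q_infty_split s t x y : s <= t ->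
  dot (Q_infty dot U B t x) y = dot (Q_ dot U B t s x) y +
    dot (Q_infty dot U B s (Us t s x)) (Us t s y).
Proof.
move=> st; have [_ /(_ x y) [ixy ->]] := Q_inftyP t.
have [_ /(_ x y) [_ ->]] := Q_P st.
have [_ /(_ (Us t s x) (Us t s y)) [_ ->]] := Q_inftyP s.
have E : `]-oo, t]%classic = `]-oo, s[%classic `|` `[s, t]%classic.
  by rewrite -itv_bndbnd_setU//.
have vE r z : r <= s -> v t r z = v s r (Us t s z).
  move=> rs; rewrite /noise_adjoint; congr (Bs r _); apply: (dot_inj normE) => w.
  have [_ _ _ Ucomp] := hU.
  have [_ a1] := adjointP normE (bU (le_trans rs st)).
  have [_ a2] := adjointP normE (bU rs); have [_ a3] := adjointP normE (bU st).
  by rewrite dotC -a1 [RHS]dotC -a2 -a3 Ucomp.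
rewrite {1}E Rintegral_setU//; last 2 first.
- by rewrite -E.
- apply/disj_setPS => r /= []; rewrite !in_itv /= => rs /andP[sr _].
  by move: rs; rewrite ltNge sr.
rewrite addrC; congr (_ + _).
rewrite Rintegral_itv_bndo_bndc; last first.
  by apply: integrableS ixy => // r /=; rewrite !in_itv /= => /ltW /le_trans; apply.
by apply: eq_Rintegral => r /set_mem; rewrite /= in_itv /= => rs; rewrite !vE.
Qed.

Lemma norm_U_cmP s t : s <= t -> exists2 r, norm_U_cm dot U B t s = r%:E &
  0 <= r <= 1 /\ forall k, dot (Q_infty dot U B s (Us t s k)) (Us t s k) <=
    r ^+ 2 * dot (Q_infty dot U B t k) k.
Proof.
move=> st; have [nQt _] := Q_inftyP t; have [nQs _] := Q_inftyP s.
have [[lU _] [_ aU]] := conj (bU st) (adjointP normE (bU st)).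
apply: (cm_operator_norm normE nQs nQt lU aU) => k.
rewrite (Q_infty_split k k st) lerDr.
by have [[_ _ Q0] _] := Q_P st.
Qed.

End Covariance.

(** * Averages over a rotation *)

Section PowerInequalities.
Context (R : realType).
Implicit Types (u v m r p y a b : R).

(** Young's inequality for u and m^(r - 1) with exponents r and r / (r - 1), rearranged. *)
Lemma powR_tangent u m r : 0 <= u -> 0 <= m -> 1 <= r ->
  m `^ r + r * m `^ (r - 1) * (u - m) <= u `^ r.
Proof.
move=> u0 m0 r1; have [->|rn1] := eqVneq r 1.
  by rewrite subrr powRr0 !powRr1// !mul1r addrCA subrr addr0.
have rgt1 : 1 < r by rewrite lt_neqAle eq_sym rn1.
have r0 : 0 < r by lra.
have s0 : 0 < r - 1 by lra.
have := @conjugate_powR R u (m `^ (r - 1)) r (r / (r - 1)) u0 (powR_ge0 _ _) r0.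
have -> : (m `^ (r - 1)) `^ (r / (r - 1)) = m `^ r.
  by rewrite -powRrM mulrCA divff ?mulr1// gt_eqF.
move=> /(_ _ _); have q0 : 0 < r / (r - 1) by rewrite divr_gt0.
move=> /(_ q0); have E : r^-1 + (r / (r - 1))^-1 = 1 by field; rewrite !gt_eqF.
move=> /(_ E) H.
have := mulr_powRB1 m0 r0; set M := m `^ (r - 1) in H *; set mr := m `^ r in H * => Emr.
have : r * (u * M) <= r * (u `^ r / r + mr / (r / (r - 1))) by rewrite ler_pM2l.
have -> : r * (u `^ r / r + mr / (r / (r - 1))) = u `^ r + (r - 1) * mr by field; rewrite !gt_eqF.
by rewrite -Emr; nra.
Qed.

(** The tangent of u^p at 1 + y, evaluated at 1, gives (1 + y)^p <= 1 + p y (1 + y)^(p - 1). A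
    second tangent bounds the last factor from the side that the sign of y requires. *)
Lemma powR1D_le p : 2 < p -> exists2 C, 0 < C & forall y, -1 <= y <= 1 ->
  (1 + y) `^ p <= 1 + p * y + C * y ^+ 2.
Proof.
move=> p2; exists (p * (p - 1) * 2 `^ (p - 2)).
  by rewrite !mulr_gt0 ?powR_gt0//; lra.
move=> y /andP[y1 y2]; have y0 : 0 <= 1 + y by lra.
have p1 : 1 <= p by lra.
have p11 : 1 <= p - 1 by lra.
have := powR_tangent ler01 y0 p1.
rewrite powR1 => H1.
have E : 1 <= 2 `^ (p - 2) :> R by rewrite -[leLHS](powRr0 2) ler_powR; lra.
have [yp|yn] := leP 0 y.
  have H2 := powR_tangent ler01 y0 p11; rewrite powR1 (_ : p - 1 - 1 = p - 2) in H2; last by ring.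
  have H3 : (1 + y) `^ (p - 2) <= 2 `^ (p - 2).
    by apply: ge0_ler_powR; rewrite ?nnegrE//; lra.
  set t1 := (1 + y) `^ (p - 1) in H1 H2; set t2 := (1 + y) `^ (p - 2) in H2 H3.
  set e := 2 `^ (p - 2) in H3 E *; set t := (1 + y) `^ p in H1 *.
  have {H2} H2 : t1 <= 1 + (p - 1) * e * y.
    have : (p - 1) * y * t2 <= (p - 1) * y * e by rewrite ler_wpM2l// mulr_ge0//; lra.
    lra.
  have : p * y * t1 <= p * y * (1 + (p - 1) * e * y) by rewrite ler_wpM2l// mulr_ge0//; lra.
  lra.
have H2 := powR_tangent y0 ler01 p11; rewrite powR1 mulr1 (addrC 1 y) addrK in H2.
rewrite (addrC y) in H2.
set t1 := (1 + y) `^ (p - 1) in H1 H2; set e := 2 `^ (p - 2) in E *; set t := (1 + y) `^ p in H1 *.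
have : p * - y * (1 + (p - 1) * y) <= p * - y * t1 by rewrite ler_wpM2l// mulr_ge0//; lra.
have : p * (p - 1) * (y ^+ 2) * 1 <= p * (p - 1) * y ^+ 2 * e.
  have K : 0 <= p * (p - 1) by rewrite mulr_ge0//; lra.
  by rewrite ler_wpM2l// (mulr_ge0 K (sqr_ge0 y)).
lra.
Qed.

Lemma powR_mul_sqr u p : 0 <= u -> 2 < p -> u `^ (p - 2) * u ^+ 2 = u `^ p.
Proof.
move=> u0 p2; rewrite -powR_mulrn// -powRD ?subrK//.
by rewrite gt_eqF// (lt_trans _ p2).
Qed.

(** By symmetry and homogeneity b = a y with |y| <= 1, and the expansion at 1 applies. The terms
    with factor p are linear in a or b, so they will integrate to 0 for functions of mean zero. *)
Lemma powR_add_le p : 2 < p -> exists2 C, 0 < C & forall a b,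
  `|a + b| `^ p <= `|a| `^ p + `|b| `^ p
    + p * (`|a| `^ (p - 2) * a * b + `|b| `^ (p - 2) * b * a)
    + C * (`|a| `^ (p - 2) * b ^+ 2 + `|b| `^ (p - 2) * a ^+ 2).
Proof.
(* The extra p absorbs the cross term p |y|^(p - 2) y, which may be negative. *)
move=> p2; have [C C0 HC] := powR1D_le p2; exists (C + p); first by lra.
move=> a b; wlog ab : a b / `|b| <= `|a|.
  move=> H; have [|/ltW] := leP `|b| `|a|; first exact: H.
  move=> /H; rewrite [b + a]addrC; congr (_ <= _); ring.
have [a0|a0] := eqVneq a 0.
  move: ab; rewrite a0 normr0 normr_le0 => /eqP ->.
  have p0 : p != 0 by rewrite gt_eqF//; lra.
  have p20 : p - 2 != 0 by rewrite gt_eqF//; lra.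
  by rewrite addr0 normr0 !powR0// expr0n /= !(mulr0, addr0).
have na : 0 < `|a| by rewrite normr_gt0.
have [y bE y1] : exists2 y, b = a * y & `|y| <= 1.
  exists (b / a); first by rewrite mulrCA divff ?mulr1.
  by rewrite normrM normfV ler_pdivrMr// mul1r.
have y1' : -1 <= y <= 1 by rewrite -ler_norml.
have yy : 0 <= 1 + y by lra.
rewrite bE (_ : a + a * y = a * (1 + y)); last by ring.
rewrite !normrM (ger0_norm yy) !powRM//.
have E2 : `|a| `^ p = `|a| `^ (p - 2) * a ^+ 2.
  by rewrite -powR_mul_sqr// real_normK// num_real.
set A := `|a| `^ (p - 2) in E2 *; set Y := `|y| `^ (p - 2).
rewrite E2; have A0 : 0 <= A * a ^+ 2 by rewrite mulr_ge0 ?powR_ge0 ?sqr_ge0.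
rewrite (_ : _ + _ + _ = A * a ^+ 2 * (1 + `|y| `^ p + p * (y + Y * y) + (C + p) * (y ^+ 2 + Y))); last by ring.
rewrite ler_wpM2l//; have H := HC _ y1'.
have Y0 : 0 <= Y by exact: powR_ge0.
have yp : 0 <= `|y| `^ p by exact: powR_ge0.
have : p * Y * (- y) <= p * Y * 1 by rewrite ler_wpM2l// ?mulr_ge0//; lra.
have : 0 <= p * y ^+ 2 by rewrite mulr_ge0 ?sqr_ge0//; lra.
have : 0 <= C * Y by rewrite mulr_ge0// ltW.
lra.
Qed.

(** Either v^2 <= e u^2, or u <= c v with c = e^(-1/2); each term on the right covers one case. *)
Lemma powR_young p e : 2 < p -> 0 < e -> exists2 D, 0 < D & forall u v, 0 <= u -> 0 <= v ->
  u `^ (p - 2) * v ^+ 2 <= e * u `^ p + D * v `^ p.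
Proof.
move=> p2 e0; pose c := (Num.sqrt e)^-1.
have c0 : 0 < c by rewrite invr_gt0 sqrtr_gt0.
have c0' := ltW c0; have e0' := ltW e0.
exists (c `^ (p - 2)); first exact: powR_gt0.
move=> u v u0 v0; rewrite -(powR_mul_sqr u0 p2) -(powR_mul_sqr v0 p2).
have U0 := powR_ge0 u (p - 2); have V0 := powR_ge0 v (p - 2); have C0 := powR_ge0 c (p - 2).
have [H|H] := leP (v ^+ 2) (e * u ^+ 2).
  rewrite (@le_trans _ _ (e * (u `^ (p - 2) * u ^+ 2)))//.
    by rewrite [leRHS]mulrCA ler_wpM2l.
  by rewrite lerDl !mulr_ge0 ?sqr_ge0.
have uv : u <= c * v.
  rewrite -ler_sqr ?nnegrE ?mulr_ge0// exprMn exprVn sqr_sqrtr//.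
  by rewrite ler_pdivlMl// ltW.
rewrite (@le_trans _ _ (c `^ (p - 2) * (v `^ (p - 2) * v ^+ 2)))//.
  rewrite mulrA ler_wpM2r ?sqr_ge0// -powRM//.
  by apply: ge0_ler_powR; rewrite ?nnegrE ?mulr_ge0//; lra.
by rewrite lerDr mulr_ge0 ?mulr_ge0 ?sqr_ge0.
Qed.

Lemma powR_sub_le q a b : 0 < q -> `|a - b| `^ q <= 2 `^ q * (`|a| `^ q + `|b| `^ q).
Proof.
move=> q0; wlog ab : a b / `|b| <= `|a|.
  move=> H; have [|/ltW] := leP `|b| `|a|; first exact: H.
  by move=> /H; rewrite distrC [X in _ * X]addrC.
rewrite (@le_trans _ _ (2 `^ q * `|a| `^ q))//; last by rewrite ler_wpM2l ?powR_ge0// lerDl powR_ge0.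
rewrite -powRM//; apply: (ge0_ler_powR (ltW q0)); rewrite ?nnegrE ?mulr_ge0//.
by rewrite (le_trans (ler_normB _ _))//; lra.
Qed.

End PowerInequalities.

(** The tangent inequality at m, the mean of |f|, is integrated; its linear term has integral 0. *)
Lemma jensen_powR d (T : measurableType d) (R : realType) (mu : probability T R)
    (f : T -> R) (r : R) : bounded_measurable f -> 1 <= r ->
  `|\int[mu]_x f x| `^ r <= \int[mu]_x `|f x| `^ r.
Proof.
move=> bf r1; have bn := bm_norm bf.
have r0 : 0 <= r by lra.
pose m := \int[mu]_x `|f x|.
have m0 : 0 <= m by apply: expect_ge0.
apply: (@le_trans _ _ (m `^ r)).
  apply: (ge0_ler_powR r0); rewrite ?nnegrE//.
  exact: le_normr_Rintegral (bm_integrable mu bf).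
rewrite -[leLHS]addr0 -[X in _ + X](mulr0 (r * m `^ (r - 1))) -[X in _ * X](subrr m).
rewrite {2}/m -[X in _ * (_ - X)](expect_cst mu) -expectB//; last exact: bm_cst.
have bB : bounded_measurable (fun x => `|f x| - m) by apply: bmB => //; exact: bm_cst.
rewrite -expectZ// -[X in X + _](expect_cst mu) -expectD; [|exact: bm_cst|exact: bmZ].
apply: expect_le; first by apply: bmD; [exact: bm_cst|exact: bmZ].
  exact: bm_powR.
by move=> x; exact: powR_tangent.
Qed.

(* Later rot is (x,w) |-> ((x+w)/sqrt 2, (x-w)/sqrt 2) and gam is Gaussian. *)
Section RotationAverage.
Context d (T : measurableType d) (R : realType).
Context (rot : T * T -> T * T).
Hypothesis mrot : measurable_fun setT rot.
Hypothesis rotK : forall z, rot (rot z) = z.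

(** Stated for an abstract involution, so that the decay rests on these two clauses alone. In the
    Gaussian case the second one is the symmetry w |-> - w. *)
Definition rotation_invariant (gam : probability T R) :=
  (forall F : T * T -> R, bounded_measurable F ->
    \int[(gam \x gam)%E]_z F (rot z) = \int[(gam \x gam)%E]_z F z) /\
  (forall x (f : T -> R), bounded_measurable f ->
    \int[gam]_w f (rot (x, w)).2 = \int[gam]_w f (rot (x, w)).1).

Context (gam : probability T R).
Hypothesis ri : rotation_invariant gam.
Local Notation bm := (@bounded_measurable _ T R).

Definition rot_avg (f : T -> R) (x : T) : R := \int[gam]_w f (rot (x, w)).1.
Local Notation A := rot_avg.

Let bm_rot (F : T * T -> R) : bounded_measurable F -> bounded_measurable (fun z => F (rot z)).
Proof. by move=> bF; exact: (bm_comp mrot bF). Qed.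

Let bm_fst (f : T -> R) : bm f -> bounded_measurable (fun z : T * T => f z.1).
Proof. by move=> bf; exact: (bm_comp measurable_fst bf). Qed.

Let bm_snd (f : T -> R) : bm f -> bounded_measurable (fun z : T * T => f z.2).
Proof. by move=> bf; exact: (bm_comp measurable_snd bf). Qed.

Let bm1 f : bm f -> bounded_measurable (fun z : T * T => f (rot z).1).
Proof. by move=> bf; exact: (bm_rot (bm_fst bf)). Qed.
Let bm2 f : bm f -> bounded_measurable (fun z : T * T => f (rot z).2).
Proof. by move=> bf; exact: (bm_rot (bm_snd bf)). Qed.

Lemma bm_rot_avg f : bm f -> bm (A f).
Proof. by move=> bf; exact: (bm_fubini1 gam gam (bm1 bf)). Qed.

Lemma expect_rot_avg f : bm f -> \int[gam]_x A f x = \int[gam]_x f x.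
Proof.
move=> bf; rewrite /A -(expect_fubini1 gam gam (bm1 bf)) (ri.1 _ (bm_fst bf)).
rewrite expect_fubini1; last exact: bm_fst.
by apply: eq_Rintegral => x _; rewrite /= expect_cst.
Qed.

(** Both sides are integrals of a product in (rot z).1 and z.1 under the product law; [rot]
    preserves that law and, being an involution, exchanges the two points. *)
Lemma rot_avg_sym f g : bm f -> bm g ->
  \int[gam]_x (A f x * g x) = \int[gam]_x (f x * A g x).
Proof.
move=> bf bg.
have H (h k : T -> R) : bm h -> bm k ->
    \int[gam]_x (A h x * k x) = \int[(gam \x gam)%E]_z (h (rot z).1 * k z.1).
  move=> bh bk; rewrite expect_fubini1; last by apply: bmM; [exact: bm1|exact: bm_fst].
  apply: eq_Rintegral => x _ /=; rewrite mulrC -expectZ; last exact: (bm_section x (bm1 bh)).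
  by apply: eq_Rintegral => w _; rewrite mulrC.
rewrite H//; under [RHS]eq_Rintegral do rewrite mulrC; rewrite H//.
rewrite -(ri.1 (fun z => f (rot z).1 * g z.1)); last by apply: bmM; [exact: bm1|exact: bm_fst].
by apply: eq_Rintegral => z _; rewrite rotK mulrC.
Qed.

(* The averages of f over the two rotated copies coincide, so that the
   mean-zero cross terms can be used. *)
Let rot_avg2 f x : bm f -> 2 * A f x = \int[gam]_w (f (rot (x, w)).1 + f (rot (x, w)).2).
Proof.
move=> bf; rewrite expectD; last 2 first.
- exact: (bm_section x (bm1 bf)).
- exact: (bm_section x (bm2 bf)).
by rewrite (ri.2 x _ bf) -mulr2n mulrC mulr_natr.
Qed.

(** Jensen in w for the symmetrised average [rot_avg2], then invariance of the product law. The
    factor 2^p is the source of all decay. *)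
Lemma rot_avg_powR f p : 1 <= p -> bm f ->
  2 `^ p * \int[gam]_x `|A f x| `^ p <= \int[(gam \x gam)%E]_z `|f z.1 + f z.2| `^ p.
Proof.
move=> p1 bf; have p0 : 0 <= p by lra.
have bF : bounded_measurable (fun z : T * T => `|f z.1 + f z.2| `^ p).
  by apply: bm_powR => //; apply: bmD; [exact: bm_fst|exact: bm_snd].
rewrite -(ri.1 _ bF) (expect_fubini1 gam gam (bm_rot bF)).
rewrite -expectZ; last by apply: bm_powR => //; exact: bm_rot_avg.
apply: expect_le; first by apply: bmZ; apply: bm_powR => //; exact: bm_rot_avg.
  exact: (bm_fubini1 gam gam (bm_rot bF)).
move=> x; rewrite -powRM// -{1}(ger0_norm (_ : 0 <= 2 :> R))// -normrM rot_avg2//.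
apply: jensen_powR => //.
by apply: bmD; [exact: (bm_section x (bm1 bf))|exact: (bm_section x (bm2 bf))].
Qed.

Lemma bm_iter_rot_avg k f : bm f -> bm (iter k A f).
Proof. by move=> bf; elim: k => //= k IH; exact: bm_rot_avg. Qed.

Lemma expect_iter_rot_avg k f : bm f -> \int[gam]_x iter k A f x = \int[gam]_x f x.
Proof.
move=> bf; elim: k => //= k IH; by rewrite (expect_rot_avg (bm_iter_rot_avg k bf)).
Qed.

Lemma iter_rot_avg_sym k f g : bm f -> bm g ->
  \int[gam]_x (iter k A f x * g x) = \int[gam]_x (f x * iter k A g x).
Proof.
elim: k g => // k IH g bf bg; rewrite iterS (rot_avg_sym (bm_iter_rot_avg k bf) bg).
by rewrite (IH _ bf (bm_rot_avg bg)) iterSr.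
Qed.

Lemma iter_rot_avgB k f c : bm f -> iter k A (fun x => f x - c) = fun x => iter k A f x - c.
Proof.
move=> bf; elim: k => //= k ->; apply/funext => x; rewrite /A expectB ?expect_cst//.
  exact: (bm_section x (bm1 (bm_iter_rot_avg k bf))).
exact: bm_cst.
Qed.

Let sqr_powR (f : T -> R) : (fun x => `|f x| `^ 2) = (fun x => f x ^+ 2).
Proof. by apply/funext => x; rewrite powR_mulrn// real_normK// num_real. Qed.

Local Notation V f := (\int[gam]_x (f x ^+ 2)).
Local Notation W p f := (\int[gam]_x (`|f x| `^ p)).

Let V_ge0 (f : T -> R) : 0 <= V f.
Proof. by apply: expect_ge0 => x; exact: sqr_ge0. Qed.
(** The cross term 2 f(z.1) f(z.2) has integral 0, which leaves 4 V (A f) <= 2 V f. *)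
Lemma rot_avg_L2 f : bm f -> \int[gam]_x f x = 0 -> V (A f) <= 2^-1 * V f.
Proof.
move=> bf f0; have := @rot_avg_powR f 2 (ler1n _ 2) bf.
rewrite (_ : \int[_]_x `|A f x| `^ 2 = V (A f)); last by congr Rintegral; exact: sqr_powR.
rewrite powR_mulrn//.
rewrite (_ : \int[(gam \x gam)%E]_z _ = 2 * V f).
  by clear f0; move: (V f) (V (A f)) => a b; lra.
have b1 := bm_fst bf; have b2 := bm_snd bf.
transitivity (\int[(gam \x gam)%E]_z (f z.1 ^+ 2 + (2 * (f z.1 * f z.2) + f z.2 ^+ 2))).
  apply: eq_Rintegral => z _; rewrite powR_mulrn// real_normK ?num_real//; ring.
have b11 := bmX 2 b1; have b22 := bmX 2 b2; have b12 := bmM b1 b2.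
rewrite expectD//; last by apply: bmD => //; exact: bmZ.
rewrite expectD//; last exact: bmZ.
rewrite expectZ// expect_prod// f0 mulr0 mulr0 add0r.
rewrite (expect_fubini1 gam gam b11) (expect_fubini2 gam gam b22) /=.
under eq_Rintegral do rewrite expect_cst.
have dbl (a : R) : a + a = 2 * a by ring.
exact: dbl.
Qed.

Lemma iter_rot_avg_L2 k f : bm f -> \int[gam]_x f x = 0 -> V (iter k A f) <= 2^-1 ^+ k * V f.
Proof.
move=> bf f0; elim: k => [|k IH]; first by rewrite expr0 mul1r.
rewrite iterS (le_trans (rot_avg_L2 _ _))//; first exact: bm_iter_rot_avg.
  by rewrite expect_iter_rot_avg.
by rewrite exprS -mulrA ler_wpM2l.
Qed.

Lemma L2_le_Lp p (f : T -> R) : 2 <= p -> bm f -> V f `^ (p / 2) <= W p f.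
Proof.
move=> p2 bf; have p1 : 1 <= p / 2 by lra.
have := @jensen_powR _ _ _ gam _ _ (bmX 2 bf) p1; rewrite (ger0_norm (V_ge0 f)) => /le_trans; apply.
rewrite le_eqVlt; apply/orP; left; apply/eqP; apply: eq_Rintegral => x _.
rewrite ger0_norm ?sqr_ge0// -(@real_normK _ (f x)) ?num_real//.
by rewrite -powR_mulrn// -powRrM mulrCA divff ?mulr1.
Qed.

(** After expansion, the terms linear in f(z.1) or f(z.2) integrate to 0. The quadratic ones factor
    into the integral of |f|^(p - 2) times V f, a product that Young's inequality splits. *)
Lemma rot_avg_Lp_step (p C D e : R) (f : T -> R) : 2 < p -> 0 < C ->
  (forall a b : R, `|a + b| `^ p <= `|a| `^ p + `|b| `^ p
    + p * (`|a| `^ (p - 2) * a * b + `|b| `^ (p - 2) * b * a)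
    + C * (`|a| `^ (p - 2) * b ^+ 2 + `|b| `^ (p - 2) * a ^+ 2)) ->
  (forall u v : R, 0 <= u -> 0 <= v ->
    u `^ (p - 2) * v ^+ 2 <= e * u `^ p + D * v `^ p) ->
  bm f -> \int[gam]_x f x = 0 ->
  2 `^ p * W p (A f) <= (2 + 2 * C * e) * W p f + 2 * C * D * (V f `^ (p / 2)).
Proof.
move=> p2 C0.
have p0 : 0 <= p by lra.
have p1 : 1 <= p by lra.
have p20 : 0 <= p - 2 by lra.
have final (w v3 g : R) : g <= 2 * (e * w + D * v3) ->
    2 * w + p * 0 + C * g <= (2 + 2 * C * e) * w + 2 * C * D * v3.
  rewrite -(ler_pM2l C0) => H; lra.
have dbl (a b : R) : a <= b -> a + a <= 2 * b by lra.
move=> HC HD bf f0; apply: (le_trans (rot_avg_powR p1 bf)).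
have bp := bm_powR p0 bf; have bp2 := bm_powR p20 bf; have bf2 := bmX 2 bf.
have bpf := bmM bp2 bf.
have W1 : \int[(gam \x gam)%E]_z `|f z.1| `^ p = W p f.
  rewrite (expect_fubini1 gam gam (bm_fst bp)).
  by apply: eq_Rintegral => x _; rewrite /= expect_cst.
have W2 : \int[(gam \x gam)%E]_z `|f z.2| `^ p = W p f.
  rewrite (expect_fubini2 gam gam (bm_snd bp)).
  by apply: eq_Rintegral => x _; rewrite /= expect_cst.
pose g1 z := `|f z.1| `^ p + `|f z.2| `^ p.
pose g2 z := (`|f z.1| `^ (p - 2) * f z.1) * f z.2 + f z.1 * (`|f z.2| `^ (p - 2) * f z.2).
pose g3 z := `|f z.1| `^ (p - 2) * f z.2 ^+ 2 + f z.1 ^+ 2 * `|f z.2| `^ (p - 2).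
have bg1 : bounded_measurable g1 by exact: (bmD (bm_fst bp) (bm_snd bp)).
have bg2 : bounded_measurable g2.
  exact: (bmD (bmM (bm_fst bpf) (bm_snd bf)) (bmM (bm_fst bf) (bm_snd bpf))).
have bg3 : bounded_measurable g3.
  exact: (bmD (bmM (bm_fst bp2) (bm_snd bf2)) (bmM (bm_fst bf2) (bm_snd bp2))).
have E1 : \int[(gam \x gam)%E]_z g1 z = 2 * W p f.
  by rewrite (expectD _ (bm_fst bp) (bm_snd bp)) W1 W2; ring.
have E2 : \int[(gam \x gam)%E]_z g2 z = 0.
  rewrite (expectD _ (bmM (bm_fst bpf) (bm_snd bf)) (bmM (bm_fst bf) (bm_snd bpf))).
  by rewrite (expect_prod _ _ bpf bf) (expect_prod _ _ bf bpf) f0 mulr0 mul0r addr0.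
have E3 : \int[(gam \x gam)%E]_z g3 z <= 2 * (e * W p f + D * (V f `^ (p / 2))).
  rewrite (expectD _ (bmM (bm_fst bp2) (bm_snd bf2)) (bmM (bm_fst bf2) (bm_snd bp2))).
  rewrite (expect_prod _ _ bp2 bf2) (expect_prod _ _ bf2 bp2) [V f * _]mulrC.
  apply: dbl.
  rewrite mulrC -(expectZ _ _ bp2).
  have bc : bm (fun=> D * (V f `^ (p / 2))) by exact: bm_cst.
  apply: (@le_trans _ _ (\int[gam]_x (e * `|f x| `^ p + D * (V f `^ (p / 2))))); last first.
    by rewrite (expectD _ (bmZ e bp) bc) expect_cst (expectZ _ _ bp).
  apply: expect_le; [exact: (bmZ _ bp2)|exact: (bmD (bmZ e bp) bc)|move=> x].
  (* Young's inequality with the constant v = sqrt (V f), whose p-th power is V f to the power p /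
     2. *)
  have := HD _ _ (normr_ge0 (f x)) (sqrtr_ge0 (V f)).
  rewrite sqr_sqrtr// mulrC => /le_trans; apply.
  by rewrite -powR12_sqrt// -powRrM [2^-1 * p]mulrC.
apply: (@le_trans _ _ (\int[(gam \x gam)%E]_z (g1 z + p * g2 z + C * g3 z))).
  apply: expect_le.
  - by apply: bm_powR => //; apply: bmD; [exact: bm_fst|exact: bm_snd].
  - by apply: bmD; [apply: bmD => //; exact: bmZ|exact: bmZ].
  - move=> z; apply: (le_trans (HC _ _)); rewrite /g1 /g2 /g3 le_eqVlt; apply/orP; left; apply/eqP; ring.
rewrite expectD; [|by apply: bmD => //; exact: bmZ|exact: bmZ].
rewrite expectD//; last exact: bmZ.
rewrite !expectZ// E1 E2.
exact: final.
Qed.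

End RotationAverage.

(** * Decay of iterated averages *)

Section RotationDecay.
Context d (T : measurableType d) (R : realType).
Context (rot : T * T -> T * T).
Hypothesis mrot : measurable_fun setT rot.
Hypothesis rotK : forall z, rot (rot z) = z.
Local Notation bm := (@bounded_measurable _ T R).

(** K is fixed before [gam], since the law gamma_t moves with t while the final constant may depend
    on p alone. The rate is for p-th powers of norms, that is 2^(-k/2) for the norm itself. *)
Definition decay_const (p K : R) := forall gam : probability T R,
  rotation_invariant rot gam -> forall f : T -> R, bm f -> \int[gam]_x f x = 0 ->
  forall k, \int[gam]_x `|iter k (rot_avg rot gam) f x| `^ p <=
    K * (2 `^ (- (p / 2))) ^+ k * \int[gam]_x `|f x| `^ p.

Let powRX (x s : R) k : 0 <= x -> (x ^+ k) `^ s = (x `^ s) ^+ k.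
Proof.
move=> x0; elim: k => [|k IH]; first by rewrite !expr0 powR1.
by rewrite !exprS powRM ?exprn_ge0// IH.
Qed.

Let powR_rate (p : R) k (x : R) : 0 <= x ->
  (2^-1 ^+ k * x) `^ (p / 2) = (2 `^ (- (p / 2))) ^+ k * x `^ (p / 2).
Proof.
move=> x0; rewrite powRM ?exprn_ge0//; congr (_ * _).
rewrite powRX//; congr (_ ^+ k).
by rewrite -(powR_inv1 (ler0n R 2)) -powRrM mulN1r.
Qed.

Lemma decay_gt2 p : 2 < p -> exists2 K, 0 < K & decay_const p K.
Proof.
move=> p2; have [C C0 HC] := powR_add_le p2.
have p20 : 0 < p / 2 by lra.
pose b : R := 2 `^ (p / 2).
have b2 : 2 < b.
  rewrite /b /powR gt_eqF// -[ltLHS]lnK ?posrE// ltr_expR -[ltLHS]mul1r ltr_pM2r ?ln_gt0 ?ltr1n//.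
  by lra.
(* With this e the term 2 * C * e is (b - 2) / 2, so the leading part shrinks by (b + 2) / (2 b^2)
   per step, less than the wanted 1 / b because b > 2. *)
have e0 : 0 < (b - 2) / (4 * C) by rewrite divr_gt0; lra.
have [D D0 HD] := powR_young p2 e0.
have K0 : 0 < 1 + 4 * C * D / (b - 2).
  by rewrite ltr_wpDr// divr_ge0//; [rewrite !mulr_ge0// ltW|lra].
(* K solves K (b - 2) = (b - 2) + 4 C D: the slack of the leading part then pays for the L^2 term in
   the induction step. *)
exists (1 + 4 * C * D / (b - 2)) => // gam ri f bf f0 k.
set K := 1 + _ in K0 *.
have rE : 2 `^ (- (p / 2)) = b^-1 :> R by rewrite powRN.
have pE : 2 `^ p = b * b :> R.
  by rewrite /b -powRD ?pnatr_eq0 ?implybT// -splitr.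
set W0 := \int[gam]_x `|f x| `^ p.
have W00 : 0 <= W0 by apply: expect_ge0 => x; exact: powR_ge0.
have V0 : 0 <= \int[gam]_x (f x ^+ 2) by apply: expect_ge0 => x; exact: sqr_ge0.
elim: k => [|k IH].
  rewrite expr0 mulr1 /= ler_peMl// /K lerDl divr_ge0//; [by rewrite !mulr_ge0// ltW|lra].
have bk := bm_iter_rot_avg mrot gam k bf.
have fk0 : \int[gam]_x iter k (rot_avg rot gam) f x = 0 by rewrite (expect_iter_rot_avg mrot ri k bf).
have := rot_avg_Lp_step mrot ri p2 C0 HC HD bk fk0; rewrite pE -iterS.
have VV : (\int[gam]_x (iter k (rot_avg rot gam) f x ^+ 2)) `^ (p / 2) <= (b^-1) ^+ k * W0.
  apply: (@le_trans _ _ ((2^-1 ^+ k * \int[gam]_x (f x ^+ 2)) `^ (p / 2))).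
    apply: (ge0_ler_powR (ltW p20)); rewrite ?nnegrE ?mulr_ge0 ?exprn_ge0//.
      by apply: expect_ge0 => x; exact: sqr_ge0.
    exact: (iter_rot_avg_L2 mrot ri k bf f0).
  rewrite powR_rate// rE ler_wpM2l ?exprn_ge0 ?invr_ge0 ?powR_ge0//.
  exact: (L2_le_Lp gam (ltW p2) bf).
rewrite rE in IH *.
rewrite exprS (mulrA K); set r := b^-1 ^+ k in IH VV *.
have r0 : 0 <= r by rewrite exprn_ge0// invr_ge0 powR_ge0.
have rW0 : 0 <= r * W0 by rewrite mulr_ge0.
have step (Wk Wk1 Vk : R) : Wk <= K * r * W0 -> Vk <= r * W0 ->
    b * b * Wk1 <= (2 + 2 * C * ((b - 2) / (4 * C))) * Wk + 2 * C * D * Vk ->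
    Wk1 <= K * b^-1 * r * W0.
  clear - C0 D0 b2 rW0 K0.
  move=> h1 h2; have -> : 2 * C * ((b - 2) / (4 * C)) = (b - 2) / 2.
    by field; rewrite gt_eqF.
  have KE : K * (b - 2) = (b - 2) + 4 * C * D by rewrite /K; field; rewrite subr_eq0 gt_eqF.
  move: KE; clearbody K b; move=> KE h3.
  have b0 : 0 < b by lra.
  rewrite (_ : K * b^-1 * r * W0 = b^-1 * (K * (r * W0))); last by ring.
  rewrite ler_pdivlMl// -(ler_pM2l b0) mulrA (le_trans h3)//.
  have CD : 0 <= 2 * C * D by rewrite !mulr_ge0 ?ltW.
  have h2' : 2 * C * D * Vk <= 2 * C * D * (r * W0) by rewrite ler_wpM2l.
  have h1' : (2 + (b - 2) / 2) * Wk <= (2 + (b - 2) / 2) * (K * r * W0) by rewrite ler_wpM2l//; lra.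
  have E : b * (K * (r * W0)) = (2 + (b - 2) / 2) * (K * r * W0) + K * (b - 2) * (r * W0) / 2 by field.
  rewrite E KE.
  have b2' : 0 <= (b - 2) * (r * W0) by rewrite mulr_ge0//; lra.
  lra.
exact: step IH VV.
Qed.

Lemma decay_eq2 : decay_const 2 1.
Proof.
move=> gam ri f bf f0 k; rewrite mul1r divff// powR_inv1//.
have E (g : T -> R) : \int[gam]_x `|g x| `^ 2 = \int[gam]_x (g x ^+ 2).
  by apply: eq_Rintegral => x _; rewrite powR_mulrn// real_normK// num_real.
by rewrite !E; exact: (iter_rot_avg_L2 mrot ri k bf f0).
Qed.

(** The iterate h is tested against its dual function g = |h|^(p - 2) h. Symmetry moves the
    averaging from f onto g, where the decay for the conjugate exponent q is available. *)
Lemma decay_dual p q K : 1 < p -> 1 < q -> p^-1 + q^-1 = 1 -> 0 < K -> decay_const q K ->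
  decay_const p ((K * 2 `^ q * 2) `^ (p / q)).
Proof.
move=> p1 q1 pq K0 HK gam ri f bf f0 k.
have p0 : 0 < p by lra.
have q0 : 0 < q by lra.
set h := iter k (rot_avg rot gam) f.
have bh : bm h := bm_iter_rot_avg mrot gam k bf.
pose g x := `|h x| `^ (p - 2) * h x.
have gn x : `|g x| = `|h x| `^ (p - 1).
  rewrite /g normrM ger0_norm ?powR_ge0// mulrC.
  by rewrite (_ : p - 2 = p - 1 - 1) ?mulr_powRB1//; lra.
have gh x : h x * g x = `|h x| `^ p.
  rewrite /g mulrCA -expr2 -(@real_normK _ (h x)) ?num_real//.
  rewrite expr2 -(@mulr_powRB1 _ _ p)// -[in RHS](@mulr_powRB1 _ _ (p - 1))//; last by lra.
  by rewrite (_ : p - 1 - 1 = p - 2); ring.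
have bp := bm_powR (ltW p0) bh.
have bg : bm g.
  split.
    apply: measurable_funM; last by case: bh.
    apply: (measurableT_comp (measurable_powR (p - 2))).
    by case: (bm_norm bh).
  have p10 : 0 <= p - 1 by lra.
  have [_ [M HM]] := bm_powR p10 bh; exists M => x.
  by rewrite gn; have := HM x; rewrite ger0_norm ?powR_ge0.
set H := \int[gam]_x `|h x| `^ p; set N := \int[gam]_x `|f x| `^ p.
have N0 : 0 <= N by apply: expect_ge0 => x; exact: powR_ge0.
have H0 : 0 <= H by apply: expect_ge0 => x; exact: powR_ge0.
have gq x : `|g x| `^ q = `|h x| `^ p.
  rewrite gn -powRrM; congr (_ `^ _).
  have e : q + p = p * q by rewrite -[RHS]mulr1 -pq; field; rewrite !gt_eqF.
  by rewrite mulrBl mul1r -e addrAC subrr add0r.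
(* The decay for q concerns functions of mean zero; as h has mean zero, subtracting m from g does
   not change the pairing. *)
pose m := \int[gam]_x g x; pose g0 x := g x - m.
have bg0 : bm g0 by apply: bmB => //; exact: bm_cst.
have g00 : \int[gam]_x g0 x = 0 by rewrite expectB ?expect_cst ?subrr//; exact: bm_cst.
have HE : H = \int[gam]_x (f x * iter k (rot_avg rot gam) g0 x).
  rewrite -(iter_rot_avg_sym mrot rotK ri k bf bg0) -/h.
  transitivity (\int[gam]_x (h x * g x - m * h x)).
    rewrite expectB; [|exact: bmM|exact: bmZ].
    rewrite expectZ// (expect_iter_rot_avg mrot ri k bf) f0 mulr0 subr0.
    by apply: eq_Rintegral => x _; rewrite gh.
  by apply: eq_Rintegral => x _; rewrite /g0 mulrBr [m * _]mulrC.
set G := iter k (rot_avg rot gam) g0 in HE *.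
have bG : bm G by exact: (bm_iter_rot_avg mrot gam k bg0).
pose L := K * 2 `^ q * 2 * (2 `^ (- (q / 2))) ^+ k.
have L0 : 0 < L by rewrite !mulr_gt0 ?exprn_gt0 ?powR_gt0.
have bgq := bm_powR (ltW q0) bg.
have GL : \int[gam]_x `|G x| `^ q <= L * H.
  apply: (le_trans (HK gam ri g0 bg0 g00 k)).
  rewrite /L -!mulrA ler_pM2l// [leRHS]mulrA [leRHS]mulrCA ler_pM2l ?exprn_gt0 ?powR_gt0//.
  apply: (@le_trans _ _ (\int[gam]_x (2 `^ q * (`|g x| `^ q + `|m| `^ q)))).
    apply: expect_le.
    - exact: bm_powR (ltW q0) bg0.
    - by apply: bmZ; apply: bmD => //; exact: bm_cst.
    - by move=> x; exact: powR_sub_le.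
  have bc : bm (fun=> `|m| `^ q) by exact: bm_cst.
  rewrite (expectZ _ _ (bmD bgq bc)) (expectD _ bgq bc) expect_cst -mulrA.
  rewrite ler_pM2l ?powR_gt0// mulrDl mul1r.
  have E : \int[gam]_x `|g x| `^ q = H by apply: eq_Rintegral => x _; rewrite gq.
  by rewrite E lerD2l -E; exact: (jensen_powR gam bg (ltW q1)).
(* This weight in Young's inequality satisfies lam^q = L, so the term in G is at most H / q. As 1 -
   1/q = 1/p, what remains is H <= lam^p * N. *)
pose lam := L `^ q^-1.
have lam0 : 0 < lam by exact: powR_gt0.
have lamq : lam `^ q = L by rewrite /lam -powRrM mulVf ?gt_eqF// powRr1// ltW.
have lamp : lam `^ p = (K * 2 `^ q * 2) `^ (p / q) * (2 `^ (- (p / 2))) ^+ k.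
  rewrite /lam -powRrM [q^-1 * p]mulrC /L powRM ?exprn_ge0 ?powR_ge0//; last first.
    by rewrite !mulr_ge0 ?powR_ge0// ltW.
  rewrite powRX ?powR_ge0//; congr (_ * _ ^+ k).
  by rewrite -powRrM; congr (_ `^ _); field; rewrite gt_eqF.
rewrite -lamp.
have bfp := bm_powR (ltW p0) bf; have bGq := bm_powR (ltW q0) bG.
have le1 : H <= \int[gam]_x (lam `^ p / p * `|f x| `^ p + (L * q)^-1 * `|G x| `^ q).
  rewrite HE; apply: expect_le; [exact: bmM|exact: (bmD (bmZ _ bfp) (bmZ _ bGq))|move=> x].
  apply: (le_trans (ler_norm _)); rewrite normrM.
  have -> : `|f x| * `|G x| = (lam * `|f x|) * (lam^-1 * `|G x|).
    by field; rewrite gt_eqF.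
  have il : 0 <= lam^-1 by rewrite invr_ge0 ltW.
  have := @conjugate_powR R (lam * `|f x|) (lam^-1 * `|G x|) p q
    (mulr_ge0 (ltW lam0) (normr_ge0 _)) (mulr_ge0 il (normr_ge0 _)) p0 q0 pq.
  move=> /le_trans; apply.
  rewrite !powRM ?(ltW lam0)// [lam^-1 `^ q](_ : _ = L^-1); last first.
    by rewrite -lamq -powR_inv1 ?(ltW lam0)// -powRrM mulN1r powRN.
  by rewrite (invfM L q) [_ * _ / p]mulrAC [_ * _ / q]mulrAC.
have : H <= lam `^ p / p * N + H / q.
  apply: (le_trans le1); rewrite (expectD _ (bmZ _ bfp) (bmZ _ bGq)).
  rewrite (expectZ _ _ bfp) (expectZ _ _ bGq) lerD2l.
  rewrite ler_pdivrMl ?mulr_gt0// (le_trans GL)// le_eqVlt; apply/orP; left; apply/eqP.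
  by field; rewrite gt_eqF.
have -> : q^-1 = 1 - p^-1 by rewrite -pq addrAC subrr add0r.
rewrite mulrBr mulr1 addrCA -lerBlDl subrr subr_ge0 => le2.
by move: le2; rewrite [leRHS]mulrAC ler_pM2r ?invr_gt0.
Qed.

Lemma decay p : 1 < p -> exists2 K, 0 < K & decay_const p K.
Proof.
move=> p1; have [p2|p2|->] := ltgtP p 2; last by exists 1; last exact: decay_eq2.
  have q0 : 0 < p - 1 by lra.
  have q2 : 2 < p / (p - 1) by rewrite ltr_pdivlMr//; lra.
  have [K K0 HK] := decay_gt2 q2.
  exists ((K * 2 `^ (p / (p - 1)) * 2) `^ (p / (p / (p - 1)))).
    by rewrite powR_gt0// !mulr_gt0// powR_gt0.
  apply: (decay_dual p1 _ _ K0 HK); first by lra.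
  by field; rewrite !gt_eqF//; lra.
exact: decay_gt2.
Qed.

(** Centering f costs the factor 2^p * 2, as Jensen bounds |m|^p by the integral of |f|^p. *)
Lemma rot_avg_decay p : 1 < p -> exists2 K, 0 < K &
  forall gam : probability T R, rotation_invariant rot gam ->
  forall f : T -> R, bm f -> forall k,
  \int[gam]_x `|iter k (rot_avg rot gam) f x - \int[gam]_y f y| `^ p <=
    K * (2 `^ (- (p / 2))) ^+ k * \int[gam]_x `|f x| `^ p.
Proof.
move=> p1; have [K K0 HK] := decay p1.
have p0 : 0 < p by lra.
exists (K * (2 `^ p * 2)); first by rewrite !mulr_gt0// powR_gt0.
move=> gam ri f bf k; set m := \int[gam]_y f y.
have bfm : bm (fun x => f x - m) by apply: bmB => //; exact: bm_cst.
have fm0 : \int[gam]_x (f x - m) = 0 by rewrite expectB ?expect_cst ?subrr//; exact: bm_cst.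
have := HK gam ri _ bfm fm0 k.
rewrite (iter_rot_avgB mrot gam k m bf) => /le_trans; apply.
rewrite -!mulrA ler_pM2l// mulrA mulrCA ler_pM2l ?exprn_gt0 ?powR_gt0//.
have bfp := bm_powR (ltW p0) bf; have bc : bm (fun=> `|m| `^ p) by exact: bm_cst.
apply: (@le_trans _ _ (\int[gam]_x (2 `^ p * (`|f x| `^ p + `|m| `^ p)))).
  apply: expect_le => [| |x]; last exact: powR_sub_le.
    exact: bm_powR (ltW p0) bfm.
  exact: bmZ (bmD bfp bc).
rewrite (expectZ _ _ (bmD bfp bc)) (expectD _ bfp bc) expect_cst.
rewrite -mulrA ler_pM2l ?powR_gt0// mulrDl mul1r lerD2l.
exact: (jensen_powR gam bf (ltW p1)).
Qed.

End RotationDecay.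

(** * The half turn of a centered Gaussian *)

Section CenteredLaws.
Context (R : realType) (X : completeNormedModType R) (dot : {dot X for idfun}).
Hypothesis normE : induces_norm dot.
Hypothesis sepX : separable X.
Local Notation BX := (borel X).
Local Notation bm := (@bounded_measurable _ BX R).

(** The characteristic function of a centered Gaussian whose covariance form is q. Laws are matched
    below by identities between such forms. *)
Definition centered (mu : probability BX R) (q : X -> R) := forall h,
  \int[mu]_x cos (dot (x : X) h) = expR (- (q h / 2)) /\
  \int[mu]_x sin (dot (x : X) h) = 0.

Lemma gaussian_centered Q : nonneg_operator dot Q -> (trace dot Q < +oo)%E ->
  centered (gaussian dot 0 Q) (fun h => dot (Q h) h).
Proof.
move=> nQ tQ h.
have /(is_gaussianP normE 0 _ nQ) /(_ h) := gaussianP normE sepX 0 nQ tQ.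
by rewrite dot0l cos0 sin0 mul1r mul0r.
Qed.

Lemma expect_law_char d (T : measurableType d) (P : probability T R) (nu : probability BX R)
    (phi : T -> BX) : measurable_fun setT phi ->
  (forall h, \int[P]_z cos (dot (phi z : X) h) = \int[nu]_x cos (dot (x : X) h)) ->
  (forall h, \int[P]_z sin (dot (phi z : X) h) = \int[nu]_x sin (dot (x : X) h)) ->
  forall f, bm f -> \int[P]_z f (phi z) = \int[nu]_x f x.
Proof.
move=> mphi Hc Hs f bf; have [nu' Hnu'] := law_exists P mphi.
have E k : bm k -> \int[nu']_y k y = \int[P]_z k (phi z).
  by move=> bk; exact: (@expect_law _ _ _ _ _ P phi nu' k mphi (fun A _ => Hnu' A)).
have mh h : measurable_fun [set: BX] (fun x : BX => dot (x : X) h : R) := measurable_dot normE h.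
rewrite -E//; apply: expect_eq_measure; apply: (eq_borel_law normE sepX) => h.
  by rewrite (E _ (bm_cos (mh h))) Hc.
by rewrite (E _ (bm_sin (mh h))) Hs.
Qed.

Lemma centered_prod mu q nu q' h k : centered mu q -> centered nu q' ->
  \int[(mu \x nu)%E]_z cos (dot (z.1 : X) h + dot (z.2 : X) k) = expR (- ((q h + q' k) / 2)) /\
  \int[(mu \x nu)%E]_z sin (dot (z.1 : X) h + dot (z.2 : X) k) = 0.
Proof.
move=> /(_ h) [c1 s1] /(_ k) [c2 s2].
have bc1 := bm_cos (measurable_dot normE h); have bs1 := bm_sin (measurable_dot normE h).
have bc2 := bm_cos (measurable_dot normE k); have bs2 := bm_sin (measurable_dot normE k).
have P (f g : BX -> R) : bm f -> bm g -> bounded_measurable (fun z : BX * BX => f z.1 * g z.2).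
  by move=> bf bg; apply: bmM; [exact: (bm_comp measurable_fst bf)|exact: (bm_comp measurable_snd bg)].
split.
  under eq_Rintegral do rewrite cosD.
  rewrite (expectB _ (P _ _ bc1 bc2) (P _ _ bs1 bs2)).
  rewrite (expect_prod _ _ bc1 bc2) (expect_prod _ _ bs1 bs2) c1 c2 s1 mul0r subr0.
  by rewrite -expRD; congr expR; ring.
under eq_Rintegral do rewrite sinD.
rewrite (expectD _ (P _ _ bs1 bc2) (P _ _ bc1 bs2)).
by rewrite (expect_prod _ _ bs1 bc2) (expect_prod _ _ bc1 bs2) s1 s2 mul0r mulr0 addr0.
Qed.

Let s2 : R := (Num.sqrt 2)^-1.
Let s2sqr : s2 ^+ 2 = 2^-1.
Proof. by rewrite exprVn sqr_sqrtr. Qed.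
Let s2s2 (a : R) : s2 * (s2 * a) = 2^-1 * a.
Proof. by rewrite mulrA -expr2 s2sqr. Qed.

(** An orthogonal map by the angle 45 degrees, taken as a reflection so that it is its own
    inverse. *)
Definition half_turn (z : BX * BX) : BX * BX :=
  (((Num.sqrt 2)^-1 *: ((z.1 : X) + z.2) : X), ((Num.sqrt 2)^-1 *: ((z.1 : X) - z.2) : X)).

Let mdot1 h : measurable_fun setT (fun z : BX * BX => dot (z.1 : X) h : R).
Proof. exact: (measurableT_comp (measurable_dot normE h) measurable_fst). Qed.
Let mdot2 h : measurable_fun setT (fun z : BX * BX => dot (z.2 : X) h : R).
Proof. exact: (measurableT_comp (measurable_dot normE h) measurable_snd). Qed.

Lemma measurable_half_turn : measurable_fun setT half_turn.
Proof.
apply: measurable_fun_pair; apply: (measurable_borel normE sepX) => h.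
  under eq_fun do rewrite dotZl dotDl.
  by apply: measurable_funM => //; exact: measurable_funD.
under eq_fun do rewrite dotZl dotBl.
by apply: measurable_funM => //; exact: measurable_funB.
Qed.

Lemma half_turnK z : half_turn (half_turn z) = z.
Proof.
case: z => x y; rewrite /half_turn /=; congr pair.
  rewrite -scalerDr scalerA -expr2 -/s2 s2sqr addrACA subrr addr0 -mulr2n.
  by rewrite -scalerMnr scalerMnl -mulr_natr mulVf// scale1r.
rewrite -scalerBr scalerA -expr2 -/s2 s2sqr opprB [(x : X) + y]addrC addrACA subrr addr0 -mulr2n.
by rewrite -scalerMnr scalerMnl -mulr_natr mulVf// scale1r.
Qed.

(** The exponents of the joint characteristic functions agree by the parallelogram identity for the
    form of Q. For the second clause, w |-> - w preserves the law and exchanges the two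
    coordinates. *)
Lemma centered_rotation_invariant Q (gam : probability BX R) :
  nonneg_operator dot Q -> centered gam (fun h => dot (Q h) h) ->
  rotation_invariant half_turn gam.
Proof.
move=> [[lQ _] sQ _] cg.
have par h k : dot (Q (s2 *: (h + k))) (s2 *: (h + k)) + dot (Q (s2 *: (h - k))) (s2 *: (h - k)) =
    dot (Q h) h + dot (Q k) k.
  rewrite !(linearZP lQ) !dotZl !dotZr (linearDP lQ) (linearBP lQ).
  by rewrite !s2s2 !(dotDl, dotDr, dotNl, dotNr); field.
have E h k (z : BX * BX) : dot ((half_turn z).1 : X) h + dot ((half_turn z).2 : X) k =
    dot (z.1 : X) (s2 *: (h + k)) + dot (z.2 : X) (s2 *: (h - k)).
  by rewrite /half_turn /= !dotZl !dotZr !(dotDl, dotDr, dotNl, dotNr) -/s2; ring.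
split.
  move=> F bF; have [nu Hnu] := law_exists (gam \x gam)%E measurable_half_turn.
  have EF k : bounded_measurable k -> \int[nu]_y k y = \int[(gam \x gam)%E]_z k (half_turn z).
    by move=> bk; exact: (@expect_law _ _ _ _ _ (gam \x gam)%E _ nu k measurable_half_turn (fun A _ => Hnu A)).
  rewrite -EF//; apply: expect_eq_measure; apply: (eq_borel_prod_law normE sepX) => h k.
    rewrite EF; last by apply: bm_cos; exact: measurable_funD.
    under eq_Rintegral do rewrite E.
    have [-> _] := centered_prod (s2 *: (h + k)) (s2 *: (h - k)) cg cg.
    by have [-> _] := centered_prod h k cg cg; rewrite par.
  rewrite EF; last by apply: bm_sin; exact: measurable_funD.
  under eq_Rintegral do rewrite E.
  have [_ ->] := centered_prod (s2 *: (h + k)) (s2 *: (h - k)) cg cg.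
  by have [_ ->] := centered_prod h k cg cg.
move=> x f bf.
have mN : measurable_fun setT (fun w : BX => - (w : X) : BX).
  apply: (measurable_borel normE sepX) => h; under eq_fun do rewrite dotNl.
  by apply: measurableT_comp => //; exact: measurable_dot.
have bg : bm (fun w => f (half_turn (x, w)).1).
  exact: (bm_section x (bm_comp measurable_half_turn (bm_comp measurable_fst bf))).
rewrite -(@expect_law_char _ _ gam gam _ mN _ _ _ bg); last 2 first.
- by move=> h; apply: eq_Rintegral => w _; rewrite dotNl cosN.
- move=> h; have [_ ->] := cg h; under eq_Rintegral do rewrite dotNl sinN -mulN1r.
  by rewrite (expectZ _ _ (bm_sin (measurable_dot normE h))); have [_ ->] := cg h; rewrite mulr0.
by apply: eq_Rintegral => w _.
Qed.

End CenteredLaws.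

(** * Gaussian transitions *)

Section GaussianTransition.
Context (R : realType) (X : completeNormedModType R) (dot : {dot X for idfun}).
Hypothesis normE : induces_norm dot.
Hypothesis sepX : separable X.
Local Notation BX := (borel X).
Local Notation bm := (@bounded_measurable _ BX R).

Lemma centered_shift (mu : probability BX R) q a h : centered dot mu q ->
  \int[mu]_y cos (a + dot (y : X) h) = cos a * expR (- (q h / 2)) /\
  \int[mu]_y sin (a + dot (y : X) h) = sin a * expR (- (q h / 2)).
Proof.
move=> /(_ h) [C S].
have bc := bm_cos (measurable_dot normE h); have bs := bm_sin (measurable_dot normE h).
split.
  transitivity (\int[mu]_y (cos a * cos (dot (y : X) h) - sin a * sin (dot (y : X) h))).
    by apply: eq_Rintegral => y _; rewrite cosD.
  rewrite (expectB mu (bmZ (cos a) bc) (bmZ (sin a) bs)).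
  by rewrite (expectZ mu _ bc) (expectZ mu _ bs) C S mulr0 subr0.
transitivity (\int[mu]_y (sin a * cos (dot (y : X) h) + cos a * sin (dot (y : X) h))).
  by apply: eq_Rintegral => y _; rewrite sinD.
rewrite (expectD mu (bmZ (sin a) bc) (bmZ (cos a) bs)).
by rewrite (expectZ mu _ bc) (expectZ mu _ bs) C S mulr0 addr0.
Qed.

(** The factor 1 in [1 *: a] makes the right side an instance of [dilated_transition] at 1. *)
Lemma expect_translate (mu nu : probability BX R) q a f : centered dot mu q ->
  (forall h, \int[nu]_y cos (dot (y : X) h) = cos (dot a h) * expR (- (q h / 2)) /\
    \int[nu]_y sin (dot (y : X) h) = sin (dot a h) * expR (- (q h / 2))) ->
  bm f -> \int[nu]_y f y = \int[mu]_y f (1 *: a + (y : X) : X).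
Proof.
move=> cmu cnu bf.
have mphi : measurable_fun setT (fun y : BX => 1 *: a + (y : X) : BX).
  apply: (measurable_borel normE sepX) => h; under eq_fun do rewrite dotDl.
  by apply: measurable_funD => //; exact: measurable_dot.
apply/esym; apply: (expect_law_char normE sepX mphi _ _ bf) => h;
  under eq_Rintegral do rewrite scale1r dotDl;
  have [C1 S1] := cnu h; have [C2 S2] := centered_shift (dot a h) h cmu.
  by rewrite C1 C2.
by rewrite S1 S2.
Qed.

Section Fixed.
Context (Qs Qt L L' : X -> X).
Hypotheses (nQs : nonneg_operator dot Qs) (nQt : nonneg_operator dot Qt).
Hypotheses (tQs : (trace dot Qs < +oo)%E) (tQt : (trace dot Qt < +oo)%E).
Hypotheses (bL : bounded_operator L) (bL' : bounded_operator L').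
Hypothesis aL : forall x y, dot (L x) y = dot x (L' y).

Local Notation gams := (gaussian dot 0 Qs).
Local Notation gamt := (gaussian dot 0 Qt).

Definition residual (a : R) (x : X) : X := Qt x - a ^+ 2 *: L (Qs (L' x)).

(* Positivity of the covariance Qt - a^2 L Qs L^*. *)
Definition dominated (a : R) :=
  forall k, a ^+ 2 * dot (Qs (L' k)) (L' k) <= dot (Qt k) k.

Let residualE a x y : dot (residual a x) y = dot (Qt x) y - a ^+ 2 * dot (Qs (L' x)) (L' y).
Proof. by rewrite dotBl dotZl aL. Qed.

Let nonneg_residual a : dominated a -> nonneg_operator dot (residual a).
Proof.
move=> da; have [[lt ct] st _] := nQt; have [[ls cs] ss _] := nQs.
have [lL cL] := bL; have [lL' cL'] := bL'.
split; [split|move=> x y|move=> x].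
- move=> b x y; rewrite /residual lL' ls lL lt scalerDr scalerA [_ * b]mulrC -scalerA.
  by rewrite scalerBr opprD addrACA.
- move=> x; apply: cvgB; first exact: ct.
  apply: cvgZr; apply: (continuous_comp (f := fun x => Qs (L' x)) (g := L)); last exact: cL.
  by apply: (continuous_comp (f := L') (g := Qs)); [exact: cL'|exact: cs].
- by rewrite residualE [RHS]dotC residualE st ss dotC; congr (_ - _ * _); rewrite dotC.
- by rewrite residualE subr_ge0.
Qed.

Let trace_residual a : (trace dot (residual a) < +oo)%E.
Proof.
apply: le_lt_trans tQt; apply: le_esum => x _; rewrite lee_fin residualE gerBl.
by rewrite mulr_ge0 ?sqr_ge0//; have [_ _ ->] := nQs.
Qed.

Definition residual_law (a : R) : probability BX R := gaussian dot 0 (residual a).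

Let centered_residual a : dominated a ->
  centered dot (residual_law a) (fun h => dot (residual a h) h).
Proof. by move=> da; exact: (gaussian_centered normE sepX (nonneg_residual da)). Qed.

Let cs : centered dot gams (fun h => dot (Qs h) h).
Proof. exact: (gaussian_centered normE sepX nQs). Qed.
Let ct : centered dot gamt (fun h => dot (Qt h) h).
Proof. exact: (gaussian_centered normE sepX nQt). Qed.

Definition dilated_transition (a : R) (f : BX -> R) (x : BX) : R :=
  \int[residual_law a]_y f (a *: L (x : X) + (y : X) : X).
Local Notation P := dilated_transition.

Lemma measurable_affine a : measurable_fun setT (fun z : BX * BX => a *: L (z.1 : X) + (z.2 : X) : BX).
Proof.
apply: (measurable_borel normE sepX) => h; under eq_fun do rewrite dotDl dotZl aL.
apply: measurable_funD.
  apply: measurable_funM => //.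
  exact: (measurableT_comp (measurable_dot normE (L' h)) measurable_fst).
exact: (measurableT_comp (measurable_dot normE h) measurable_snd).
Qed.

Let bm_affine a (f : BX -> R) : bm f ->
  bounded_measurable (fun z : BX * BX => f (a *: L (z.1 : X) + (z.2 : X) : X)).
Proof. by move=> bf; exact: (bm_comp (measurable_affine a) bf). Qed.

Lemma bm_dilated_transition a f : bm f -> bm (P a f).
Proof. by move=> bf; exact: (bm_fubini1 gams (residual_law a) (bm_affine a bf)). Qed.

(** The covariance a^2 L Qs L' of the first summand and the residual covariance of the noise add up
    to Qt. *)
Lemma expect_affine a f : dominated a -> bm f ->
  \int[(gams \x residual_law a)%E]_z f (a *: L (z.1 : X) + (z.2 : X) : X) = \int[gamt]_x f x.
Proof.
move=> da bf.
apply: (expect_law_char normE sepX (P := (gams \x residual_law a)%E) (measurable_affine a) _ _ bf) => h.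
  have [+ _] := centered_prod normE (a *: L' h) h cs (centered_residual da).
  under eq_Rintegral do rewrite dotZr -aL -dotZl -dotDl.
  move=> ->; have [-> _] := ct h; congr (expR (- (_ / 2))).
  have [[ls _] _ _] := nQs.
  by rewrite residualE (linearZP ls) dotZl dotZr; ring.
have [_] := centered_prod normE (a *: L' h) h cs (centered_residual da).
under eq_Rintegral do rewrite dotZr -aL -dotZl -dotDl.
by move=> ->; have [_ ->] := ct h.
Qed.

Lemma affine_law a (A : set BX) : dominated a -> measurable A ->
  gamt A = (gams \x residual_law a)%E
    ((fun z : BX * BX => a *: L (z.1 : X) + (z.2 : X) : BX) @^-1` A).
Proof.
move=> da mA; have mB := measurable_affine a measurableT mA; rewrite setTI in mB.
rewrite -(fineK (fin_num_measure gamt _ mA)).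
pose prod : probability _ R := (gams \x residual_law a)%E.
have fB : prod ((fun z : BX * BX => a *: L z.1 + z.2) @^-1` A) \is a fin_num := fin_num_measure prod _ mB.
rewrite -[RHS](fineK fB); congr EFin.
rewrite -(expect_indic gamt mA) -(expect_affine da (bm_indic R mA)).
exact: (expect_indic prod mB).
Qed.

(** Jensen in the noise variable, then [expect_affine]. P fixes constants, so c can later be the
    mean. *)
Lemma dilated_transition_contraction a f c p : dominated a -> 1 <= p -> bm f ->
  \int[gams]_x `|P a f x - c| `^ p <= \int[gamt]_x `|f x - c| `^ p.
Proof.
move=> da p1 bf; have p0 : 0 <= p by lra.
have bfc : bm (fun x => f x - c) by apply: bmB => //; exact: bm_cst.
have bfp := bm_powR p0 bfc.
rewrite -[leRHS](expect_affine da bfp) [leRHS](expect_fubini1 gams (residual_law a) (bm_affine a bfp)).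
apply: expect_le.
- by apply: bm_powR => //; apply: bmB; [exact: bm_dilated_transition|exact: bm_cst].
- exact: (bm_fubini1 gams (residual_law a) (bm_affine a bfp)).
move=> x; rewrite /P -[X in _ - X](expect_cst (residual_law a)) -expectB; last exact: bm_cst.
  exact: (jensen_powR _ (bm_section x (bm_affine a bfc)) p1).
exact: (bm_section x (bm_affine a bf)).
Qed.

Let sq2 : Num.sqrt 2 ^+ 2 = 2 :> R. Proof. by rewrite sqr_sqrtr. Qed.
(** Qt - a^2 L Qs L' is half of Qt - 2 a^2 L Qs L' plus half of Qt. The noise of P_a is therefore (y
    + w) / sqrt 2, with y the noise at sqrt 2 * a and w independent of law gamt. *)
Lemma dilated_transition_step a f : dominated (Num.sqrt 2 * a) -> bm f ->
  P a f = P (Num.sqrt 2 * a) (rot_avg (@half_turn _ X) gamt f).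
Proof.
move=> da bf; have da1 : dominated a.
  move=> k; apply: le_trans (da k); rewrite exprMn sq2 -(mulrA 2).
  have [_ _ /(_ (L' k)) Q0] := nQs.
  by rewrite ler_peMl ?ler1n ?(mulr_ge0 (sqr_ge0 a) Q0).
apply/funext => x; rewrite /P /rot_avg.
pose s2 : R := (Num.sqrt 2)^-1.
have mphi : measurable_fun setT (fun z : BX * BX => s2 *: ((z.1 : X) + (z.2 : X)) : BX).
  apply: (measurable_borel normE sepX) => h; under eq_fun do rewrite dotZl dotDl.
  apply: measurable_funM => //; apply: measurable_funD.
    exact: (measurableT_comp (measurable_dot normE h) measurable_fst).
  exact: (measurableT_comp (measurable_dot normE h) measurable_snd).
pose g (y : BX) := f (a *: L (x : X) + (y : X) : X).
have bg : bm g by exact: (bm_section x (bm_affine a bf)).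
have bgphi := bm_comp mphi bg.
transitivity (\int[(residual_law (Num.sqrt 2 * a) \x gamt)%E]_z g (s2 *: ((z.1 : X) + (z.2 : X)) : X)).
  apply/esym; apply: (expect_law_char normE sepX mphi _ _ bg) => h.
    have [+ _] := centered_prod normE (s2 *: h) (s2 *: h) (centered_residual da) ct.
    under eq_Rintegral do rewrite -dotDl dotZr -dotZl.
    move=> ->; have [-> _] := centered_residual da1 h; congr (expR (- (_ / 2))).
    have [[lt _] _ _] := nQt; have [[lr _] _ _] := nonneg_residual da.
    rewrite (linearZP lr) (linearZP lt) !dotZl !dotZr !residualE exprMn sq2.
    by rewrite !mulrA -!expr2 exprVn sq2; field.
  have [_] := centered_prod normE (s2 *: h) (s2 *: h) (centered_residual da) ct.
  under eq_Rintegral do rewrite -dotDl dotZr -dotZl.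
  by move=> ->; have [_ ->] := centered_residual da1 h.
rewrite (expect_fubini1 _ _ bgphi); apply: eq_Rintegral => y _ /=.
apply: eq_Rintegral => w _; rewrite /g /half_turn /=; congr f.
by rewrite -addrA [RHS]scalerDr scalerA mulrA mulVf// mul1r.
Qed.

Lemma dilated_transition_iter k f : (forall j, (j <= k)%N -> dominated (Num.sqrt 2 ^+ j)) -> bm f ->
  P 1 f = P (Num.sqrt 2 ^+ k) (iter k (rot_avg (@half_turn _ X) gamt) f).
Proof.
elim: k => [//|k IH] dk bf; rewrite (IH (fun j jk => dk j (leqW jk)) bf).
rewrite iterS exprS; apply: dilated_transition_step.
  by rewrite -exprS; exact: dk.
exact: (bm_iter_rot_avg (measurable_half_turn normE sepX) gamt k bf).
Qed.

Lemma gaussian_translation (Q1 : X -> X) f x : nonneg_operator dot Q1 -> (trace dot Q1 < +oo)%E ->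
  (forall k, dot (Q1 k) k = dot (Qt k) k - dot (Qs (L' k)) (L' k)) -> bm f ->
  \int[gaussian dot (L x) Q1]_y f y = P 1 f x.
Proof.
move=> nQ1 tQ1 E bf.
have d1 : dominated 1.
  by move=> k; rewrite expr1n mul1r -subr_ge0 -E; have [_ _ ->] := nQ1.
have /(is_gaussianP normE (L x) _ nQ1) G := gaussianP normE sepX (L x) nQ1 tQ1.
apply: (expect_translate (centered_residual d1) _ bf) => h.
have [G1 G2] := G h.
by rewrite residualE expr1n mul1r -E; split; [exact: G1|exact: G2].
Qed.

End Fixed.

End GaussianTransition.

(** * Decay of the transition on bounded functions *)

Section TransitionDecay.
Context (R : realType).

Lemma dyadic_scale (r : R) : 0 < r <= 1 ->
  exists k : nat, 2 ^+ k * r ^+ 2 <= 1 /\ 1 < 2 ^+ k.+1 * r ^+ 2.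
Proof.
move=> /andP[r0 r1]; have r20 : 0 < r ^+ 2 by rewrite exprn_gt0.
have E : exists n, 1 < 2 ^+ n * r ^+ 2.
  have [n Hn] : exists n : nat, (r ^+ 2)^-1 < n%:R.
    by exists (Num.Def.trunc (r ^+ 2)^-1).+1; rewrite truncnS_gt// invr_ge0 ltW.
  exists n; rewrite -ltr_pdivrMr// div1r (lt_le_trans Hn)// -natrX ler_nat ltnW//.
  exact: ltn_expl.
have [[|k] Hk Hmin] := ex_minnP E.
  by move: Hk; rewrite expr0 mul1r ltNge expr_le1 ?r1// ltW.
exists k; split=> //; rewrite leNgt; apply/negP => /Hmin; by rewrite ltnn.
Qed.

(* The number k of doublings is as large as the domination by r allows, so that
   2^-k < 2 r^2. *)
Lemma dyadic_decay_bound (r K p I J : R) : 0 <= r <= 1 -> 0 < K -> 1 < p -> 0 <= J ->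
  (forall k : nat, 2 ^+ k * r ^+ 2 <= 1 -> I <= K * (2 `^ (- (p / 2))) ^+ k * J) ->
  I <= ((K * 2 `^ (p / 2)) `^ p^-1 * r) `^ p * J.
Proof.
move=> /andP[r0 r1] K0 p1 J0 H; have p0 : p != 0 by lra.
have pp : 0 <= p / 2 by lra.
have hp : 0 <= p by lra.
rewrite powRM ?powR_ge0// -powRrM mulVf// powRr1 ?mulr_ge0 ?powR_ge0 ?(ltW K0)//.
have q2 k : (2 `^ (- (p / 2))) ^+ k = ((2 ^+ k)^-1) `^ (p / 2) :> R.
  elim: k => [|k IHk]; first by rewrite !expr0 invr1 powR1.
  rewrite exprS IHk exprS invfM powRM ?invr_ge0 ?exprn_ge0//; congr (_ * _).
  have -> : (2^-1 : R) `^ (p / 2) = (2 `^ (- 1)) `^ (p / 2).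
    by congr (_ `^ _); rewrite powR_inv1.
  by rewrite -powRrM mulN1r.
move: r0; rewrite le_eqVlt => /predU1P[r0|r0]; last first.
  have [|k [H1 H2]] := @dyadic_scale r; first by rewrite r0 r1.
  apply: (le_trans (H k H1)); rewrite ler_wpM2r// -mulrA ler_wpM2l ?(ltW K0)// q2.
  have -> : r `^ p = (r ^+ 2) `^ (p / 2).
    by rewrite -powR_mulrn ?(ltW r0)// -powRrM; congr (_ `^ _); field.
  rewrite -powRM ?exprn_ge0 ?(ltW r0)//; apply: ge0_ler_powR => //.
  - by rewrite nnegrE invr_ge0 exprn_ge0.
  - by rewrite nnegrE mulr_ge0 ?exprn_ge0 ?(ltW r0).
  have k0 : 0 < 2 ^+ k :> R by rewrite exprn_gt0.
  by rewrite -[leLHS]div1r ler_pdivrMr// mulrC mulrA -exprSr ltW.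
(* For r = 0 every k is allowed, and letting k tend to infinity forces I <= 0. *)
rewrite -r0 powR0// mulr0 mul0r.
set q : R := 2 `^ (- (p / 2)) in H.
have q1 : `|q| < 1.
  have pp2 : 0 < p / 2 by lra.
  have h2 : 2^-1 < 1 :> R by lra.
  rewrite ger0_norm ?powR_ge0// -[q]expr1 q2 expr1.
  by have := gt0_ltr_powR pp2 _ _ h2; rewrite powR1; apply; rewrite nnegrE.
have c : K * q ^+ k * J @[k --> \oo] --> K * 0 * J.
  by apply: cvgMl; apply: cvgMr; exact: cvg_expr.
rewrite mulr0 mul0r in c; rewrite -(cvg_lim _ c)//; apply: limr_ge; first by apply/cvg_ex; exists 0.
by near=> k; apply: H; rewrite -r0 expr0n mulr0.
Unshelve. all: by end_near. Qed.

Context (X : completeNormedModType R) (dot : {dot X for idfun}).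
Hypothesis normE : induces_norm dot.
Hypothesis sepX : separable X.

(** C is fixed before the operators, because it must serve all pairs s < t. *)
Lemma dilated_transition_decay p : 1 < p -> exists2 C : R, 0 < C &
  forall Qs Qt L L' : X -> X, nonneg_operator dot Qs -> nonneg_operator dot Qt ->
    (trace dot Qs < +oo)%E -> (trace dot Qt < +oo)%E ->
    bounded_operator L -> bounded_operator L' ->
    (forall x y, dot (L x) y = dot x (L' y)) ->
    forall r : R, 0 <= r <= 1 ->
    (forall k, dot (Qs (L' k)) (L' k) <= r ^+ 2 * dot (Qt k) k) ->
    forall f : borel X -> R, bounded_measurable f ->
    \int[gaussian dot 0 Qs]_x
      `|dilated_transition dot Qs Qt L L' 1 f x - \int[gaussian dot 0 Qt]_y f y| `^ p <=
    (C * r) `^ p * \int[gaussian dot 0 Qt]_x `|f x| `^ p.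
Proof.
move=> p1; have [K K0 HK] := rot_avg_decay (measurable_half_turn normE sepX) (@half_turnK _ X) p1.
exists ((K * 2 `^ (p / 2)) `^ p^-1); first by rewrite powR_gt0// mulr_gt0// powR_gt0.
move=> Qs Qt L L' nQs nQt tQs tQt bL bL' aL r r01 dr f bf.
apply: dyadic_decay_bound => // [|k kr].
  by apply: expect_ge0 => x; exact: powR_ge0.
have D j : (j <= k)%N -> dominated dot Qs Qt L' (Num.sqrt 2 ^+ j).
  move=> jk h; rewrite -exprM mulnC exprM sqr_sqrtr//.
  have [_ _ /(_ h) Q0] := nQt.
  rewrite (le_trans (ler_wpM2l _ (dr h))) ?exprn_ge0// mulrA ler_piMl//.
  by rewrite (le_trans _ kr)// ler_wpM2r ?sqr_ge0// ler_weXn2l// ler1n.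
rewrite (dilated_transition_iter normE sepX nQs nQt tQt bL bL' aL D bf).
have rg := centered_rotation_invariant normE sepX nQt (gaussian_centered normE sepX nQt tQt).
have bk := bm_iter_rot_avg (measurable_half_turn normE sepX) (gaussian dot 0 Qt) k bf.
apply: le_trans (HK _ rg f bf k).
exact: (dilated_transition_contraction normE sepX nQs nQt tQs tQt bL bL' aL _ (D k (leqnn k)) (ltW p1) bk).
Qed.

End TransitionDecay.

(** * Extension to Lp *)

Lemma Lnorm_EFinE d (T : measurableType d) (R : realType) (mu : probability T R) (p : R)
    (h : T -> R) :
  ('N[mu]_p%:E[EFin \o h] = (\int[mu]_x (`|h x| `^ p)%:E) `^ p^-1)%E.
Proof. by rewrite unlock. Qed.

(** Jensen's inequality for the truncations of u, whose bounds pass to u itself; in particular u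
    becomes integrable. *)
Lemma integral_le_powR_root d (T : measurableType d) (R : realType) (mu : probability T R)
    (u : T -> R) (p c : R) : measurable_fun setT u -> (forall x, 0 <= u x) -> 1 <= p ->
  (\int[mu]_x (u x `^ p)%:E <= c%:E)%E -> (\int[mu]_x (u x)%:E <= (c `^ p^-1)%:E)%E.
Proof.
move=> mu_ u0 p1 H; have p0 : 0 <= p by lra.
have pn : p != 0 by lra.
apply: ge0_integral_le => // n; have bt := bm_trunc n mu_ u0.
have t0 x : 0 <= Num.min (u x) n%:R by rewrite le_min u0 ler0n.
have I0 := expect_ge0 mu t0.
have J := jensen_powR mu bt p1; rewrite (ger0_norm I0) in J.
set m := Rintegral _ _ _ in I0 J *.
have -> : m = (m `^ p) `^ p^-1 by rewrite -powRrM mulfV// powRr1.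
apply: ge0_ler_powR.
- by rewrite invr_ge0.
- by rewrite nnegrE powR_ge0.
- rewrite nnegrE -lee_fin; apply: le_trans H.
  by apply: integral_ge0 => x _; rewrite lee_fin powR_ge0.
apply: (le_trans J).
rewrite -lee_fin -expect_EFin; last exact: bm_powR.
apply: le_trans H; apply: ge0_le_integral => //.
- by apply/measurable_EFinP; case: (bm_powR p0 bt).
- by apply/measurable_EFinP; apply: (measurableT_comp (measurable_powR p)).
- move=> x _; rewrite lee_fin ger0_norm//; apply: ge0_ler_powR; rewrite ?nnegrE//.
  by rewrite ge_min lexx.
Qed.

Lemma Lfun_EFin_integrable d (T : measurableType d) (R : realType) (mu : probability T R)
    (f : T -> R) (p : R) : 1 <= p -> f \in Lfun mu p%:E ->
  measurable_fun setT f /\ mu.-integrable setT (EFin \o f).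
Proof.
move=> p1 fp; have mf : measurable_fun setT f by have := sub_Lfun_mfun fp; rewrite inE.
split=> //; have ip := Lfun_integrable p1 fp.
apply/integrableP; split; first exact/measurable_EFinP.
have mn : measurable_fun setT (fun x => `|f x|) by exact: measurableT_comp.
have := @integral_le_powR_root _ _ _ mu _ p (fine (\int[mu]_x (`|f x| `^ p)%:E)) mn
  (fun x => normr_ge0 _) p1.
rewrite fineK ?lexx; last exact: (integrable_fin_num measurableT ip).
by move=> /(_ isT) /le_lt_trans; apply; exact: ltry.
Qed.

Lemma expect_sub_Lnorm d (T : measurableType d) (R : realType) (mu : probability T R)
    (f g : T -> R) (p : R) : 1 <= p -> bounded_measurable g -> f \in Lfun mu p%:E ->
  (`|\int[mu]_x g x - \int[mu]_x f x|%:E <= 'N[mu]_p%:E[EFin \o (g \- f)%R])%E.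
Proof.
move=> p1 bg /(Lfun_EFin_integrable p1)[mf fi]; have [mg _] := bg.
have pn : p != 0 by lra.
have ig := bm_integrable mu bg.
rewrite -RintegralB// Lnorm_EFinE.
have mn : measurable_fun setT (fun x => `|g x - f x|).
  by apply: measurableT_comp => //; exact: measurable_funB.
have I0 : (0 <= \int[mu]_x (`|g x - f x| `^ p)%:E)%E by exact: integral_ge0.
have igf : mu.-integrable setT (EFin \o (fun x => g x - f x)).
  exact: (integrableB measurableT ig fi).
(* An infinite L^p distance makes the right side +oo, and only the finite case needs Jensen. *)
case E : (\int[mu]_x (`|g x - f x| `^ p)%:E)%E I0 => [c| |] //= c0; last first.
  by rewrite gt_eqF ?leey// invr_gt0; lra.
have := @integral_le_powR_root _ _ _ mu _ p c mn (fun x => normr_ge0 _) p1.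
rewrite E lexx => /(_ isT); apply: le_trans.
rewrite -[leRHS]fineK; last exact: (integrable_fin_num measurableT (integrable_norm igf)).
by rewrite lee_fin; exact: (le_normr_Rintegral measurableT igf).
Qed.

(** Clamping f to [-n, n] moves no value by more than |f|, so |f|^p dominates the error. *)
Lemma Lnorm_clamp_cvg d (T : measurableType d) (R : realType) (mu : probability T R)
    (f : T -> R) (p : R) : 1 <= p -> f \in Lfun mu p%:E ->
  exists phi : nat -> T -> R, (forall n, bounded_measurable (phi n)) /\
    ('N[mu]_p%:E[EFin \o (phi n \- f)%R] @[n --> \oo] --> 0)%E.
Proof.
move=> p1 fp; have [mf _] := Lfun_EFin_integrable p1 fp.
have pn : p != 0 by lra.
have p0 : 0 <= p by lra.
pose phi (n : nat) x := Num.max (- n%:R) (Num.min (f x) n%:R).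
have bphi n : bounded_measurable (phi n).
  split; first by apply: measurable_maxr => //; exact: measurable_minr.
  by exists n%:R => x; rewrite ler_norml le_max lexx/= ge_max ge_min lexx orbT andbT ge0_cp.
exists phi; split=> //.
have phile n x : `|phi n x - f x| <= `|f x|.
  rewrite /phi; have n0 : 0 <= n%:R :> R by [].
  have [f0|f0] := leP 0 (f x).
    have -> : Num.max (- n%:R) (Num.min (f x) n%:R) = Num.min (f x) n%:R.
      by apply/max_idPr; rewrite le_min; apply/andP; split; lra.
    by have [fn|fn] := leP (f x) n%:R; rewrite ?subrr ?normr0// ler0_norm ?ger0_norm//; lra.
  have -> : Num.min (f x) n%:R = f x by apply/min_idPl; lra.
  by have [fn|fn] := leP (- n%:R) (f x); rewrite ?subrr ?normr0// ger0_norm ?ltr0_norm//; lra.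
have phicvg x : \forall n \near \oo, phi n x = f x.
  near=> n; have fn : `|f x| <= n%:R by near: n; exact: nbhs_infty_ger.
  by move: fn; rewrite ler_norml => /andP[fn1 fn2]; rewrite /phi (min_idPl fn2); apply/max_idPr.
have mphi n : measurable_fun setT (fun x => (`|phi n x - f x| `^ p)%:E).
  apply/measurable_EFinP; apply: (measurableT_comp (measurable_powR p)).
  apply: measurableT_comp => //; apply: measurable_funB => //; by case: (bphi n).
have H : (\int[mu]_x (`|phi n x - f x| `^ p)%:E @[n --> \oo] --> \int[mu]_x (0 : \bar R))%E.
  apply: (@dominated_cvg _ _ _ mu setT measurableT _ _ (fun x => (`|f x| `^ p)%:E)) => //.
  - move=> x _; apply: cvg_near_cst; near=> n.
    by rewrite (near (phicvg x) n)// subrr normr0 powR0.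
  - exact: (Lfun_integrable p1 fp).
  - move=> n x _; rewrite lee_fin ger0_norm ?powR_ge0//.
    by apply: ge0_ler_powR; rewrite ?nnegrE.
rewrite integral0 in H.
have [F1 F2] := (fine_cvgP _ _).1 H.
apply/fine_cvgP; split.
  near=> n; rewrite Lnorm_EFinE fin_num_poweR//; by near: n.
apply/cvgr0Pnorm_lt => e e0; have ep : 0 < e `^ p by rewrite powR_gt0.
near=> n; rewrite /= Lnorm_EFinE.
have fin : (\int[mu]_x (`|phi n x - f x| `^ p)%:E)%E \is a fin_num by near: n.
have I0 : (0 <= \int[mu]_x (`|phi n x - f x| `^ p)%:E)%E by apply: integral_ge0 => x _; rewrite lee_fin powR_ge0.
have : `|fine (\int[mu]_x (`|phi n x - f x| `^ p)%:E)| < e `^ p.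
  by near: n; exact: (cvgr0_norm_lt _ F2 _ ep).
rewrite -(fineK fin) in I0 *; move: (fine _) I0 => a a0; rewrite lee_fin in a0.
rewrite /= (ger0_norm a0) ger0_norm ?powR_ge0// => ae.
have -> : e = (e `^ p) `^ p^-1 by rewrite -powRrM mulfV// powRr1// ltW.
by apply: gt0_ltr_powR; rewrite ?nnegrE ?powR_ge0// ?invr_gt0; lra.
Unshelve. all: by end_near. Qed.

Section LpExtension.
Context d1 (T1 : measurableType d1) d2 (T2 : measurableType d2) d3 (T3 : measurableType d3).
Context (R : realType) (mu1 : probability T1 R) (mu2 : probability T2 R) (nu : probability T3 R).
Context (phi : T1 * T2 -> T3).
Hypothesis mphi : measurable_fun setT phi.
Hypothesis Hnu : forall A, measurable A -> nu A = (mu1 \x mu2)%E (phi @^-1` A).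

Definition partial_mean (f : T3 -> R) (x : T1) : R := \int[mu2]_y f (phi (x, y)).
Local Notation K := partial_mean.

(** Sections of f may fail to be integrable, so the extended integral is written as a difference of
    two measurable Tonelli integrals, which [fine] makes real. *)
Lemma measurable_partial_mean f : measurable_fun setT f -> measurable_fun setT (K f).
Proof.
move=> mf; have mh : measurable_fun setT (fun z => (f (phi z))%:E).
  by apply/measurable_EFinP; exact: measurableT_comp.
apply: (measurableT_comp (f := fine)) => //.
apply: (eq_measurable_fun (fun x => \int[mu2]_y ((fun z => (f (phi z))%:E)^\+ (x, y)) -
   \int[mu2]_y ((fun z => (f (phi z))%:E)^\- (x, y)))%E).
  move=> x _; rewrite [RHS]integralE; congr (_ - _)%E; apply: eq_integral => y _.
    by rewrite !funeposE.
  by rewrite !funenegE.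
apply: emeasurable_funB.
  apply: (measurable_fun_fubini_tonelli_F (m2 := mu2) (fun z => (f (phi z))%:E)^\+%E) => //.
  exact: measurable_funepos.
apply: (measurable_fun_fubini_tonelli_F (m2 := mu2) (fun z => (f (phi z))%:E)^\-%E) => //.
exact: measurable_funeneg.
Qed.


(** Jensen on each section, then Tonelli. Where the inner L^p integral is infinite the bound is
    trivial; where it is finite, the section of f is integrable because g is bounded. *)
Lemma partial_mean_Lp p f g : 1 <= p -> bounded_measurable g -> measurable_fun setT f ->
  ('N[mu1]_p%:E[EFin \o (K g \- K f)%R] <= 'N[nu]_p%:E[EFin \o (g \- f)%R])%E.
Proof.
move=> p1 bg mf; have [mg _] := bg.
have pp : 0 < p by lra.
have p0 : 0 <= p by lra.
have pn : p != 0 by lra.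
rewrite !Lnorm_EFinE; apply: gt0_ler_poweR.
- by rewrite invr_ge0.
- by rewrite in_itv/= integral_ge0// leey.
- by rewrite in_itv/= integral_ge0// leey.
have mgf : measurable_fun setT (fun x => g x - f x) by exact: measurable_funB.
have mp : measurable_fun setT (fun x => (`|g x - f x| `^ p)%:E).
  apply/measurable_EFinP; apply: (measurableT_comp (measurable_powR p)).
  exact: (measurableT_comp _ mgf).
have pos z : (0 <= (`|g z - f z| `^ p)%:E)%E by rewrite lee_fin powR_ge0.
rewrite [leRHS](ge0_expect_law mphi Hnu mp pos).
have mpphi : measurable_fun setT (fun z => (`|g (phi z) - f (phi z)| `^ p)%:E) by exact: (measurableT_comp mp mphi).
have posphi z : (0 <= (`|g (phi z) - f (phi z)| `^ p)%:E)%E by rewrite lee_fin powR_ge0.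
rewrite (fubini_tonelli1 _ mpphi posphi).
apply: ge0_le_integral => //.
- apply/measurable_EFinP; apply: (measurableT_comp (measurable_powR p)).
  apply: measurableT_comp => //; apply: measurable_funB; exact: measurable_partial_mean.
- exact: (measurable_fun_fubini_tonelli_F _ mpphi posphi).
move=> x _; rewrite /fubini_F /=.
have mx : measurable_fun setT (fun y => phi (x, y)) by apply: (measurableT_comp mphi); exact: measurable_fun_pair.
have I0 : (0 <= \int[mu2]_y (`|g (phi (x, y)) - f (phi (x, y))| `^ p)%:E)%E.
  by apply: integral_ge0 => y _; exact: posphi.
case E : (\int[mu2]_y (`|g (phi (x, y)) - f (phi (x, y))| `^ p)%:E)%E I0 => [c| |] //= c0; last by rewrite leey.
rewrite lee_fin in c0.
have mu_ : measurable_fun setT (fun y => `|g (phi (x, y)) - f (phi (x, y))|).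
  by apply: (measurableT_comp _ (measurableT_comp mgf mx)).
have := @integral_le_powR_root _ _ _ mu2 _ p c mu_ (fun y => normr_ge0 _) p1; rewrite E lexx => /(_ isT) L.
have bgx := bm_comp mx bg.
have igf : mu2.-integrable setT (EFin \o (fun y => g (phi (x, y)) - f (phi (x, y)))).
  apply/integrableP; split; first by apply/measurable_EFinP; exact: (measurableT_comp mgf mx).
  exact: le_lt_trans L (ltry _).
have ig := bm_integrable mu2 bgx.
have if_ : mu2.-integrable setT (EFin \o (fun y => f (phi (x, y)))).
  apply: eq_integrable (integrableB measurableT ig igf) => // y _ /=.
  by rewrite -EFinB opprB addrC subrK.
have -> : K g x - K f x = \int[mu2]_y (g (phi (x, y)) - f (phi (x, y))) by rewrite RintegralB.
have -> : c = (c `^ p^-1) `^ p by rewrite -powRrM mulVf// powRr1.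
rewrite lee_fin; apply: ge0_ler_powR; rewrite ?nnegrE ?powR_ge0//.
apply: le_trans (le_normr_Rintegral _ igf) _ => //.
by rewrite -lee_fin fineK// (integrable_fin_num measurableT (integrable_norm igf)).
Qed.

(** [get] may return any h reached along some bounded sequence, so the bound is shown for all of
    them: h - m is compared with the centered [K (psi n)], with errors [a n] and [b n] that vanish.
    [Pt] is tied to K on bounded functions only, where [transition] is the actual Gaussian
    integral. *)
Lemma partial_mean_extension (p c : R) (f : T3 -> R) (Pt : (T3 -> R) -> T1 -> R) :
  1 <= p -> 0 <= c -> f \in Lfun nu p%:E ->
  (forall g, bounded_measurable g -> Pt g = K g) ->
  (forall g, bounded_measurable g ->
    \int[mu1]_x `|K g x - \int[nu]_y g y| `^ p <= c `^ p * \int[nu]_x `|g x| `^ p) ->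
  ('N[mu1]_p%:E[EFin \o (get [set h | h \in Lfun mu1 p%:E /\ exists phi : nat -> T3 -> R,
      [/\ forall n, bounded_measurable (phi n),
          ('N[nu]_p%:E[EFin \o (phi n \- f)%R])%E @[n --> \oo] --> 0%E
        & ('N[mu1]_p%:E[EFin \o (Pt (phi n) \- h)%R])%E @[n --> \oo] --> 0%E]]
      \- cst (\int[nu]_x f x))%R] <= c%:E * 'N[nu]_p%:E[EFin \o f])%E.
Proof.
move=> p1 c0 fp HP HK; set ext := [set h | _]; have [mf fi] := Lfun_EFin_integrable p1 fp.
have pn : p != 0 by lra.
have p0 : 0 <= p by lra.
have Nf : ('N[nu]_p%:E[EFin \o f])%E \is a fin_num.
  by rewrite ge0_fin_numE ?Lnorm_ge0//; have := sub_Lfun_finLfun fp; rewrite inE.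
have mK g : bounded_measurable g -> measurable_fun setT (K g).
  by move=> [mg _]; exact: measurable_partial_mean.
(* The set is not empty: K contracts, so K f is a limit along the clamped functions. *)
have [] : ext (get ext).
  apply: getPex; exists (K f); split.
    rewrite inE; apply/andP; split; rewrite inE/=; first exact: measurable_partial_mean.
    have b0 : bounded_measurable (fun _ : T3 => 0 : R) by exact: bm_cst.
    have := partial_mean_Lp p1 b0 mf.
    rewrite (eq_Lnorm mu1 p%:E (g := \- (EFin \o K f))%E); last first.
      by move=> x /=; rewrite /K (expect_cst mu2) sub0r.
    rewrite (eq_Lnorm nu p%:E (g := \- (EFin \o f))%E); last by move=> x /=; rewrite sub0r.
    rewrite !oppe_Lnorm => /le_lt_trans; apply.
    by rewrite -ge0_fin_numE ?Lnorm_ge0.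
  have [psi [bpsi psif]] := Lnorm_clamp_cvg p1 fp; exists psi; split=> //.
  apply: (squeeze_cvge _ (@cvg_cst _ 0%E _ _ _) psif).
  by near=> n; rewrite Lnorm_ge0/= HP//; exact: partial_mean_Lp.
move: (get ext) => h hp [psi [bpsi psif psih]].
have [mh _] := Lfun_EFin_integrable p1 hp.
set m := \int[nu]_x f x.
pose a n := ('N[mu1]_p%:E[EFin \o (Pt (psi n) \- h)%R])%E; rewrite -/a in psih.
pose b n := ('N[nu]_p%:E[EFin \o (psi n \- f)%R])%E.
have key n : ('N[mu1]_p%:E[EFin \o (h \- cst m)%R] <=
    a n + (c%:E * ('N[nu]_p%:E[EFin \o f] + b n) + b n))%E.
  have [mpsin _] := bpsi n; have mKn := mK _ (bpsi n).
  pose mn := \int[nu]_x psi n x.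
  apply: (@le_trans _ _ ('N[mu1]_p%:E[EFin \o (h \- K (psi n))%R] +
      'N[mu1]_p%:E[EFin \o (K (psi n) \- cst m)%R]))%E.
    rewrite (eq_Lnorm mu1 p%:E (g := EFin \o ((h \- K (psi n)) \+ (K (psi n) \- cst m))%R)); last first.
      by move=> x /=; congr EFin; rewrite addrA subrK.
    by apply: minkowski_EFin => //; apply: measurable_funB.
  apply: leeD.
    rewrite /a HP// (eq_Lnorm mu1 p%:E (g := \- (EFin \o (K (psi n) \- h)%R))%E); last first.
      by move=> x /=; rewrite opprB.
    by rewrite oppe_Lnorm.
  apply: (@le_trans _ _ ('N[mu1]_p%:E[EFin \o (K (psi n) \- cst mn)%R] +
      'N[mu1]_p%:E[EFin \o cst (mn - m)%R]))%E.
    rewrite (eq_Lnorm mu1 p%:E (g := EFin \o ((K (psi n) \- cst mn) \+ cst (mn - m))%R)); last first.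
      by move=> x /=; congr EFin; rewrite addrA subrK.
    by apply: minkowski_EFin => //; apply: measurable_funB.
  apply: leeD; last first.
    apply: le_trans (expect_sub_Lnorm p1 (bpsi n) fp); rewrite Lnorm_EFinE.
    rewrite (expect_EFin mu1 (bm_cst T1 (`|mn - m| `^ p))) expect_cst.
    by rewrite poweR_EFin -powRrM mulfV// powRr1.
  apply: (@le_trans _ _ (c%:E * 'N[nu]_p%:E[EFin \o psi n]))%E.
    have b1 : bounded_measurable (fun x => K (psi n) x - mn).
      apply: bmB; last exact: bm_cst.
      exact: (bm_fubini1 mu1 mu2 (bm_comp mphi (bpsi n))).
    rewrite !Lnorm_EFinE (expect_EFin mu1 (bm_powR p0 b1)) (expect_EFin nu (bm_powR p0 (bpsi n))).
    rewrite !poweR_EFin -EFinM lee_fin.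
    have -> : c = (c `^ p) `^ p^-1 by rewrite -powRrM mulfV// powRr1.
    rewrite -powRM ?powR_ge0//; last by apply: expect_ge0 => x; exact: powR_ge0.
    apply: ge0_ler_powR; last exact: HK.
    - by rewrite invr_ge0.
    - by rewrite nnegrE; apply: expect_ge0 => x; exact: powR_ge0.
    - by rewrite nnegrE mulr_ge0 ?powR_ge0//; apply: expect_ge0 => x; exact: powR_ge0.
  apply: lee_wpmul2l; first by rewrite lee_fin.
  rewrite (eq_Lnorm nu p%:E (g := EFin \o (f \+ (psi n \- f))%R)); last first.
    by move=> x /=; congr EFin; rewrite addrC subrK.
  by apply: minkowski_EFin => //; exact: measurable_funB.
have L : ((a n + (c%:E * ('N[nu]_p%:E[EFin \o f] + b n) + b n)) @[n --> \oo] -->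
    0 + (c%:E * ('N[nu]_p%:E[EFin \o f] + 0) + 0))%E.
  apply: (cvgeD _ psih); first by rewrite fin_num_adde_defr.
  apply: (cvgeD _ _ psif); first by rewrite fin_num_adde_defl.
  apply: cvgeZl => //; apply: (cvgeD _ (cvg_cst _) psif).
  by rewrite fin_num_adde_defl.
rewrite add0e !adde0 in L; rewrite -(cvg_lim _ L)//.
apply: lime_ge; first by apply/cvg_ex; eexists; exact: L.
by near=> n; exact: key.
Unshelve. all: by end_near. Qed.

End LpExtension.

(** By [Q_infty_split] the noise covariance Q(t,s) is Qt - U Qs U^*, the residual at a = 1. *)
Lemma transitionE (R : realType) (X : completeNormedModType R)
    (dot : {dot X for idfun}) (U : R -> R -> X -> X) (B : R -> X -> X) :
  induces_norm dot -> separable X -> evolution_operator U ->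
  bounded_strongly_measurable B -> finite_traces dot U B -> stable dot U B ->
  forall s t g, s < t -> bounded_measurable g ->
  transition dot U B s t g = dilated_transition dot (Q_infty dot U B s) (Q_infty dot U B t)
    (U t s) (adjoint dot (U t s)) 1 g.
Proof.
move=> normE sepX hU hB fT hS s t g st bg; apply/funext => x.
have bU : bounded_operator (U t s) by have [H _ _ _] := hU; exact/H/ltW.
have [bU' aU] := adjointP normE bU.
have [nQt _] := Q_inftyP normE sepX hU hB hS t.
have [nQs _] := Q_inftyP normE sepX hU hB hS s.
have [nQ _] := Q_P normE sepX hU hB (ltW st).
rewrite /transition (lt_eqF st).
apply: (gaussian_translation normE sepX nQs nQt (trace_Q_infty normE sepX hU hB hS t) bU bU' aU x nQ (fT _ _ st) _ bg) => k.
by rewrite (Q_infty_split normE sepX hU hB hS k k (ltW st)) addrK.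
Qed.

Theorem proposition5p9 (R : realType) (X : completeNormedModType R)
    (dot : {dot X for idfun}) (U : R -> R -> X -> X) (B : R -> X -> X) :
  induces_norm dot -> separable X ->
  evolution_operator U ->
  bounded_strongly_measurable B ->
  finite_traces dot U B ->
  stable dot U B ->
  forall p : R, 1 < p ->
  exists2 c : R, 0 < c &
    forall (f : borel X -> R) (s t : R),
      f \in Lfun (gamma dot U B t) p%:E -> s < t ->
      ('N[gamma dot U B s]_p%:E
         [EFin \o (transition_Lp dot U B p s t f \- cst (mean dot U B t f))%R]
       <= c%:E * norm_U_cm dot U B t s
          * 'N[gamma dot U B t]_p%:E [EFin \o f])%E.
Proof.
move=> normE sepX hU hB fT hS p p1.
have [C C0 HC] := dilated_transition_decay normE sepX p1.
exists C => // f s t fp st.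
have bU : bounded_operator (U t s) by have [H _ _ _] := hU; exact/H/ltW.
have [bU' aU] := adjointP normE bU.
have [nQt _] := Q_inftyP normE sepX hU hB hS t.
have [nQs _] := Q_inftyP normE sepX hU hB hS s.
have tQt := trace_Q_infty normE sepX hU hB hS t.
have tQs := trace_Q_infty normE sepX hU hB hS s.
have [r -> [r01 dr]] := norm_U_cmP normE sepX hU hB hS (ltW st).
have [r0 r1] := andP r01.
(* As r <= 1, the domination by r implies the one at a = 1, under which the law gamma_t is the image
   of gamma_s and the noise. *)
have d1 : dominated dot (Q_infty dot U B s) (Q_infty dot U B t) (adjoint dot (U t s)) 1.
  move=> k; rewrite expr1n mul1r (le_trans (dr k))// ler_piMl//; last by rewrite expr_le1.
  by have [_ _ ->] := nQt.
rewrite -EFinM.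
have Cr : 0 <= C * r by rewrite mulr_ge0// ltW.
have mphi := measurable_affine normE sepX aU 1.
have Hnu A := @affine_law _ _ _ normE sepX _ _ _ _ nQs nQt tQs tQt bU bU' aU 1 A d1.
have HP g : bounded_measurable g -> transition dot U B s t g = partial_mean (residual_law dot (Q_infty dot U B s) (Q_infty dot U B t)
    (U t s) (adjoint dot (U t s)) 1) (fun z : borel X * borel X => 1 *: U t s z.1 + z.2 : borel X) g.
  exact: transitionE.
have HK := HC _ _ _ _ nQs nQt tQs tQt bU bU' aU r r01 dr.
(* [transition_Lp], [bounded_borel] and [mean] unfold to the terms of this instance. *)
have M := partial_mean_extension mphi Hnu (ltW p1) Cr fp HP HK.
exact: M.
Qed.
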